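(* For every good atlas $\mathcal U$, the triple $$\overline{\mathcal S}_{\mathcal U}=(\overline{\mathsf F}^*_{\mathcal U},\overline{\mathsf E}^*_{\mathcal U},\overline{\mathsf I}^*_{\mathcal U}):=\big(\mathsf{Tot}(\overline{\mathsf C}^*(\mathcal U,\Omega^* )),\ \overline\Omega^*(\mathcal U),\ \overline{\mathsf C}^*(\mathcal U,\mathbb Z)\big)$$ is a spark complex.
   Context: **Charts and atlases.** All spaces are paracompact, second countable and Hausdorff; all charts and atlases are effective and of a fixed dimension $n$. A chart over a connected open subset $U\subseteq X$ is a triple $(\tilde U,G,\pi)$ where $\tilde U\subseteq\mathbb R^n$ is connected and open, $G<\mathrm{Diff}(\tilde U)$ is a finite group of smooth automorphisms acting effectively on $\tilde U$, and $\pi:\tilde U\to U$ is a continuous, surjective, $G$-invariant map inducing a homeomorphism $\tilde U/G\cong U$. The case $\tilde U=\varnothing$ (trivial group, empty map) is allowed. For open $U\subseteq V\subseteq X$, an embedding $\lambda:(\tilde U,G,\pi)\to(\tilde V,H,\tau)$ of charts is a smooth embedding $\lambda:\tilde U\to\tilde V$ with $\tau\circ\lambda=\pi$. An atlas on $X$ is a family $\mathcal U=\{(\tilde U_i,G_i,\pi_i)\mid i\in I\}$ of charts on $X$ such that the sets $U_i=\pi_i(\tilde U_i)$ cover $X$ and for each $x\in U_i\cap U_j$ there is a chart $(\tilde U_k,G_k,\pi_k)\in\mathcal U$ with $x\in U_k\subseteq U_i\cap U_j$ and embeddings of it into $(\tilde U_i,G_i,\pi_i)$ and $(\tilde U_j,G_j,\pi_j)$.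 **Good atlases.** A good atlas on $X$ is an atlas $\mathcal U=\{(\tilde U_I,G_I,\pi_I)\mid I\in\mathsf{Fin}(V_{\mathcal U})\}$ such that, with $U_I=\pi_I(\tilde U_I)$: (1) $V_{\mathcal U}$ is a countable set and $\mathsf{Fin}(V_{\mathcal U})$ is the set of all non-empty finite subsets of $V_{\mathcal U}$; (2) $\{U_i:=U_{\{i\}}\mid i\in V_{\mathcal U}\}$ is a locally finite open cover of $X$; (3) each $\tilde U_I$ is contractible whenever non-empty, and so is $U_I$; (4) $U_I=U_{I_0}\cap\dots\cap U_{I_p}$ ($p\ge 0$) if $I=I_0\cup\dots\cup I_p$, and it is uniformized by $(\tilde U_I,G_I,\pi_I)\in\mathcal U$; (5) there is an embedding $\lambda_{IJ}:(\tilde U_I,G_I,\pi_I)\to(\tilde U_J,G_J,\pi_J)$ in $\mathcal U$ whenever $U_I\subseteq U_J$. **The complexes.** $\mathsf{MFin}^p(V_{\mathcal U})$ is the set of strings $\mathfrak I=I_0\dots I_p$ of length $p+1$ of elements of $\mathsf{Fin}(V_{\mathcal U})$. For such $\mathfrak I$: $\cup\mathfrak I:=I_0\cup\dots\cup I_p$, $(\tilde U_{\mathfrak I},G_{\mathfrak I},\pi_{\mathfrak I}):=(\tilde U_{\cup\mathfrak I},G_{\cup\mathfrak I},\pi_{\cup\mathfrak I})$; $\mathfrak I_{\hat k}$ is $\mathfrak I$ with $I_k$ removed; $\mathfrak I_{j\leftrightarrow k}$ ($j\ne k$) is $\mathfrak I$ with $I_j,I_k$ switched. $\Omega^q(\tilde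 U)^{G}$ denotes the $G$-invariant differential $q$-forms on $\tilde U$. For $p,q\ge 0$, $$\overline{\mathsf C}^p(\mathcal U,\Omega^q):=\Big\{(a_{\mathfrak I})\in\prod_{\mathfrak I\in\mathsf{MFin}^p(V_{\mathcal U})}\Omega^q(\tilde U_{\mathfrak I})^{G_{\mathfrak I}}\ \Big|\ a_{\mathfrak I}=-a_{\mathfrak I_{j\leftrightarrow k}}\text{ for all }0\le j\neq k\le p\Big\},$$ and it is $\{0\}$ otherwise. If $U_I\subseteq U_J$, the restriction to $\tilde U_I$ of a $G_J$-invariant form $a$ on $\tilde U_J$ is $a|_{\tilde U_I}:=\lambda_{IJ}^*(a)$ for any embedding $\lambda_{IJ}$ (independent of the choice). $d$ is the exterior derivative (componentwise), $\delta:\overline{\mathsf C}^p(\mathcal U,\Omega^q)\to\overline{\mathsf C}^{p+1}(\mathcal U,\Omega^q)$ is $(\delta a)_{\mathfrak I}=\sum_{k=0}^{p+1}(-1)^k a_{\mathfrak I_{\hat k}}|_{\tilde U_{\mathfrak I}}$, and $\mathsf{Tot}(\overline{\mathsf C}^*(\mathcal U,\Omega^* ))^k=\bigoplus_{p+q=k}\overline{\mathsf C}^p(\mathcal U,\Omega^q)$ has differential $\overline D=\delta+(-1)^pd$ on $\overline{\mathsf C}^p(\mathcal U,\Omega^q)$. $\overline\Omega^q(\mathcal U)$ is the set of families $\{a_I\in\Omega^q(\tilde U_I)\mid I\in\mathsf{Fin}(V_{\mathcal U})\}$ with each $a_I$ $G_I$-invariant and $\lambda_{IJ}^*(a_J)=a_I$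 for every embedding $\lambda_{IJ}$ in $\mathcal U$; it is identified with $\ker\delta|_{\overline{\mathsf C}^0(\mathcal U,\Omega^q)}$, and $(\overline\Omega^*(\mathcal U),d)$ is a subcomplex of $\mathsf{Tot}$. $\overline{\mathsf C}^p(\mathcal U,\mathbb Z)\subseteq\overline{\mathsf C}^p(\mathcal U,\Omega^0)$ is the subgroup of cochains whose components are constant integer-valued functions; $(\overline{\mathsf C}^*(\mathcal U,\mathbb Z),\delta)$ is a subcomplex of $\mathsf{Tot}$. **Spark complexes.** A spark complex is a triple $(\mathsf F^*,\mathsf E^*,\mathsf I^* )$ of (bounded below) cochain complexes of abelian groups such that (1) $\mathsf I^*$ and $\mathsf E^*$ are subcomplexes of $\mathsf F^*$; (2) $\mathsf I^k\cap\mathsf E^k=\{0\}$ for $k>0$ and $\mathsf F^k=\mathsf E^k=\mathsf I^k=\{0\}$ for $k<0$; (3) $H^*(\mathsf E^* )\cong H^*(\mathsf F^* )$. *)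

(* Defs.v *)
From HB Require Import structures.
From mathcomp Require Import all_boot all_order all_algebra perm generic_quotient.
From mathcomp Require Import finmap.
From mathcomp Require Import all_classical all_reals all_analysis.

Set Implicit Arguments.
Unset Strict Implicit.
Unset Printing Implicit Defensive.

Import Order.TTheory GRing.Theory Num.Theory.
Import numFieldNormedType.Exports.

Local Open Scope classical_set_scope.
Local Open Scope quotient_scope.
Local Open Scope ring_scope.

(** * Topology *)

Section Topology.
Context {T : topologicalType}.

Definition locally_finite (K : Type) (D : set K) (F : K -> set T) : Prop :=
  forall x : T, exists2 N, nbhs x N & finite_set [set i | D i /\ F i `&` N !=set0].

Definition open_cover (C : set (set T)) : Prop :=
  C `<=` open /\ \bigcup_(A in C) A = [set: T].

Definition paracompact : Prop :=
  forall C, open_cover C -> exists D, [/\ open_cover D,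
    forall B, D B -> exists2 A, C A & B `<=` A & locally_finite D id].

(* The space may be empty, hence the base point is part of the conclusion. *)
Definition contractible (R : realType) (A : set T) : Prop :=
  exists a (H : R * T -> T), [/\ A a,
    {within `[0, 1]%classic `*` A, continuous H},
    forall t x, `[0, 1]%classic t -> A x -> A (H (t, x)),
    forall x, A x -> H (0, x) = x &
    forall x, A x -> H (1, x) = a].

End Topology.
Arguments paracompact T : clear implicits.

(* A homeomorphism onto the image. *)
Definition topological_embedding (S T : topologicalType) (f : S -> T) : Prop :=
  [/\ injective f, continuous f &
    forall W, open W -> exists2 O, open O & f @` W = O `&` range f].

(** * Smooth maps and differential forms on open subsets of R^n *)

Section Smooth.
Context {R : realType} {n : nat}.
Local Notation E := 'rV[R]_n.
Implicit Type U : set E.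

(* All iterated directional derivatives exist and are continuous on U; only the
   restriction of f to the open set U matters. *)
Definition smooth_on (W : normedModType R) U (f : E -> W) : Prop :=
  forall (vs : seq E) x, U x ->
    let g := foldr (fun v h => 'D_v h) f vs in
    {for x, continuous g} /\ forall v, derivable g x v.

(* Diff(U); a diffeomorphism of U is represented by its extension to R^n by the
   identity outside U, so that equal diffeomorphisms are equal functions. *)
Definition Diff U : set (E -> E) :=
  [set f | (forall x, ~ U x -> f x = x) /\
    exists g, [/\ smooth_on U f, smooth_on U g,
      (forall x, U x -> U (f x)), (forall x, U x -> U (g x)) &
      forall x, U x -> g (f x) = x /\ f (g x) = x]].

(* A finite subgroup of Diff(U). It acts effectively on U by construction, and
   it is trivial if U is empty. *)
Record diff_group U := DiffGroup {
  dg_set :> set (E -> E);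
  dg_diff : dg_set `<=` Diff U;
  dg_finite : finite_set dg_set;
  dg_id : dg_set idfun;
  dg_comp : forall g h, dg_set g -> dg_set h -> dg_set (g \o h);
  dg_inv : forall g, dg_set g -> exists2 h, dg_set h & h \o g = idfun }.

Section OrbitSpace.
Context {U : set E} (G : diff_group U).

Definition orbit_rel : rel U :=
  fun x y => `[< exists2 g, dg_set G g & g (set_val x) = set_val y >].

Lemma orbit_rel_refl : reflexive orbit_rel.
Proof. by move=> x; apply/asboolP; exists idfun => //; exact: dg_id. Qed.

Lemma orbit_rel_sym : symmetric orbit_rel.
Proof.
suff H x y : orbit_rel x y -> orbit_rel y x by move=> x y; apply/idP/idP; exact: H.
move=> /asboolP[g Gg gxy]; have [h Gh hg] := dg_inv Gg.
by apply/asboolP; exists h; rewrite // -gxy; exact: (congr1 (@^~ (set_val x)) hg).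
Qed.

Lemma orbit_rel_trans : transitive orbit_rel.
Proof.
move=> y x z /asboolP[g Gg gxy] /asboolP[h Gh hyz].
by apply/asboolP; exists (h \o g); [exact: dg_comp | rewrite /= gxy].
Qed.

Canonical orbit_equiv :=
  EquivRel orbit_rel orbit_rel_refl orbit_rel_sym orbit_rel_trans.

Definition orbit_space : topologicalType :=
  quotient_topology {eq_quot orbit_equiv}.

End OrbitSpace.

(* A q-form on U is a family of alternating q-multilinear maps on R^n, smooth on
   U and extended by 0 outside U, so that equal forms are equal functions. *)
Definition dform (q : nat) := E -> ('I_q -> E) -> R.

Definition Omega q U : set (dform q) :=
  [set w | [/\ forall x v i (c : R) a b,
                 w x (dfwith v i (c *: a + b)) =
                   c * w x (dfwith v i a) + w x (dfwith v i b),
               forall x v i j, i != j -> v i = v j -> w x v = 0,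
               forall v, smooth_on U (fun x => w x v) &
               forall x v, ~ U x -> w x v = 0]].

(* The pullback to U along f : U -> R^n. *)
Definition pullback q U (f : E -> E) (w : dform q) : dform q :=
  fun x v => if x \in U then w (f x) (fun i => 'd f x (v i)) else 0.

(* The invariant formula for d, evaluated on constant vector fields. *)
Definition extd q U (w : dform q) : dform q.+1 :=
  fun x v => if x \in U then
    \sum_(i < q.+1)
      (-1) ^+ i * 'D_(v i) (fun y => w y (fun j => v (lift i j))) x
  else 0.

Definition Omega_inv q U (G : set (E -> E)) : set (dform q) :=
  [set w | Omega U w /\ forall g, G g -> pullback U g w = w].

End Smooth.
Arguments dform R n q : clear implicits.

(** * Charts and good atlases *)

Section Charts.
Context {R : realType} {n : nat} {X : topologicalType}.
Local Notation E := 'rV[R]_n.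

Record chart := Chart {
  dom : set E;
  grp : diff_group dom;
  cproj : dom -> X;
  dom_open : open dom;
  dom_connected : connected dom;
  supp_open : open (range cproj);
  supp_connected : connected (range cproj);
  cproj_continuous : continuous cproj;
  cproj_invariant : forall g (x y : dom), dg_set grp g ->
    set_val y = g (set_val x) -> cproj y = cproj x;
  (* [cproj \o repr] is the map induced by [cproj] on the orbit space *)
  cproj_homeo : topological_embedding (cproj \o repr : orbit_space grp -> X) }.

Definition supp (c : chart) : set X := range (@cproj c).

Definition embedding (c1 c2 : chart) (l : E -> E) : Prop :=
  [/\ smooth_on (dom c1) l,
      forall x, dom c1 x -> injective ('d l x),
      topological_embedding (l \o set_val : dom c1 -> E),
      forall x, dom c1 x -> dom c2 (l x) &
      forall (x : dom c1) (y : dom c2),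
        set_val y = l (set_val x) -> cproj y = cproj x].

Definition is_atlas (K : Type) (c : K -> chart) : Prop :=
  \bigcup_i supp (c i) = [set: X] /\
  forall i j x, supp (c i) x -> supp (c j) x ->
    exists k, [/\ supp (c k) x, supp (c k) `<=` supp (c i) `&` supp (c j),
      exists l, embedding (c k) (c i) l & exists l, embedding (c k) (c j) l].

End Charts.
Arguments chart R n X : clear implicits.

(* Non-empty finite subsets of V. *)
Definition Fin (V : choiceType) : Type := {I : {fset V} | I != fset0}.

Definition fin1 (V : choiceType) (i : V) : Fin V.
Proof. by exists [fset i]%fset; apply/fset0Pn; exists i; rewrite in_fset1. Defined.

(* Strings I_0 ... I_p. *)
Definition MFin (V : choiceType) (p : nat) : Type := 'I_p.+1 -> Fin V.

Section Strings.
Context {V : choiceType}.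

Definition cup p (J : MFin V p) : Fin V.
Proof.
exists (\big[fsetU/fset0]_(i < p.+1) val (J i))%fset.
rewrite big_ord_recl; have /fset0Pn[x xJ] := valP (J ord0).
by apply/fset0Pn; exists x; rewrite in_fsetU xJ.
Defined.

Definition face p (k : 'I_p.+2) (J : MFin V p.+1) : MFin V p :=
  fun i => J (lift k i).

Definition swap p (j k : 'I_p.+1) (J : MFin V p) : MFin V p :=
  fun i => J (tperm j k i).

End Strings.

Record good_atlas (R : realType) (n : nat) (X : topologicalType) := GoodAtlas {
  vert : countType;
  ch :> Fin vert -> chart R n X;
  ga_atlas : is_atlas ch;
  ga_cover : \bigcup_i supp (ch (fin1 i)) = [set: X];
  ga_locally_finite :
    locally_finite [set: vert] (fun i => supp (ch (fin1 i)));
  ga_contractible_dom :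
    forall I, dom (ch I) !=set0 -> contractible R (dom (ch I));
  ga_contractible_supp :
    forall I, supp (ch I) !=set0 -> contractible R (supp (ch I));
  ga_inter : forall p (J : MFin vert p),
    supp (ch (cup J)) = \bigcap_i supp (ch (J i));
  ga_embedding : forall I J, supp (ch I) `<=` supp (ch J) ->
    exists l, embedding (ch I) (ch J) l }.

(** * Complexes of abelian groups and spark complexes *)

Section Complexes.
Context {A : zmodType}.

(* Z-graded families of subgroups of an ambient abelian group A, together with an
   operator on A which is only meaningful on those subgroups. *)
Record precomplex := Precomplex { gr :> int -> set A; dif : A -> A }.
Implicit Types C : precomplex.

Definition subgroup (S : set A) : Prop :=
  S 0 /\ forall x y, S x -> S y -> S (x - y).

Definition is_complex C : Prop :=
  forall k, [/\ subgroup (C k),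
    forall x y, C k x -> C k y -> dif C (x + y) = dif C x + dif C y,
    forall x, C k x -> C (k + 1) (dif C x) &
    forall x, C k x -> dif C (dif C x) = 0].

Definition subcomplex C' C : Prop :=
  forall k x, C' k x -> C k x /\ dif C' x = dif C x.

Definition cocycles C (k : int) : set A := [set z | C k z /\ dif C z = 0].
Definition coboundaries C (k : int) : set A := dif C @` C (k - 1).

(* The class of z in the quotient group H^k = Z^k / B^k, as a coset. *)
Definition cclass C k (z : A) : set A := [set z + b | b in coboundaries C k].
Definition cohomology C k : set (set A) := cclass C k @` cocycles C k.

(* For C' a subcomplex of C: the inclusion induces isomorphisms of the
   cohomology groups. The sum of two cosets is their pointwise sum. *)
Definition cohomology_iso C' C : Prop :=
  exists phi : int -> set A -> set A, forall k,
    [/\ set_bij (cohomology C' k) (cohomology C k) (phi k),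
        forall c d, cohomology C' k c -> cohomology C' k d ->
          phi k [set x + y | x in c & y in d] =
          [set x + y | x in phi k c & y in phi k d] &
        forall z, cocycles C' k z -> phi k (cclass C' k z) = cclass C k z].

Definition spark_complex F E I : Prop :=
  [/\ is_complex F, is_complex E & is_complex I] /\
  [/\ subcomplex E F /\ subcomplex I F,
      forall k : int, 0 < k -> I k `&` E k = [set 0],
      forall k : int, k < 0 -> [/\ F k = [set 0], E k = [set 0] & I k = [set 0]] &
      cohomology_iso E F].

End Complexes.
Arguments precomplex A : clear implicits.

(** * The complexes of a good atlas *)

(* Families of forms indexed by strings; no condition is imposed here. *)
Definition cochain (R : realType) (n : nat) (V : choiceType) (p q : nat) : Type :=
  MFin V p -> dform R n q.

Definition bicochain (R : realType) (n : nat) (V : choiceType) : Type :=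
  forall p q : nat, cochain R n V p q.

Section BicochainGroup.
Context (R : realType) (n : nat) (V : choiceType).
Local Notation B := (bicochain R n V).
HB.instance Definition _ := gen_eqMixin B.
HB.instance Definition _ := gen_choiceMixin B.

Definition bc0 : B := fun p q _ _ _ => 0.
Definition bcN (a : B) : B := fun p q J x v => - a p q J x v.
Definition bcD (a b : B) : B := fun p q J x v => a p q J x v + b p q J x v.

Lemma bc_ext (a b : B) : (forall p q J x v, a p q J x v = b p q J x v) -> a = b.
Proof.
move=> ab; apply: functional_extensionality_dep => p.
apply: functional_extensionality_dep => q.
by do 3 apply: funext => ?; exact: ab.
Qed.

Lemma bcDA : associative bcD.
Proof. by move=> a b c; apply: bc_ext => *; rewrite /bcD addrA. Qed.
Lemma bcDC : commutative bcD.
Proof. by move=> a b; apply: bc_ext => *; rewrite /bcD addrC. Qed.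
Lemma bc0D : left_id bc0 bcD.
Proof. by move=> a; apply: bc_ext => *; rewrite /bcD /bc0 add0r. Qed.
Lemma bcND : left_inverse bc0 bcN bcD.
Proof. by move=> a; apply: bc_ext => *; rewrite /bcD /bc0 /bcN addNr. Qed.

HB.instance Definition _ := GRing.isZmodule.Build B bcDA bcDC bc0D bcND.
End BicochainGroup.

Section AtlasComplexes.
Context {R : realType} {n : nat} {X : topologicalType} (U : good_atlas R n X).
Local Notation V := (vert U).
Local Notation cochain := (cochain R n V).
Local Notation B := (bicochain R n V).

(* Meaningful if supp (U I) `<=` supp (U J); the embedding is then a chosen one,
   and the result does not depend on it for grp (U J)-invariant forms. *)
Definition restr q (I J : Fin V) (w : dform R n q) : dform R n q :=
  pullback (dom (U I)) (get (embedding (U I) (U J))) w.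

Definition delta p q (a : cochain p q) : cochain p.+1 q :=
  fun J x v =>
    \sum_(k < p.+2) (-1) ^+ k * restr (cup J) (cup (face k J)) (a (face k J)) x v.

Definition Cbar p q : set (cochain p q) :=
  [set a | (forall J, Omega_inv (dom (U (cup J))) (grp (U (cup J))) (a J)) /\
           forall j k J, j != k -> a J = - a (swap j k J)].

Definition CbarZ p : set (cochain p 0) :=
  [set a | Cbar a /\ forall J, exists m : int,
     forall x v, dom (U (cup J)) x -> a J x v = m%:~R].

Definition OmegaBar q : set (Fin V -> dform R n q) :=
  [set a | (forall I, Omega_inv (dom (U I)) (grp (U I)) (a I)) /\
           forall I J l, embedding (U I) (U J) l ->
             pullback (dom (U I)) l (a J) = a I].

Definition tot_delta (a : B) : B := fun p =>
  match p with
  | 0%N => fun q => 0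
  | p'.+1 => fun q => delta (a p' q)
  end.

Definition tot_d (a : B) : B := fun p q =>
  match q with
  | 0%N => 0
  | q'.+1 => fun J => extd (dom (U (cup J))) (a p q' J)
  end.

Definition tot_D (a : B) : B := fun p q J x v =>
  tot_delta a J x v + (-1) ^+ p * tot_d a J x v.

(* The direct sum over p + q = k consists of the bigraded families supported
   in total degree k; it is 0 for k < 0. *)
Definition Tot : precomplex B :=
  @Precomplex B (fun k => [set a : B | forall p q : nat,
          Cbar (a p q) /\ ((p + q)%:Z <> k -> a p q = 0)]) tot_D.

(* Global forms in bidegree (0, k), a family (a_I) being viewed as indexed by
   strings of length 1. *)
Definition OmegaBar_complex : precomplex B :=
  @Precomplex B (fun k => [set a : B | forall p q : nat,
          (p = 0%N -> OmegaBar (fun I => a 0%N q (fun=> I))) /\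
          (~ (p = 0%N /\ q%:Z = k) -> a p q = 0)]) tot_d.

(* Integral cochains in bidegree (k, 0). *)
Definition CbarZ_complex : precomplex B :=
  @Precomplex B (fun k => [set a : B | forall p q : nat,
          CbarZ (a p 0%N) /\ (~ (p%:Z = k /\ q = 0%N) -> a p q = 0)]) tot_delta.

End AtlasComplexes.

(* Main.v *)
Require Import Defs.
From HB Require Import structures.
From mathcomp Require Import all_boot all_order all_algebra perm generic_quotient.
From mathcomp Require Import finmap.
From mathcomp Require Import all_classical all_reals all_analysis.
From mathcomp Require Import zify ring lra.

Set Implicit Arguments.
Unset Strict Implicit.
Unset Printing Implicit Defensive.

Import Order.TTheory GRing.Theory Num.Theory.
Import numFieldNormedType.Exports.

Local Open Scope classical_set_scope.
Local Open Scope quotient_scope.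
Local Open Scope ring_scope.

(** Compatibility of the differentials is formal: both the exterior derivative
    and the Cech differential are alternating sums over the faces of a string,
    so that their squares vanish by one cancellation ([face_face_sum]), and they
    commute because pulling back commutes with d ([extd_pullback]). An integral
    cochain of degree k sits in bidegree (k, 0) and a global form of degree k in
    bidegree (0, k), so that only 0 is both when k > 0.

    The content is that the inclusion of global forms into the total complex
    induces isomorphisms in cohomology. It suffices that a cochain whose total
    differential is a global form can be moved into the global forms by a
    coboundary ([cohomology_iso_of_retraction]). This is the classical zigzag
    ([zigzag]), which rests on the exactness of the rows of the double complex:
    a Cech cocycle of forms is a coboundary in positive degree ([cech_exact]),
    and is a global form in degree 0 ([delta_eq0_OmegaBar]).

    The rows are exact because X has smooth partitions of unity
    ([partition_of_unity]): they provide the contraction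
    (K a)_J = sum_k psi_k a_(i_k J). Here a_(i_k J) is a form on the chart of
    the union of i_k and J, which embeds into the chart of J but covers only a
    part of X seen by the latter; its translates under the group of J also have
    to be reached. Forms are therefore moved between charts by local lifts,
    that is, smooth maps covering the identity of X ([chart_lift]). Lifts exist
    near every point lying over both charts ([atlas_lift]), since an embedding
    of charts has an open image and a smooth inverse ([inverse_smooth]). The
    pullback of an invariant form does not depend on the lift
    ([invariant_pullback_eq]): two lifts differ at each point by an element of a
    finite group, this element is locally constant on a dense open set, and the
    two pullbacks agree there by invariance, hence everywhere by continuity.

    Smoothness is handled one order of differentiability at a time ([Ck]),
    which makes the chain rule, the inverse function and the bump functions
    accessible to induction on the order. *)

(** * Directional derivatives and differentiability *)

Section Differentiability.
Context {R : realType}.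

Lemma nbhs_norm_ex (V : normedModType R) (x : V) (A : set V) :
  nbhs x A <-> exists2 r : R, 0 < r & forall y, `|x - y| < r -> A y.
Proof.
split=> [nA|[r r0 Hr]]; last by apply/(nbhs_normP x A); exists r => //= y /= /Hr.
by have /nbhs_normP[r /= r0 Hr] : \forall y \near x, A y by []; exists r => // y /Hr.
Qed.

Lemma diffP_eps (V W : normedModType R) (f : V -> W) (L : {linear V -> W}) x :
  continuous L ->
  (forall e, 0 < e -> \forall y \near x, `|f y - f x - L (y - x)| <= e * `|y - x|) ->
  differentiable f x /\ 'd f x = L :> (V -> W).
Proof.
move=> cL H.
have Ho : f \o shift x = cst (f x) + L +o_ 0 id.
  apply/eqaddoP => e e0; rewrite near_simpl.
  have := H e e0; rewrite (near_shift 0) /=.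
  apply: filter_app; near=> h.
  by rewrite /= subr0 addrK !fctE opprD addrA.
have dE := diff_unique cL Ho.
by split=> //; apply/diff_locallyP; rewrite dE.
Unshelve. all: by end_near. Qed.

Lemma diff_eps (V W : normedModType R) (f : V -> W) x (e : R) :
  differentiable f x -> 0 < e ->
  \forall y \near x, `|f y - f x - 'd f x (y - x)| <= e * `|y - x|.
Proof.
move=> /diff_locally /eqaddoP /[apply]; rewrite near_simpl => H.
rewrite (near_shift 0) /=; apply: filter_app H; near=> h.
by rewrite /= subr0 addrK !fctE opprD addrA.
Unshelve. all: by end_near. Qed.

Lemma line_is_derive (V W : normedModType R) (f : V -> W) x v t :
  derivable f (t *: v + x) v ->
  is_derive t (1 : R) (fun s : R => f (s *: v + x)) ('D_v f (t *: v + x)).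
Proof.
move=> df.
have E : (fun h : R => h^-1 *: (((fun s : R => f (s *: v + x)) \o shift t) (h *: (1 : R)) -
    f (t *: v + x))) =
  (fun h : R => h^-1 *: ((f \o shift (t *: v + x)) (h *: v) - f (t *: v + x))).
  by apply: funext => h /=; rewrite addrA -scalerDl [h *: _]mulr1.
split; first by rewrite /derivable E.
by rewrite /derive E.
Qed.

Lemma line_MVT (V : normedModType R) (f : V -> R) x v :
  (forall t : R, 0 <= t <= 1 -> derivable f (t *: v + x) v) ->
  exists2 t : R, 0 <= t <= 1 & f (v + x) - f x = 'D_v f (t *: v + x).
Proof.
move=> df.
have [||t] := @MVT_segment R (fun s => f (s *: v + x))
   (fun s => 'D_v f (s *: v + x)) 0 1 ler01.
- move=> t; rewrite in_itv /= => /andP[t0 t1].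
  by apply: line_is_derive; apply: df; rewrite !ltW.
- apply: derivable_within_continuous => t; rewrite in_itv /= => t01.
  by have [] := line_is_derive (df t t01).
rewrite in_itv /= => t01; rewrite scale1r scale0r add0r subr0 mulr1 => ->.
by exists t.
Qed.

Lemma is_derive_eps (V W : normedModType R) (f : V -> W) x v d :
  is_derive x v f d <-> forall e, 0 < e ->
    \forall h \near (0 : R), `|f (h *: v + x) - f x - h *: d| <= e * `|h|.
Proof.
split=> [[df <-] e e0|H].
  have /eqaddoP/(_ e e0) := derivable_nbhs df; rewrite near_simpl.
  by apply: filter_app; near=> h; rewrite /= !fctE opprD addrA.
suff C : (fun h => h^-1 *: ((f \o shift x) (h *: v) - f x)) @ 0^' --> d.
  by split; [apply/cvg_ex; eexists; exact: C | exact/cvg_lim].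
apply/cvgrPdist_le => e e0; near=> h.
have h0 : h != 0 by near: h; exact: nbhs_dnbhs_neq.
rewrite -[d in d - _]scale1r -(mulVf h0) -scalerA -scalerBr normrZ normfV.
rewrite ler_pdivrMl ?normr_gt0// distrC mulrC /=; near: h.
by apply: nbhs_dnbhs; exact: H.
Unshelve. all: by end_near. Qed.

Lemma is_deriveZdir (V W : normedModType R) (f : V -> W) x v (c : R) d :
  is_derive x v f d -> is_derive x (c *: v) f (c *: d).
Proof.
have [-> _|c0 df] := eqVneq c 0; first by rewrite !scale0r; exact: is_derive0.
apply/is_derive_eps => e e0.
have /is_derive_eps/(_ (e / `|c|)) := df; rewrite divr_gt0 ?normr_gt0// => /(_ isT) H.
have cc : (h * c @[h --> (0 : R)]) --> (0 : R).
  by rewrite -[X in _ --> X](mul0r c); apply: cvgMl.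
have {}H : \forall h \near (0 : R),
  `|f ((h * c) *: v + x) - f x - (h * c) *: d| <= e / `|c| * `|h * c| := cc _ H.
near=> h; rewrite !scalerA (le_trans (near H h _))//.
by rewrite normrM (_ : e / `|c| * (`|h| * `|c|) = e * `|h|)//; field; rewrite normr_eq0.
Unshelve. all: by end_near. Qed.

Lemma is_deriveZdirR (V : normedModType R) (f : V -> R) x v (c : R) d :
  is_derive x v f d -> is_derive x (c *: v) f (c * d).
Proof. exact: is_deriveZdir. Qed.

(** The mean value theorem turns the increment along v, taken at the point
    reached along u, into a value of 'D_v f near x, where continuity applies. *)
Lemma is_deriveDdir (V : normedModType R) (f : V -> R) x u v :
  derivable f x u -> (\forall y \near x, derivable f y v) ->
  {for x, continuous ('D_v f)} ->
  is_derive x (u + v) f ('D_u f x + 'D_v f x).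
Proof.
move=> /derivableP du dv cv; apply/is_derive_eps => e e0.
have e20 : 0 < e / 2 by rewrite divr_gt0.
have Hu := (is_derive_eps _ _ _ _).1 du _ e20.
have {cv}Hv : \forall y \near x, `|'D_v f x - 'D_v f y| <= e / 2.
  by move: cv => /cvgrPdist_le; apply.
have [r /= r0 Hr] : exists2 r : R, 0 < r & forall y, `|x - y| < r ->
    derivable f y v /\ `|'D_v f x - 'D_v f y| <= e / 2.
  have /nbhs_normP[r /= r0 Hr] :
      \forall y \near x, derivable f y v /\ `|'D_v f x - 'D_v f y| <= e / 2.
    exact: filterI.
  by exists r => // y /Hr.
have M0 : 0 < `|v| + `|u| + 1 by rewrite ltr_wpDl// addr_ge0.
near=> h.
have hr : `|h| < r / (`|v| + `|u| + 1).
  by near: h; apply: (@nbhs0_lt R R); rewrite divr_gt0.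
have Hb t : 0 <= t <= 1 ->
    derivable f (t *: (h *: v) + (h *: u + x)) v /\
    `|'D_v f x - 'D_v f (t *: (h *: v) + (h *: u + x))| <= e / 2.
  move=> /andP[t0 t1]; apply: Hr => /=.
  rewrite addrA opprD addrCA subrr addr0 normrN.
  rewrite (le_lt_trans (ler_normD _ _))// !normrZ.
  rewrite (@le_lt_trans _ _ (`|h| * (`|v| + `|u| + 1)))//.
    rewrite 2!mulrDr mulr1 -addrA lerD//; last by rewrite lerDl.
    by rewrite ger0_norm// ler_piMl// mulr_ge0.
  by rewrite -ltr_pdivlMr.
have [|t t01] := @line_MVT V f (h *: u + x) (h *: v).
  move=> t /Hb[/derivableP/is_deriveZdir + _] => /(_ h) []//.
have [/derivableP dv' Ht] := Hb t t01; have [_ ->] := is_deriveZdirR h dv'; move=> E.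
have -> : h *: (u + v) + x = h *: v + (h *: u + x) by rewrite scalerDr addrAC addrC.
set D := 'D_v f _ in E Ht.
have -> : f (h *: v + (h *: u + x)) = f (h *: u + x) + h * D.
  by rewrite -E [RHS]addrC subrK.
rewrite [h *: (_ + _ : R)]/(h * _).
have -> : f (h *: u + x) + h * D - f x - h * ('D_u f x + 'D_v f x) =
  (f (h *: u + x) - f x - h * 'D_u f x) - h * ('D_v f x - D) by ring.
rewrite (le_trans (ler_normB _ _))// (splitr e) mulrDl lerD//.
  by near: h; exact: (Hu).
by rewrite normrM mulrC ler_wpM2r.
Unshelve. all: by end_near. Qed.

Lemma C1_derive_sum n (U : set 'rV[R]_n) (f : 'rV[R]_n -> R) x h :
  open U -> (forall v y, U y -> derivable f y v) ->
  (forall v y, U y -> {for y, continuous ('D_v f)}) -> U x ->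
  'D_h f x = \sum_i h 0 i * 'D_(delta_mx 0 i) f x.
Proof.
move=> oU df cf Ux.
rewrite [in LHS](row_sum_delta h).
have [_ ->//] : is_derive x (\sum_i h 0 i *: delta_mx 0 i) f
  (\sum_i h 0 i * 'D_(delta_mx 0 i) f x).
elim/big_rec2: _ => [|i d v _ [_ <-]]; first exact: is_derive0.
have [_ <-] := is_deriveZdirR (h 0 i) (derivableP (df (delta_mx 0 i) x Ux)).
apply: is_deriveDdir; [exact: df| |exact: cf].
by have := open_nbhs_nbhs (conj oU Ux); apply: filterS => y /df.
Qed.

(** On the segment from x to y the increment of f is a value of its derivative
    in the direction y - x, which is linear in y - x by [C1_derive_sum] and has
    continuous coefficients. *)
Lemma C1_differentiable n (U : set 'rV[R]_n) (f : 'rV[R]_n -> R) x :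
  open U -> (forall v y, U y -> derivable f y v) ->
  (forall v y, U y -> {for y, continuous ('D_v f)}) -> U x ->
  differentiable f x.
Proof.
move=> oU df cf Ux.
have Hs y h := @C1_derive_sum n U f y h oU df cf.
pose c : 'cV[R]_n := \col_i 'D_(delta_mx 0 i) f x.
pose L : 'rV[R]_n -> R := fun h => (h *m c) 0 0.
have lL : linear L by move=> a u v; rewrite /L mulmxDl -scalemxAl !mxE.
pose lM := GRing.isLinear.Build R 'rV[R]_n R _ L lL.
pose LL : {linear 'rV[R]_n -> R} := HB.pack L lM.
have LE h : L h = \sum_i h 0 i * 'D_(delta_mx 0 i) f x.
  by rewrite /L mxE; apply: eq_bigr => i _; rewrite mxE.
have hle (h : 'rV[R]_n) i : `|h 0 i| <= `|h|.
  by rewrite [leRHS]/Num.Def.normr/= mx_normrE (le_bigmax _ _ (0, i)).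
have cL : continuous (LL : _ -> _).
  rewrite (_ : (LL : _ -> _) = \sum_(i < n) (fun h : 'rV[R]_n => h 0 i * 'D_(delta_mx 0 i) f x)).
    move=> y; apply: differentiable_continuous; apply: differentiable_sum => i.
    apply: differentiableM; last exact: differentiable_cst.
    exact: differentiable_coord.
  by apply: funext => h; rewrite fct_sumE -LE.
suff: differentiable f x /\ 'd f x = LL :> (_ -> _) by case.
apply: diffP_eps => // e e0.
have Hi (i : 'I_n) : \forall y \near x, `|'D_(delta_mx 0 i) f x - 'D_(delta_mx 0 i) f y| <= e / (n%:R + 1).
  have n1 : 0 < n%:R + 1 :> R by rewrite ltr_wpDl.
  by have /cvgrPdist_le/(_ (e / (n%:R + 1))) := cf (delta_mx 0 i) x Ux; apply; rewrite divr_gt0.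
have HI : \forall y \near x, U y /\ forall i : 'I_n, `|'D_(delta_mx 0 i) f x - 'D_(delta_mx 0 i) f y| <= e / (n%:R + 1).
  near=> y; split; first by near: y; exact: open_nbhs_nbhs (conj oU Ux).
  by move=> i; move: i; near: y; apply: filter_forall => /= i; exact: Hi.
have {HI} [r /= r0 Hr] : exists2 r : R, 0 < r & forall y, `|x - y| < r ->
    U y /\ forall i : 'I_n, `|'D_(delta_mx 0 i) f x - 'D_(delta_mx 0 i) f y| <= e / (n%:R + 1).
  by have /nbhs_normP[r /= r0 Hr] := HI; exists r => // y /Hr.
apply/nbhs_normP; exists r => //= y /= xy.
have Hy t : 0 <= t <= 1 -> `|x - (t *: (y - x) + x)| < r.
  move=> /andP[t0 t1]; rewrite opprD addrCA subrr addr0 normrN normrZ ger0_norm//.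
  by rewrite (le_lt_trans _ xy)// distrC ler_piMl.
have [t /Hy/Hr[]|t t01] := @line_MVT _ f x (y - x); first by move=> Uy _; exact: df.
rewrite subrK => ->; have [Ut Ht] := Hr _ (Hy _ t01).
rewrite Hs// LE -sumrB (le_trans (ler_norm_sum _ _ _))//.
apply: (@le_trans _ _ (\sum_(i < n) `|y - x| * (e / (n%:R + 1)))).
  apply: ler_sum => i _; rewrite -mulrBr normrM ler_pM//.
  by rewrite distrC.
rewrite sumr_const card_ord -[leLHS]mulr_natr -mulrA mulrC ler_wpM2r//.
have n1 : 0 < n%:R + 1 :> R by rewrite ltr_wpDl.
by rewrite [leLHS]mulrAC ler_pdivrMr// ler_pM2l// lerDl.
Unshelve. all: by end_near. Qed.

(** Schwarz's theorem. *)
Lemma derive_comm (V : normedModType R) (U : set V) (f : V -> R) x u v :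
  open U -> U x ->
  (forall y, U y -> derivable f y u) -> (forall y, U y -> derivable f y v) ->
  (forall y, U y -> derivable ('D_u f) y v) ->
  (forall y, U y -> derivable ('D_v f) y u) ->
  {for x, continuous ('D_v ('D_u f))} -> {for x, continuous ('D_u ('D_v f))} ->
  'D_v ('D_u f) x = 'D_u ('D_v f) x.
Proof.
move=> oU Ux; have [r /= r0 Hr] : exists2 r : R, 0 < r & forall y, `|x - y| < r -> U y.
  by have /nbhs_normP[r /= r0 Hr] := open_nbhs_nbhs (conj oU Ux); exists r => // y /Hr.
(* the second difference quotient is a value of the mixed derivative *)
have key a b (h : R) : (forall y, U y -> derivable f y a) ->
    (forall y, U y -> derivable ('D_a f) y b) ->
    `|h| * (`|a| + `|b|) < r -> exists y,
    `|x - y| <= `|h| * (`|a| + `|b|) /\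
    f (h *: a + (h *: b + x)) - f (h *: a + x) - (f (h *: b + x) - f x) =
    h * (h * 'D_b ('D_a f) y).
  move=> da db hr.
  have Hb s t : 0 <= s <= 1 -> 0 <= t <= 1 ->
     `|x - (s *: (h *: b) + (t *: (h *: a) + x))| <= `|h| * (`|a| + `|b|).
    move=> /andP[s0 s1] /andP[t0 t1].
    rewrite addrA opprD addrCA subrr addr0 normrN.
    rewrite (le_trans (ler_normD _ _))// !normrZ mulrDr addrC.
    by rewrite (ger0_norm s0) (ger0_norm t0) lerD// ler_piMl// mulr_ge0.
  have HU s t : 0 <= s <= 1 -> 0 <= t <= 1 ->
     U (s *: (h *: b) + (t *: (h *: a) + x)).
    by move=> ? ?; apply: Hr; rewrite (le_lt_trans _ hr)// Hb.
  pose g (y : V) := f (h *: b + y) - f y.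
  have I0 : 0 <= (0 : R) <= 1 by rewrite lexx ler01.
  have I1 : 0 <= (1 : R) <= 1 by rewrite lexx ler01.
  have dg t : 0 <= t <= 1 -> is_derive (t *: (h *: a) + x) (h *: a) g
     (h * ('D_a f (h *: b + (t *: (h *: a) + x)) - 'D_a f (t *: (h *: a) + x))).
    move=> t01; apply: is_deriveZdirR; apply: is_deriveB; last first.
      by apply: derivableP; apply: da; have := HU 0 t I0 t01; rewrite scale0r add0r.
    have /da/derivableP := HU 1 t I1 t01; rewrite scale1r => D.
    apply/is_derive_eps => e e0; have := (is_derive_eps _ _ _ _).1 D e e0.
    by apply: filterS => k; rewrite addrCA.
  have [t t01|t t01] := @line_MVT V g x (h *: a).
    by have [] := dg t t01.
  have [_ ->] := dg t t01.
  have [s s01|s s01] := @line_MVT V ('D_a f) (t *: (h *: a) + x) (h *: b).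
    by have [] := is_deriveZdir h (derivableP (db _ (HU s t s01 t01))).
  have [_ ->] := is_deriveZdirR h (derivableP (db _ (HU s t s01 t01))) => E1 E2.
  exists (s *: (h *: b) + (t *: (h *: a) + x)); split; first exact: Hb.
  by rewrite -E1 -E2 /g addrCA; congr (_ - _ - _); rewrite addrCA.
move=> du dv duv dvu cuv cvu.
apply/eqP; rewrite -subr_eq0 -normr_le0; apply/ler_addgt0Pr => e e0; rewrite add0r.
have [s /= s0 Hs] : exists2 s : R, 0 < s & forall y, `|x - y| < s ->
    `|'D_v ('D_u f) x - 'D_v ('D_u f) y| <= e / 2 /\
    `|'D_u ('D_v f) x - 'D_u ('D_v f) y| <= e / 2.
  have /nbhs_normP[s /= s0 Hs] : \forall y \near x,
    `|'D_v ('D_u f) x - 'D_v ('D_u f) y| <= e / 2 /\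
    `|'D_u ('D_v f) x - 'D_u ('D_v f) y| <= e / 2.
    by apply: filterI; [move: cuv | move: cvu] => /cvgrPdist_le; apply;
       rewrite divr_gt0.
  by exists s => // y /Hs.
pose M := `|u| + `|v| + 1; have M0 : 0 < M by rewrite ltr_wpDl// addr_ge0.
pose m := Num.min r s; have m0 : 0 < m by rewrite lt_min r0.
pose h := m / (2 * M); have h0 : 0 < h by rewrite divr_gt0// mulr_gt0.
have hm : `|h| * (`|u| + `|v|) < m.
  rewrite gtr0_norm// /h mulrAC ltr_pdivrMr ?mulr_gt0//.
  rewrite ltr_pM2l// /M; have := normr_ge0 u; have := normr_ge0 v; lra.
have [|y [yx Ey]] := key u v h du duv; first by rewrite (lt_le_trans hm)// ge_min lexx.
have [|z [zx Ez]] := key v u h dv dvu.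
  by rewrite addrC (lt_le_trans hm)// ge_min lexx.
have yzE : 'D_v ('D_u f) y = 'D_u ('D_v f) z.
  apply: (mulfI (lt0r_neq0 h0)); apply: (mulfI (lt0r_neq0 h0)).
  rewrite -Ey -Ez (addrCA (h *: v)).
  by move: (f _) (f _) (f _) (f _) => a b c d; ring.
have ms : m <= s by rewrite ge_min lexx orbT.
have [H1 _] := Hs y (le_lt_trans yx (lt_le_trans hm ms)).
have [|_ H2] := Hs z; first by rewrite (le_lt_trans zx)// addrC (lt_le_trans hm).
rewrite -(subrKA ('D_v ('D_u f) y)) (le_trans (ler_normD _ _))// (splitr e).
by apply: (lerD H1); rewrite yzE distrC; exact: H2.
Qed.

End Differentiability.

(** * Functions of class C^k *)

Section Ck.
Context {R : realType} {n : nat}.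
Local Notation E := 'rV[R]_n.

(** Smoothness in the sense of [smooth_on] is the conjunction of these finite
    levels; induction on the level is what proves the stability lemmas. *)
Fixpoint Ck (W : normedModType R) k (U : set E) (f : E -> W) : Prop :=
  match k with
  | 0 => forall x, U x -> {for x, continuous f}
  | k'.+1 => (forall x, U x -> {for x, continuous f}) /\
     forall v, (forall x, U x -> derivable f x v) /\ Ck k' U ('D_v f)
  end.

Lemma Ck_continuous (W : normedModType R) k U (f : E -> W) x :
  Ck k U f -> U x -> {for x, continuous f}.
Proof. by case: k => [|k] => [cf|[cf _]]; exact: cf. Qed.

Lemma smooth_onP (W : normedModType R) U (f : E -> W) :
  smooth_on U f <-> forall k, Ck k U f.
Proof.
split=> [sf k|H].
  elim: k f sf => [|k IH] f sf /=; first by move=> x Ux; have [] := sf [::] x Ux.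
  split=> [x Ux|v]; first by have [] := sf [::] x Ux.
  split=> [x Ux|]; first by have [_] := sf [::] x Ux; apply.
  by apply: IH => vs x Ux; have := sf (rcons vs v) x Ux; rewrite foldr_rcons.
move=> vs; elim/last_ind: vs f H => [|vs v IH] f H x Ux.
  split; first exact: (H 0%N).
  by move=> v; have [_ /(_ v)[+ _]] := H 1%N; exact.
rewrite /= foldr_rcons; apply: IH => // k.
by have [_ /(_ v)[]] := H k.+1.
Qed.

Lemma CkW (W : normedModType R) k U (f : E -> W) : Ck k.+1 U f -> Ck k U f.
Proof.
elim: k f => [|k IH] f /= [cf df] //; split=> // v.
by have [dfv Cv] := df v; split=> //; exact: IH.
Qed.

Lemma Ck_sub (W : normedModType R) k U U' (f : E -> W) :
  U' `<=` U -> Ck k U f -> Ck k U' f.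
Proof.
move=> UU'; elim: k f => [|k IH] f /= => [cf x /UU'/cf//|[cf df]].
split=> [x /UU'/cf//|v]; have [dfv Cv] := df v.
by split=> [x /UU'/dfv//|]; exact: IH.
Qed.

Lemma near_open_eq (W : normedModType R) (U : set E) (f g : E -> W) x :
  open U -> (forall y, U y -> f y = g y) -> U x -> \forall y \near x, f y = g y.
Proof.
by move=> oU fg Ux; apply: filterS (open_nbhs_nbhs (conj oU Ux)) => y /fg.
Qed.

Lemma Ck_eq (W : normedModType R) k U (f g : E -> W) : open U ->
  (forall x, U x -> f x = g x) -> Ck k U f -> Ck k U g.
Proof.
move=> oU; have cE (f1 g1 : E -> W) x : (forall x, U x -> f1 x = g1 x) -> U x ->
    {for x, continuous f1} -> {for x, continuous g1}.
  move=> fg Ux cf; rewrite /prop_for /continuous_at -fg//.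
  have H := near_open_eq oU fg Ux.
  exact: (cvg_trans (near_eq_cvg H) cf).
elim: k f g => [|k IH] f g fg /= => [cf x Ux|[cf df]]; first exact: cE (cf x Ux).
split=> [x Ux|v]; first exact: cE (cf x Ux).
have [dfv Cv] := df v; split.
  by move=> x Ux; apply: near_eq_derivable (dfv x Ux); exact: near_open_eq oU fg Ux.
apply: IH Cv => x Ux; apply: near_eq_derive; exact: near_open_eq oU fg Ux.
Qed.

Lemma CkS (W : normedModType R) k U (f : E -> W) (d : E -> E -> W) : open U ->
  (forall x, U x -> {for x, continuous f}) ->
  (forall v x, U x -> is_derive x v f (d v x)) ->
  (forall v, Ck k U (d v)) -> Ck k.+1 U f.
Proof.
move=> oU cf df Cd; split=> // v; split=> [x /(df v)[]//|].
by apply: Ck_eq (Cd v) => // x /(df v)[].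
Qed.

Lemma Ck_derive (W : normedModType R) k U (f : E -> W) x v :
  Ck k.+1 U f -> U x -> is_derive x v f ('D_v f x).
Proof. by move=> [_ /(_ v)[df _]] /df /derivableP. Qed.

Lemma CkD_ (W : normedModType R) k U (f : E -> W) v :
  Ck k.+1 U f -> Ck k U ('D_v f).
Proof. by case=> _ /(_ v)[]. Qed.

Lemma Ck_cst (W : normedModType R) k (U : set E) (c : W) : open U -> Ck k U (cst c).
Proof.
move=> oU; elim: k c => [|k IH] c; first by move=> x _; exact: cst_continuous.
apply: (@CkS _ _ _ _ (fun _ => cst 0) oU) => // x _; exact: cst_continuous.
Qed.

Section Algebra.
Context (U : set E) (oU : open U).
Implicit Types f g : E -> R.

Lemma CkD k f g : Ck k U f -> Ck k U g -> Ck k U (f \+ g).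
Proof.
elim: k f g => [|k IH] f g Cf Cg.
  by move=> x Ux; exact: (continuousD (Cf x Ux) (Cg x Ux)).
apply: (@CkS _ _ _ _ (fun v => 'D_v f \+ 'D_v g)) => // [x Ux|v x Ux|v].
- exact: (continuousD (Ck_continuous Cf Ux) (Ck_continuous Cg Ux)).
- by apply: is_deriveD; [exact: Ck_derive Cf Ux | exact: Ck_derive Cg Ux].
- by apply: IH; exact: CkD_.
Qed.

Lemma CkM k f g : Ck k U f -> Ck k U g -> Ck k U (f \* g).
Proof.
elim: k f g => [|k IH] f g Cf Cg.
  by move=> x Ux; exact: (continuousM (Cf x Ux) (Cg x Ux)).
apply: (@CkS _ _ _ _ (fun v => (f \* 'D_v g) \+ (g \* 'D_v f))) => // [x Ux|v x Ux|v].
- exact: (continuousM (Ck_continuous Cf Ux) (Ck_continuous Cg Ux)).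
- exact: (is_deriveM (Ck_derive v Cf Ux) (Ck_derive v Cg Ux)).
- by apply: CkD; apply: IH; try exact: CkD_; exact: CkW.
Qed.

Lemma CkV k f : (forall x, U x -> f x != 0) -> Ck k U f -> Ck k U (fun x => (f x)^-1).
Proof.
move=> f0; elim: k => [|k IH] Cf.
  by move=> x Ux; exact: (continuousV (f0 x Ux) (Cf x Ux)).
have C1 := IH (CkW Cf).
apply: (@CkS _ _ _ _ (fun v x => - 1 * (f x)^-1 * (f x)^-1 * 'D_v f x)) => // [x Ux|v x Ux|v].
- exact: (continuousV (f0 x Ux) (Ck_continuous Cf Ux)).
- have D := Ck_derive v Cf Ux; have [dV _] := D.
  split; first exact: derivableV (f0 x Ux) dV.
  rewrite (deriveV (f0 x Ux) dV).
  transitivity (- (f x) ^- 2 * 'D_v f x) => //.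
  by rewrite -exprVn expr2 !mulN1r mulNr.
- apply: CkM; last exact: CkD_.
  by apply: CkM => //; apply: CkM => //; exact: Ck_cst.
Qed.

Lemma Ck_sum (I : Type) (r : seq I) (P : pred I) k (F : I -> E -> R) :
  (forall i, Ck k U (F i)) -> Ck k U (fun x => \sum_(i <- r | P i) F i x).
Proof.
move=> CF; elim: r => [|i r IH].
  by apply: Ck_eq (Ck_cst k (0 : R) oU) => // x _; rewrite big_nil.
apply: (@Ck_eq _ _ _ (if P i then F i \+ (fun x => \sum_(i <- r | P i) F i x) else
   (fun x => \sum_(i <- r | P i) F i x))) => //; last first.
  by case: ifP => // _; exact: CkD.
by move=> x _; rewrite big_cons; case: ifP.
Qed.

Lemma Ck_prod (I : Type) (r : seq I) (P : pred I) k (F : I -> E -> R) :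
  (forall i, Ck k U (F i)) -> Ck k U (fun x => \prod_(i <- r | P i) F i x).
Proof.
move=> CF; elim: r => [|i r IH].
  by apply: Ck_eq (Ck_cst k (1 : R) oU) => // x _; rewrite big_nil.
apply: (@Ck_eq _ _ _ (if P i then F i \* (fun x => \prod_(i <- r | P i) F i x) else
   (fun x => \prod_(i <- r | P i) F i x))) => //; last first.
  by case: ifP => // _; exact: CkM.
by move=> x _; rewrite big_cons; case: ifP.
Qed.

Lemma Ck_coord k i : Ck k U (fun x : E => x 0 i).
Proof.
case: k => [|k]; first by move=> x _; exact: coord_continuous.
apply: (@CkS _ _ _ _ (fun v => cst (v 0 i))) => // [x _|v x _|v].
- exact: coord_continuous.
- apply/is_derive_eps => e e0; near=> h.
  by rewrite !mxE addrK subrr normr0 mulr_ge0// ltW.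
- exact: Ck_cst.
Unshelve. all: by end_near. Qed.

Lemma Ck_differentiable k f x : Ck k.+1 U f -> U x -> differentiable f x.
Proof.
move=> Cf Ux; apply: (C1_differentiable oU _ _ Ux) => v y Uy.
  by have [_ /(_ v)[+ _]] := Cf; apply.
exact: Ck_continuous (CkD_ v Cf) Uy.
Qed.

End Algebra.

Lemma mx_norm_coord (h : E) i : `|h 0 i| <= `|h|.
Proof. by rewrite [leRHS]/Num.Def.normr/= mx_normrE (le_bigmax _ _ (0, i)). Qed.

Lemma mx_norm_le (h : E) (e : R) : 0 <= e -> (forall i, `|h 0 i| <= e) -> `|h| <= e.
Proof.
move=> e0 H; rewrite [leLHS]/Num.Def.normr/= mx_normrE; apply: bigmax_le => // -[i j] _.
by rewrite ord1; exact: H.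
Qed.

Lemma continuous_coordP (T : topologicalType) (s : T -> E) x :
  {for x, continuous s} <-> forall i, {for x, continuous (fun y => s y 0 i)}.
Proof.
split=> [cs i|H].
  apply: (@continuous_comp _ _ _ s (fun y : E => y 0 i)) => //.
  exact: coord_continuous.
apply/cvgrPdist_le => e e0; near=> y.
apply: mx_norm_le (ltW e0) _ => i; rewrite !mxE.
move: i; near: y; apply: filter_forall => i.
by have /cvgrPdist_le := H i; apply.
Unshelve. all: by end_near. Qed.

Lemma is_derive_coord (s : E -> E) x v d :
  is_derive x v s d -> forall i, is_derive x v (fun y => s y 0 i) (d 0 i).
Proof.
move=> [ds <-] i; split; first exact: (derivable_mxP _ _ _).1.
by rewrite derive_mx// mxE.
Qed.

Lemma is_derive_mx (s : E -> E) x v (d : E) :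
  (forall i, is_derive x v (fun y => s y 0 i) (d 0 i)) -> is_derive x v s d.
Proof.
move=> H; have ds : derivable s x v.
  by apply/derivable_mxP => i j; rewrite ord1; have [] := H j.
split => //; rewrite derive_mx//; apply/rowP => i; rewrite mxE.
by have [] := H i.
Qed.

Lemma Ck_coordP k (U : set E) (s : E -> E) : open U ->
  Ck k U s <-> forall i, Ck k U (fun y => s y 0 i).
Proof.
move=> oU; split; elim: k s => [|k IH] s Cs.
- by move=> i x Ux; have /continuous_coordP := Cs x Ux.
- move=> i; apply: (@CkS _ _ _ _ (fun v y => 'D_v s y 0 i)) => // [x Ux|v x Ux|v].
  + by have /continuous_coordP := Ck_continuous Cs Ux.
  + by apply: is_derive_coord; exact: Ck_derive Cs Ux.
  + by apply: IH; exact: CkD_.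
- by move=> x Ux; apply/continuous_coordP => i; exact: Cs.
- apply: (@CkS _ _ _ _ (fun v y => \row_i 'D_v (fun y => s y 0 i) y)) => //.
  + by move=> x Ux; apply/continuous_coordP => i; exact: Ck_continuous (Cs i) Ux.
  + move=> v x Ux; apply: is_derive_mx => i; rewrite mxE.
    exact: Ck_derive (Cs i) Ux.
  + move=> v; apply: IH => i; apply: Ck_eq (CkD_ v (Cs i)) => // x _.
    by rewrite mxE.
Qed.

Lemma Ck_differentiable_mx k (U : set E) (s : E -> E) x :
  open U -> Ck k.+1 U s -> U x -> differentiable s x.
Proof.
move=> oU /(Ck_coordP _ _ oU) Cs Ux.
have -> : s = \sum_i (fun y => s y 0 i *: delta_mx 0 i).
  by apply: funext => y; rewrite fct_sumE {1}[s y]row_sum_delta.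
apply: differentiable_sum => i; apply: differentiableZl.
exact: Ck_differentiable (Cs i) Ux.
Qed.

Lemma Ck_is_derive_comp k (U U' : set E) (s : E -> E) (w : E -> R) x v :
  open U -> open U' -> Ck k.+1 U s -> Ck k.+1 U' w -> U x -> U' (s x) ->
  is_derive x v (w \o s) (\sum_i ('D_v s x) 0 i * 'D_(delta_mx 0 i) w (s x)).
Proof.
move=> oU oU' Cs Cw Ux Usx.
have ds := Ck_differentiable_mx oU Cs Ux.
have dw := Ck_differentiable oU' Cw Usx.
split; first exact/diff_derivable/differentiable_comp.
rewrite deriveE; last exact: differentiable_comp.
rewrite diff_comp//= -(deriveE v ds) -(deriveE _ dw).
apply: (C1_derive_sum _ oU' _ _ Usx) => u y Uy; first by have [] := Ck_derive u Cw Uy.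
exact: Ck_continuous (CkD_ u Cw) Uy.
Qed.

Lemma Ck_comp k (U U' : set E) (s : E -> E) (w : E -> R) :
  open U -> open U' -> (forall x, U x -> U' (s x)) ->
  Ck k U s -> Ck k U' w -> Ck k U (w \o s).
Proof.
move=> oU oU' sU; elim: k w => [|k IH] w Cs Cw.
  by move=> x Ux; apply: continuous_comp; [exact: Cs | exact: Cw (sU x Ux)].
apply: (@CkS _ _ _ _ (fun v x => \sum_i ('D_v s x) 0 i * ('D_(delta_mx 0 i) w \o s) x)) => //.
- move=> x Ux; apply: continuous_comp; first exact: Ck_continuous Cs Ux.
  exact: Ck_continuous Cw (sU x Ux).
- by move=> v x Ux; exact: Ck_is_derive_comp oU oU' Cs Cw Ux (sU x Ux).
- move=> v; apply: Ck_sum => // i; apply: CkM => //.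
    by have /(Ck_coordP _ _ oU) := CkD_ v Cs; exact.
  by apply: IH; [exact: CkW | exact: CkD_].
Qed.

Lemma Ck_comp_mx k (U U' : set E) (s w : E -> E) :
  open U -> open U' -> (forall x, U x -> U' (s x)) ->
  Ck k U s -> Ck k U' w -> Ck k U (w \o s).
Proof.
move=> oU oU' sU Cs /(Ck_coordP _ _ oU') Cw; apply/(Ck_coordP _ _ oU) => i.
exact: (Ck_comp oU oU' sU Cs (Cw i)).
Qed.

Lemma Ck_det k (U : set E) m (M : E -> 'M[R]_m) : open U ->
  (forall i j, Ck k U (fun x => M x i j)) -> Ck k U (fun x => \det (M x)).
Proof.
move=> oU CM; apply: Ck_sum => // p; apply: CkM => //; first exact: Ck_cst.
exact: Ck_prod.
Qed.

Lemma linear_continuous_rV (W : normedModType R) (L : {linear E -> W}) : continuous L.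
Proof.
have -> : (L : E -> W) = \sum_i (fun y : E => y 0 i *: L (delta_mx 0 i)).
  apply: funext => y; rewrite fct_sumE {1}[y]row_sum_delta linear_sum.
  by apply: eq_bigr => i _; rewrite linearZ.
move=> x; apply: differentiable_continuous; apply: differentiable_sum => i.
by apply: differentiableZl; exact: differentiable_coord.
Qed.

Lemma compact_closed_ball (x : E) (r : R) : 0 < r -> compact (closed_ball x r).
Proof.
move=> r0; apply: bounded_closed_compact; last exact: closed_ball_closed.
exists (`|x| + r); split; first by rewrite realE addr_ge0// ltW.
move=> M HM y; rewrite closed_ballE// => /= Hy; rewrite (le_trans _ (ltW HM))//.
by rewrite -[y](subKr x) (le_trans (ler_normB _ _))// lerD2l.
Qed.

(** The transpose of the usual Jacobian, as vectors are rows. *)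
Definition Jac (s : E -> E) x : 'M[R]_n := \matrix_(i, j) ('D_(delta_mx 0 i) s x) 0 j.

Lemma JacE (s : E -> E) x v : differentiable s x -> 'd s x v = v *m Jac s x.
Proof.
move=> ds; rewrite {1}[v]row_sum_delta linear_sum /= mulmx_sum_row.
apply: eq_bigr => i _; rewrite linearZ /= -deriveE//; congr (_ *: _).
by apply/rowP => j; rewrite !mxE.
Qed.

Lemma Jac_unit (s : E -> E) x : differentiable s x -> injective ('d s x) ->
  Jac s x \in unitmx.
Proof.
move=> ds inj; rewrite -row_free_unit; apply: inj_row_free => v.
by rewrite -JacE// => H; apply: inj; rewrite linear0.
Qed.

(** * Smooth inverses of embeddings *)

Section InverseFunction.
Context (U : set E) (s g : E -> E).
Hypotheses (oU : open U) (Cs : smooth_on U s).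
Hypothesis inj_ds : forall x, U x -> injective ('d s x).
Hypothesis inj_s : forall x y, U x -> U y -> s x = s y -> x = y.
Hypothesis emb_s : forall W, open W -> W `<=` U ->
  exists2 O, open O & s @` W = O `&` s @` U.

Let smooth_diff x : U x -> differentiable s x.
Proof. exact: Ck_differentiable_mx oU ((smooth_onP _ _).1 Cs 1%N). Qed.

Let jac_unit x : U x -> Jac s x \in unitmx.
Proof. by move=> Ux; apply: Jac_unit; [exact: smooth_diff | exact: inj_ds]. Qed.

(** A value near s x is attained where the squared distance to it is minimal:
    the minimum over a compact ball around x is interior since s is an
    embedding, and a critical point is a solution since ds is surjective. *)
Lemma embedding_image_nbhs x : U x -> nbhs (s x) (s @` U).
Proof.
move=> Ux; have [r /= r0 Hr] : exists2 r : R, 0 < r & forall y, `|x - y| <= r -> U y.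
  have /nbhs_normP[r /= r0 Hr] := open_nbhs_nbhs (conj oU Ux).
  exists (r / 2); first by rewrite divr_gt0.
  by move=> y xy; apply: Hr; rewrite /= (le_lt_trans xy)// ltr_pdivrMr// ltr_pMr// ltr1n.
pose B : set E := [set y | `|x - y| <= r].
pose W : set E := [set y | `|x - y| < r].
have oW : open W.
  rewrite (_ : W = ball x r); first exact: ball_open.
  by rewrite -ball_normE.
have cB : compact B.
  rewrite (_ : B = closed_ball x r); last first.
    by rewrite closed_ballE//.
  exact: compact_closed_ball.
have [Q oQ WQ] := emb_s oW (fun y Wy => Hr y (ltW Wy)).
have Wx : W x by rewrite /W /= subrr normr0.
have Qsx : Q (s x) by have [] : (Q `&` s @` U) (s x) by rewrite -WQ; exists x.
have /nbhs_normP[e /= e0 He] := open_nbhs_nbhs (conj oQ Qsx).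
have n2 : 0 < n.+2%:R :> R by [].
(* for |c - s x| < d the minimizer y satisfies |s y - c| <= (n + 1) d, so that
   s y stays within e of s x *)
have [d d0 dE] : exists2 d : R, 0 < d & e = d + n.+1%:R * d.
  exists (e / n.+2%:R); first by rewrite divr_gt0.
  by rewrite -[X in X + _]mul1r -mulrDl nat1r mulrC divfK// gt_eqF.
apply/nbhs_norm_ex; exists d => // c cd.
pose phi y := \sum_i (s y 0 i - c 0 i) ^+ 2.
have Csi i : Ck 1 U (fun y => s y 0 i - c 0 i).
  apply: (CkD oU); last exact: Ck_cst.
  exact: (Ck_coordP 1 _ oU).1 ((smooth_onP _ _).1 Cs 1%N) i.
have ds y v i : U y -> is_derive y v (fun y => s y 0 i - c 0 i) ('D_v s y 0 i).
  move=> Uy; rewrite -['D_v s y 0 i]subr0; apply: is_deriveB.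
  apply: is_derive_coord; exact: Ck_derive ((smooth_onP _ _).1 Cs 1%N) Uy.
have dphi y v : U y -> is_derive y v phi (\sum_i 2 * (s y 0 i - c 0 i) * 'D_v s y 0 i).
  move=> Uy; rewrite (_ : phi = \sum_i (fun y => s y 0 i - c 0 i) ^+ 2); last first.
    by apply: funext => z; rewrite fct_sumE.
  apply: is_derive_eq; first by apply: is_derive_sum => i; apply: is_deriveX; exact: ds.
  by apply: eq_bigr => i _; rewrite /= expr1.
have [y /set_mem yB Hy] : exists2 y, y \in B & forall t, t \in B -> phi y <= phi t.
  apply: EVT_min_rV => //; first by exists x; rewrite /B /= subrr normr0 ltW.
  apply: continuous_in_subspaceT => z /set_mem Bz.
  apply: (@Ck_continuous _ 1 U); last exact: Hr.
  by apply: Ck_sum => // i; exact: CkM.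
have Uy := Hr y yB.
have phix : phi y <= n.+1%:R * d ^+ 2.
  apply: (le_trans (Hy x _)); first by rewrite inE /B /= subrr normr0 ltW.
  apply: (@le_trans _ _ (\sum_(i < n) d ^+ 2)).
    apply: ler_sum => i _; rewrite -[leLHS]real_normK ?num_real// ler_sqr ?nnegrE ?(ltW d0)//.
    by rewrite (le_trans _ (ltW cd))// (le_trans _ (mx_norm_coord _ i))// !mxE.
  rewrite sumr_const card_ord -[leLHS]mulr_natl ler_wpM2r ?sqr_ge0//.
  by rewrite ler_nat.
have scd i : `|s y 0 i - c 0 i| <= n.+1%:R * d.
  have nd0 : 0 <= n.+1%:R * d by rewrite mulr_ge0// ltW.
  suff: `|s y 0 i - c 0 i| ^+ 2 <= (n.+1%:R * d) ^+ 2 by rewrite ler_sqr.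
  rewrite real_normK ?num_real//.
  rewrite (@le_trans _ _ (phi y))//.
    by rewrite /phi (bigD1 i)//= lerDl sumr_ge0// => j _; exact: sqr_ge0.
  apply: (le_trans phix); rewrite exprMn; apply: ler_wpM2r; first exact: sqr_ge0.
  by rewrite ler_eXnr// ler1n.
have Qsy : Q (s y).
  apply: He => /=.
  rewrite dE.
  rewrite -(subrKA c) (le_lt_trans (ler_normD _ _))// ltr_leD// distrC.
  by apply: mx_norm_le => [|i]; rewrite ?mulr_ge0 ?(ltW d0)// !mxE.
have Wy : W y.
  have : (Q `&` s @` U) (s y) by split => //; exists y.
  by rewrite -WQ => -[z Wz /inj_s <-//]; exact: Hr (ltW Wz).
exists y => //.
have crit v : \sum_i 2 * (s y 0 i - c 0 i) * 'D_v s y 0 i = 0.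
  have /nbhs_normP[t /= t0 Ht] := open_nbhs_nbhs (conj oW Wy).
  pose b := t / (`|v| + 1); have v1 : 0 < `|v| + 1 by rewrite ltr_wpDl.
  have b0 : 0 < b by rewrite divr_gt0.
  have Hu (u : R) : u \in `]-b, b[ -> W (u *: v + y).
    rewrite in_itv /= -ltr_norml => ub; apply: Ht => /=.
    rewrite opprD addrCA subrr addr0 normrN normrZ.
    rewrite (@le_lt_trans _ _ (`|u| * (`|v| + 1)))//; first by rewrite ler_wpM2l// lerDl.
    by rewrite -ltr_pdivlMr.
  have b00 : 0 \in `]-b, b[ by rewrite in_itv /= oppr_lt0 b0.
  have Hd (u : R) : u \in `]-b, b[ -> is_derive u 1 (fun u => phi (u *: v + y)) ('D_v phi (u *: v + y)).
    by move=> /Hu Wu; apply: line_is_derive; have [] := dphi _ v (Hr _ (ltW Wu)).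
  have [_ D0] : is_derive (0 : R) 1 (fun u => phi (u *: v + y)) 0.
    apply: (@derive1_at_min R _ (-b) b 0 _ _ b00).
  - by rewrite (@le_trans _ _ 0)// ?oppr_le0 ltW.
  - by move=> u /Hd[].
  - by move=> u /Hu Wu; rewrite scale0r add0r; apply: Hy; rewrite inE /B /= ltW.
  have [_ <-] := dphi y v Uy; have [_] := Hd 0 b00.
  by rewrite D0 scale0r add0r => ->.
(* the direction that ds sends to s y - c *)
have {crit} := crit ((s y - c) *m invmx (Jac s y)).
rewrite (deriveE _ (smooth_diff Uy)) (JacE _ (smooth_diff Uy)) mulmxKV ?jac_unit//.
move=> H; apply/rowP => i; apply/eqP; rewrite -subr_eq0 -sqrf_eq0.
have /psumr_eq0P/(_ i isT) : \sum_i 2 * (s y 0 i - c 0 i) ^+ 2 = 0.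
  by rewrite -[RHS]H; apply: eq_bigr => j _; rewrite !mxE expr2 mulrA.
move=> HH; have /eqP := HH (fun i _ => mulr_ge0 (ler0n _ 2) (sqr_ge0 _)).
by rewrite mulf_eq0 pnatr_eq0.
Qed.

Lemma embedding_image_open W : open W -> W `<=` U -> open (s @` W).
Proof.
move=> oW WU; have [Q oQ ->] := emb_s oW WU; apply: openI => //.
by rewrite openE => _ [x Ux <-]; exact: embedding_image_nbhs.
Qed.

Hypothesis sK : forall x, U x -> g (s x) = x.

Lemma inverse_continuous c : (s @` U) c -> {for c, continuous g}.
Proof.
move=> [x Ux <-] A; rewrite sK// => nA.
have nAU : nbhs x (A° `&` U).
  apply: filterI; first exact: nbhs_interior.
  exact: open_nbhs_nbhs (conj oU Ux).
have : nbhs (s x) (s @` (A° `&` U)).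
  apply: open_nbhs_nbhs; split; last by exists x => //; exact: nbhs_singleton nAU.
  apply: embedding_image_open; last exact: subIsetr.
  by apply: openI => //; exact: open_interior.
apply: filterS => _ [y [Ay Uy] <-] /=; rewrite sK//.
exact: interior_subset.
Qed.

(** At y with s y = c the error of the linearization of s is small against
    |y - x|, hence |y - x| is at most a multiple of |c - s x|, and the error is
    small against |c - s x| as well. *)
Lemma inverse_is_diff x : U x ->
  differentiable g (s x) /\ forall v, 'd g (s x) v = v *m invmx (Jac s x).
Proof.
move=> Ux; have ju := jac_unit Ux; have dsx := smooth_diff Ux.
pose B : E -> E := mulmxr (invmx (Jac s x)).
have [K K0 HK] := linear_lipschitz (@linear_continuous_rV _ (mulmxr (invmx (Jac s x)))).
suff [dg dgE] : differentiable g (s x) /\ 'd g (s x) = mulmxr (invmx (Jac s x)) :> (E -> E).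
  by split=> // v; rewrite dgE.
apply: diffP_eps; first exact: linear_continuous_rV.
move=> e e0; pose h := Num.min (1 / (2 * K)) (e / (2 * K ^+ 2)).
have h0 : 0 < h by rewrite lt_min !divr_gt0// ?mulr_gt0// exprn_gt0.
have Hs := diff_eps dsx h0.
have {}Hs : \forall y \near g (s x), `|s y - s x - 'd s x (y - x)| <= h * `|y - x|.
  by rewrite sK.
have cg : {for s x, continuous g} by apply: inverse_continuous; exists x.
have {}Hs := cg _ Hs.
have HV : nbhs (s x) (s @` U) by exact: embedding_image_nbhs.
near=> c.
have [y Uy yE] : (s @` U) c by near: c.
have : `|s (g c) - s x - 'd s x (g c - x)| <= h * `|g c - x| by near: c.
rewrite -yE !sK// => Hy.
have E1 : `|(y - x) - (s y - s x) *m invmx (Jac s x)| <= K * (h * `|y - x|).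
  rewrite (_ : _ - _ = - ((s y - s x - 'd s x (y - x)) *m invmx (Jac s x))); last first.
    by rewrite JacE// [in RHS]mulmxBl mulmxK// opprB.
  by rewrite normrN (le_trans (HK _))// ler_pM2l.
have E2 : K * (h * `|y - x|) <= 1 / 2 * `|y - x|.
  rewrite mulrA ler_wpM2r// -ler_pdivlMl// mulrC mul1r -invfM.
  by rewrite ge_min mul1r lexx.
have E3 : `|y - x| <= 2 * (K * `|s y - s x|).
  have := le_trans (ler_normD ((y - x) - (s y - s x) *m invmx (Jac s x)) ((s y - s x) *m invmx (Jac s x))) (lerD (le_trans E1 E2) (HK _)).
  by rewrite subrK /=; lra.
rewrite (le_trans E1)//.
have E4 : h * (2 * K ^+ 2) <= e.
  by rewrite -ler_pdivlMr ?mulr_gt0 ?exprn_gt0// ge_min lexx orbT.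
apply: (@le_trans _ _ (h * (2 * K ^+ 2) * `|s y - s x|)); last by rewrite ler_wpM2r.
rewrite (_ : h * _ * _ = K * (h * (2 * (K * `|s y - s x|)))); last by ring.
by rewrite ler_pM2l// ler_pM2l.
Unshelve. all: by end_near. Qed.

(** By Cramer's rule the derivative of g is a rational function of the first
    derivatives of s composed with g, so that each level of regularity of g
    gives the next one. *)
Lemma inverse_smooth : smooth_on (s @` U) g.
Proof.
have oV : open (s @` U) by exact: embedding_image_open.
apply/smooth_onP; elim=> [|k IH]; first by move=> c Vc; exact: inverse_continuous.
have gU c : (s @` U) c -> U (g c) by move=> [x Ux <-]; rewrite sK.
pose J i j : E -> R := fun c => Jac s (g c) i j.
have CJ i j : Ck k (s @` U) (J i j).
  apply: (@Ck_comp k _ U g (fun x => Jac s x i j)) => //.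
  apply: (@Ck_eq _ _ _ (fun x => 'D_(delta_mx 0 i) s x 0 j)) => //.
    by move=> x _; rewrite mxE.
  by apply: (Ck_coordP k _ oU).1; apply: CkD_; exact: (smooth_onP _ _).1.
apply: (@CkS _ _ _ _ (fun v c => v *m invmx (Jac s (g c)))) => //.
- by move=> c; exact: inverse_continuous.
- move=> v c [x Ux <-]; have [dg dgE] := inverse_is_diff Ux.
  by rewrite sK// -dgE -deriveE//; apply: derivableP; exact: diff_derivable.
move=> v; apply/(Ck_coordP k _ oV) => j.
apply: (@Ck_eq _ _ _ (fun c => \sum_i v 0 i * ((\det (Jac s (g c)))^-1 *
   ((-1) ^+ (j + i) * \det (row' j (col' i (Jac s (g c)))))))) => //.
  move=> c Vc; rewrite mxE; apply: eq_bigr => i _.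
  by rewrite /invmx (jac_unit (gU c Vc)) [X in _ * X = _]/= !mxE.
apply: Ck_sum => // i; apply: CkM => //; first exact: Ck_cst.
have Cdet : Ck k (s @` U) (fun c => (\det (Jac s (g c)))^-1).
  apply: CkV => // [c Vc|]; last exact: Ck_det.
  by have := jac_unit (gU c Vc); rewrite unitmxE unitfE.
apply: CkM => //; apply: CkM => //; first exact: Ck_cst.
apply: Ck_det => // a b.
by apply: Ck_eq (CJ (lift j a) (lift i b)) => // c _; rewrite /J !mxE.
Qed.

End InverseFunction.
End Ck.

(** * Bump functions on R^n *)

Section FlatFunction.
Context {R : realType}.
Implicit Type p : {poly R}.

(** The functions p(1/t) e^(-1/t) for t > 0, extended by 0: differentiation maps
    the family to itself, [dflat p] being the new polynomial, hence all of them
    are smooth at once. *)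
Definition flat p (t : R) : R := if 0 < t then p.[t^-1] * expR (- t^-1) else 0.
Definition dflat p : {poly R} := 'X ^+ 2 * (p - p^`()).

Lemma flat_bound p : exists2 K : R, 0 < K & forall s : R, 1 <= s ->
  `|p.[s]| * s ^+ 2 <= K * expR s.
Proof.
pose C : R := \sum_(i < size p) `|p`_i|.
have C0 : 0 <= C by exact: sumr_ge0.
exists ((C + 1) * (size p).+2`!%:R).
  by rewrite mulr_gt0 ?ltr0n ?fact_gt0// ltr_wpDl.
move=> s s1; have s0 : 0 < s by rewrite (lt_le_trans ltr01).
apply: (@le_trans _ _ ((C + 1) * s ^+ (size p).+2)).
  rewrite -[(size p).+2]addn2 exprD [leRHS]mulrA ler_wpM2r ?sqr_ge0// horner_coef.
  apply: (@le_trans _ _ (C * s ^+ size p)); last first.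
    by rewrite ler_wpM2r ?exprn_ge0 ?ltW// ltrDl.
  rewrite mulr_suml (le_trans (ler_norm_sum _ _ _))//; apply: ler_sum => i _.
  rewrite normrM ler_wpM2l// ger0_norm ?exprn_ge0 ?(ltW s0)//.
  by apply: ler_weXn2l => //; exact: ltnW.
rewrite -mulrA ler_wpM2l ?addr_ge0//.
rewrite mulrC -ler_pdivrMr ?ltr0n ?fact_gt0//.
by apply: le_trans (expR_ge1Dxn (size p).+1 (ltW s0)); rewrite lerDr.
Qed.

Lemma flat_is_derive p t : is_derive t (1 : R) (flat p) (flat (dflat p) t).
Proof.
have [t0|t0|<-] := ltgtP 0 t.
- have tn : t != 0 by rewrite gt_eqF.
  have dV : is_derive t (1 : R) (fun u : R => u^-1) (- t ^- 2).
    by have := is_deriveV tn (is_derive_id t 1); rewrite [_ *: _]mulr1.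
  have dp : is_derive t (1 : R) (fun u => p.[u^-1]) ((p^`()).[t^-1] * (- t ^- 2)).
    exact: (is_derive1_comp (is_derive_poly p t^-1) dV).
  have de : is_derive t (1 : R) (fun u => expR (- u^-1)) (expR (- t^-1) * t ^- 2).
    have dN := is_deriveN dV; rewrite opprK in dN.
    exact: (@is_derive1_comp R expR (fun u => - u^-1) t _ _ (is_derive_expR _) dN).
  have H := is_deriveM dp de.
  have E : flat (dflat p) t = p.[t^-1] *: (expR (- t^-1) * t ^- 2) +
      expR (- t^-1) *: ((p^`()).[t^-1] * (- t ^- 2)).
    rewrite /flat t0 /dflat !hornerE /GRing.scale /=; field; exact: tn.
  rewrite E; apply: near_eq_is_derive H.
  by near=> u; rewrite /flat ifT//; near: u; exact: lt_nbhsr.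
- have E : flat (dflat p) t = 0 by rewrite /flat ltNge (ltW t0).
  rewrite E; apply: near_eq_is_derive (is_derive_cst (0 : R) t 1).
  by near=> u; rewrite /flat ltNge ltW//; near: u; exact: lt_nbhsl.
have E : flat (dflat p) 0 = 0 by rewrite /flat ltxx.
rewrite E; apply/is_derive_eps => e e0.
have [K K0 HK] := flat_bound p.
near=> h; rewrite [h *: 1]mulr1 scaler0 addr0 {2}/flat ltxx !subr0 /flat.
case: ifP => [h0|_]; last by rewrite normr0 mulr_ge0// ltW.
have h1 : `|h| < 1 by near: h; exact: (@nbhs0_lt R R).
have hK : `|h| < e / K by near: h; apply: (@nbhs0_lt R R); rewrite divr_gt0.
rewrite (gtr0_norm h0) in h1 hK *.
have s1 : 1 <= h^-1 by rewrite invf_ge1// ltW.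
have := HK _ s1; rewrite normrM (ger0_norm (expR_ge0 _)) expRN ler_pdivrMr ?expR_gt0//.
rewrite -ler_pdivlMr ?exprn_gt0 ?invr_gt0// => /le_trans; apply.
rewrite mulrAC ler_wpM2r ?expR_ge0// exprVn invrK expr2 mulrA ler_wpM2r ?(ltW h0)//.
by rewrite -ler_pdivlMl// mulrC ltW.
Unshelve. all: by end_near. Qed.

Lemma is_derive_lineP (V W : normedModType R) (f : V -> W) x v d :
  is_derive x v f d <-> is_derive (0 : R) (1 : R) (fun t : R => f (t *: v + x)) d.
Proof.
split=> /is_derive_eps H; apply/is_derive_eps => e e0; have := H e e0;
  by apply: filterS => h; rewrite [h *: 1]mulr1 addr0 scale0r add0r.
Qed.

Lemma Ck_flat n k p (U : set 'rV[R]_n) (f : 'rV[R]_n -> R) : open U ->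
  Ck k U f -> Ck k U (flat p \o f).
Proof.
have cflat q t : {for t, continuous (flat q)}.
  apply: differentiable_continuous; apply/derivable1_diffP.
  by have [] := flat_is_derive q t.
move=> oU; elim: k p => [|k IH] p Cf.
  by move=> x Ux; apply: continuous_comp; [exact: Cf | exact: cflat].
apply: (@CkS _ _ _ _ _ _ (fun v x => flat (dflat p) (f x) * 'D_v f x)) => //.
- by move=> x Ux; apply: continuous_comp; [exact: Ck_continuous Cf Ux | exact: cflat].
- move=> v x Ux; apply/is_derive_lineP; apply: (@is_derive1_comp _ (flat p)).
    by rewrite scale0r add0r; exact: flat_is_derive.
  exact: (is_derive_lineP _ _ _ _).1 (Ck_derive v Cf Ux).
- by move=> v; apply: CkM => //; [apply: IH; exact: CkW | exact: CkD_].
Qed.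

End FlatFunction.

(** In each coordinate F(2 - u) / (F(2 - u) + F(u - 1)), where F is e^(-1/t)
    extended by 0 and u is the square of the rescaled coordinate, is 1 for
    u <= 1 and 0 for u >= 2. *)
Lemma bump_function (R : realType) n (U : set 'rV[R]_n) x : open U -> U x ->
  exists (b : 'rV[R]_n -> R) (W K : set 'rV[R]_n),
    [/\ forall k, Ck k setT b, open W /\ W x, compact K /\ K `<=` U,
        forall y, W y -> b y = 1 & forall y, ~ K y -> b y = 0].
Proof.
move=> oU Ux; have [r0 r00 Hr0] := (nbhs_norm_ex _ _).1 (open_nbhs_nbhs (conj oU Ux)).
pose r := r0 / 4; have r_gt0 : 0 < r by rewrite divr_gt0.
pose F (t : R) : R := flat 1 t.
have F0 t : t <= 0 -> F t = 0 by rewrite /F /flat leNgt => /negPf ->.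
have Fp t : 0 < t -> 0 < F t by rewrite /F /flat => ->; rewrite hornerC mul1r expR_gt0.
have Fge t : 0 <= F t by case: (leP t 0) => [/F0 ->//|/Fp/ltW].
pose u i (y : 'rV[R]_n) : R := ((y 0 i - x 0 i) * r^-1) ^+ 2.
pose b y := \prod_i (F (2 - u i y) * (F (2 - u i y) + F (u i y - 1))^-1).
pose W : set 'rV[R]_n := [set y | `|x - y| < r].
pose K : set 'rV[R]_n := closed_ball x (2 * r).
have uabs i (y : 'rV[R]_n) c : 0 <= c -> (`|x 0 i - y 0 i| <= c * r) = (u i y <= c ^+ 2).
  move=> c0; rewrite /u -[X in _ = (X <= _)]real_normK ?num_real// ler_sqr ?nnegrE//.
  by rewrite normrM normfV (gtr0_norm r_gt0) ler_pdivrMr// distrC.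
have r20 : 0 < 2 * r by rewrite mulr_gt0.
exists b, W, K; split.
- move=> k; apply: Ck_prod => [|i]; first exact: openT.
  have Cu : Ck k setT (u i).
    have C1 : Ck k setT (fun y : 'rV[R]_n => (y 0 i - x 0 i) * r^-1).
      apply: CkM; [exact: openT| |exact: Ck_cst openT].
      by apply: CkD; [exact: openT|exact: Ck_coord openT _ _|exact: Ck_cst openT].
    exact: (CkM openT C1 C1).
  have C2 : Ck k setT (fun y => 2 - u i y).
    apply: (@Ck_eq _ _ _ _ _ (cst 2 \+ (cst (-1) \* u i))) => //; first exact: openT.
      by move=> y _; rewrite /= mulN1r.
    apply: CkD; [exact: openT|exact: Ck_cst openT|].
    by apply: CkM; [exact: openT|exact: Ck_cst openT|].
  have C3 : Ck k setT (fun y => u i y - 1).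
    by apply: CkD; [exact: openT|exact: Cu|exact: Ck_cst openT].
  have C4 := Ck_flat 1 openT C2; have C5 := Ck_flat 1 openT C3.
  apply: CkM; [exact: openT|exact: C4|].
  apply: CkV; [exact: openT| |by apply: CkD; [exact: openT|exact: C4|exact: C5]].
  move=> y _; rewrite gt_eqF//; case: (ltP (u i y) 2) => h.
    by rewrite ltr_wpDr// ?Fge// Fp// subr_gt0.
  by rewrite ltr_wpDl// ?Fge// Fp// subr_gt0 (lt_le_trans _ h)// ltr1n.
- split; last by rewrite /W /= subrr normr0.
  rewrite (_ : W = ball x r); first exact: ball_open.
  by rewrite -ball_normE.
- split.
    exact: compact_closed_ball.
  move=> y; rewrite /K closed_ballE// => Hy; apply: Hr0; apply: le_lt_trans Hy _.
  by rewrite /r; lra.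
- move=> y Wy; rewrite /b big1// => i _.
  have : u i y <= 1 ^+ 2.
    rewrite -uabs// mul1r (le_trans _ (ltW Wy))// (le_trans _ (mx_norm_coord _ i))//.
    by rewrite !mxE.
  rewrite expr1n => u1.
  rewrite [F (_ - 1)]F0 ?subr_le0// addr0 divff// gt_eqF// Fp// subr_gt0.
  by rewrite (le_lt_trans u1)// ltr1n.
- move=> y Ky; have [i Hi] : exists i, 2 * r < `|x 0 i - y 0 i|.
    apply: contrapT => H; apply: Ky; rewrite /K closed_ballE//.
    apply: (mx_norm_le (ltW r20)) => i; rewrite !mxE leNgt; apply/negP => Hi.
    by apply: H; exists i.
  rewrite /b (bigD1 i)//= [F (2 - _)]F0 ?mul0r// subr_le0.
  have : ~~ (u i y <= 2 ^+ 2) by rewrite -uabs// -ltNge.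
  by rewrite -ltNge; lra.
Unshelve. all: by end_near. Qed.

(** * Alternating sums over faces *)

Section Faces.
Context {R : numDomainType} {T : Type}.

Definition antisym m (f : ('I_m -> T) -> R) :=
  forall u i j, i != j -> f (u \o tperm i j) = - f u.

(** A transposition is conjugate to one at a smaller distance by an adjacent
    transposition. *)
Lemma antisym_adjacent m (f : ('I_m -> T) -> R) :
  (forall u (i j : 'I_m), j = i.+1 :> nat -> f (u \o tperm i j) = - f u) -> antisym f.
Proof.
move=> adj; suff H d u (i j : 'I_m) : (j = i + d.+1 :> nat)%N -> f (u \o tperm i j) = - f u.
  move=> u i j; rewrite -val_eqE neq_ltn /= => /orP[ij|ji].
    by apply: (H (j - i).-1); lia.
  by rewrite tpermC; apply: (H (i - j).-1); lia.
elim: d u j => [|d IH] u j ji; first by apply: adj; lia.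
have km : (i + d.+1 < m)%N by have := ltn_ord j; lia.
pose k := Ordinal km.
have kj : j = k.+1 :> nat by rewrite /=; lia.
have E : tperm i j = (tperm i k ^ tperm k j)%g.
  rewrite tpermJ tpermL tpermD//; apply/eqP => /(congr1 val) /=; lia.
have -> : u \o tperm i j = ((u \o tperm k j) \o tperm i k) \o tperm k j.
  by apply: funext => x; rewrite E /= conjgE tpermV !permM.
by rewrite adj// IH// adj// opprK.
Qed.

Lemma tperm_lift_adjacent m (i j : 'I_m.+1) x : j = i.+1 :> nat ->
  tperm i j (lift i x) = lift j x /\ tperm i j (lift j x) = lift i x.
Proof.
move=> ij.
have key a b : j = i.+1 :> nat -> a = lift i x -> b = lift j x -> tperm i j a = b.
  move=> _ -> ->; apply: val_inj.
  case: tpermP => [/(congr1 val)|/(congr1 val)|/eqP + /eqP]; rewrite -?val_eqE /= /bump.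
  - by have := ltn_ord x; lia.
  - by case: leqP; case: leqP; lia.
  - by case: leqP; case: leqP; lia.
have H : tperm i j (lift i x) = lift j x by exact: key.
by split=> //; rewrite -H tpermK.
Qed.

(** Switching two adjacent entries exchanges the two faces that omit one of
    them, whose signs are opposite, and switches two entries of each other face.
    Both the exterior derivative and the Cech differential of an alternating
    object are alternating for this reason. *)
Lemma antisym_face_sum m (Phi : T -> ('I_m -> T) -> R) :
  (forall t, antisym (Phi t)) ->
  antisym (fun v : 'I_m.+1 -> T => \sum_(k < m.+1) (-1) ^+ k * Phi (v k) (v \o lift k)).
Proof.
move=> aPhi; apply: antisym_adjacent => v i j ij.
have nij : j != i by rewrite -val_eqE /=; lia.
rewrite (bigD1 i)//= (bigD1 j)//= [in RHS](bigD1 i)//= [in RHS](bigD1 j)//=.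
rewrite tpermL tpermR.
have -> : v \o tperm i j \o lift i = v \o lift j.
  by apply: funext => x /=; rewrite (tperm_lift_adjacent x ij).1.
have -> : v \o tperm i j \o lift j = v \o lift i.
  by apply: funext => x /=; rewrite (tperm_lift_adjacent x ij).2.
rewrite (_ : (-1) ^+ j = - (-1) ^+ i); last by rewrite ij exprS mulN1r.
rewrite [X in _ + (_ + X) = _](_ : _ = - \sum_(k < m.+1 | (k != i) && (k != j)) (-1) ^+ k * Phi (v k) (v \o lift k)).
  ring.
rewrite -sumrN; apply: eq_bigr => k /andP[ki kj].
rewrite tpermD 1?eq_sym//.
have [i' ii' _] := unlift_some ki; have [j' jj' _] := unlift_some kj.
have -> : v \o tperm i j \o lift k = v \o lift k \o tperm i' j'.
  apply: funext => x /=; rewrite (inj_tperm _ _ _ (@lift_inj _ k)).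
  by rewrite -ii' -jj'.
rewrite aPhi ?mulrN//; apply: contraNneq nij => E.
by rewrite ii' jj' E.
Qed.

(** Omitting two entries in either order gives the same string with opposite
    signs. This is behind d^2 = 0, delta^2 = 0 and d f^* = f^* d. *)
Lemma face_face_sum m (Psi : T -> T -> ('I_m -> T) -> R) (v : 'I_m.+2 -> T) :
  (forall a b u, Psi a b u = Psi b a u) ->
  \sum_(k < m.+2) \sum_(l < m.+1)
    (-1) ^+ k * ((-1) ^+ l * Psi (v k) (v (lift k l)) (v \o lift k \o lift l)) = 0.
Proof.
move=> sPsi; rewrite pair_big /=.
set F : 'I_m.+2 * 'I_m.+1 -> R := fun p => (-1) ^+ p.1 * ((-1) ^+ p.2 * Psi (v p.1) (v (lift p.1 p.2)) (v \o lift p.1 \o lift p.2)).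
have hP (p : 'I_m.+2 * 'I_m.+1) : (unbump p.2 p.1 < m.+1)%N.
  by case: p => k l /=; have := ltn_ord k; have := ltn_ord l; rewrite /unbump; case: ltnP; lia.
pose h p := (lift p.1 p.2, Ordinal (hP p)).
have hK : involutive h.
  move=> [k l]; rewrite /h /=; congr pair; apply: val_inj => /=;
  have := ltn_ord k; have := ltn_ord l; rewrite /bump /unbump;
  by case: leqP => ? /=; case: ltnP => ? /=; try case: leqP; try case: ltnP; lia.
suff H : \sum_p F p = - \sum_p F p.
  by apply/eqP; rewrite -[_ == 0](@mulrn_eq0 _ _ 2) mulr2n {1}H addNr.
rewrite {1}(reindex_inj (inv_inj hK)) -sumrN; apply: eq_bigr => -[k l] _.
rewrite /F /=.
have hh : lift (lift k l) (Ordinal (hP (k, l))) = k by have /(congr1 fst) := hK (k, l).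
rewrite hh sPsi.
have -> : v \o lift (lift k l) \o lift (Ordinal (hP (k, l))) = v \o lift k \o lift l.
  apply: funext => x /=; congr v; apply: val_inj => /=.
  by rewrite [RHS]bumpC.
rewrite !mulrA -mulNr -!exprD; congr (_ * _).
rewrite -signr_odd -[in RHS]signr_odd !oddD /=.
have : odd (bump k l + unbump l k) = ~~ odd (k + l).
  by rewrite /bump /unbump; case: leqP => ? /=; lia.
rewrite !oddD => ->; case: (odd k (+) odd l); rewrite /= ?expr0 ?expr1 ?opprK//.
Qed.

Definition scons m (t : T) (u : 'I_m -> T) : 'I_m.+1 -> T :=
  fun i => if unlift ord0 i is Some k then u k else t.

Lemma scons0 m t (u : 'I_m -> T) : scons t u ord0 = t.
Proof. by rewrite /scons unlift_none. Qed.

Lemma sconsS m t (u : 'I_m -> T) k : scons t u (lift ord0 k) = u k.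
Proof. by rewrite /scons liftK. Qed.

Lemma scons_face0 m t (u : 'I_m -> T) : scons t u \o lift ord0 = u.
Proof. by apply: funext => k /=; rewrite sconsS. Qed.

Lemma scons_faceS m t (u : 'I_m.+1 -> T) k :
  scons t u \o lift (lift ord0 k) = scons t (u \o lift k).
Proof.
apply: funext => x /=; case: (unliftP ord0 x) => [y|] ->.
  rewrite sconsS (_ : lift _ _ = lift ord0 (lift k y)) ?sconsS//.
  by apply: val_inj; rewrite /= /bump /=; lia.
rewrite scons0 (_ : lift _ _ = ord0) ?scons0//.
by apply: val_inj.
Qed.

Lemma scons_tperm m t (u : 'I_m -> T) i j :
  scons t (u \o tperm i j) = scons t u \o tperm (lift ord0 i) (lift ord0 j).
Proof.
apply: funext => x /=; case: (unliftP ord0 x) => [y|] ->.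
  by rewrite sconsS -(inj_tperm _ _ _ (@lift_inj _ ord0)) sconsS.
by rewrite tpermD ?scons0// eq_sym neq_lift.
Qed.

(** The sign counts the k adjacent transpositions that bring the entry to the
    front. *)
Lemma antisym_to_front m (f : ('I_m.+1 -> T) -> R) u (k : 'I_m.+1) (z : T) : antisym f ->
  f (dfwith u k z) = (-1) ^+ k * f (scons z (u \o lift k)).
Proof.
move=> af; case: k => k; elim: k u => [|k IH] u km.
  rewrite /= expr0 mul1r; congr f; apply: funext => x.
  case: (unliftP ord0 x) => [y|] ->.
    rewrite sconsS dfwithout; last by rewrite -val_eqE.
    by congr u; apply: val_inj.
  rewrite scons0 (_ : ord0 = Ordinal km) ?dfwithin//; exact: val_inj.
set j := Ordinal km; pose i := Ordinal (ltnW km).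
have nij : i != j by rewrite -val_eqE /=; lia.
have -> : dfwith u j z = dfwith (u \o tperm i j) i z \o tperm i j.
  apply: funext => x /=; case: tpermP => [->|->|/eqP xi /eqP xj].
  - by rewrite !dfwithout//= ?tpermR// eq_sym.
  - by rewrite !dfwithin.
  - by rewrite !dfwithout//= 1?eq_sym// tpermD// eq_sym.
rewrite af// IH exprS mulN1r mulNr; congr (- (_ * f (scons z _))).
apply: funext => x /=; congr u.
by rewrite (_ : Ordinal _ = i) ?(tperm_lift_adjacent x (_ : j = i.+1 :> nat)).1//; exact: val_inj.
Qed.

End Faces.

(* Otherwise unification compares differentials by unfolding them. *)
Opaque derive diff.

(** * Differential forms *)

Lemma diff_near_eq (R : realType) (V1 V2 : normedModType R) (f g : V1 -> V2) x : differentiable f x -> differentiable g x ->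
  (\forall y \near x, f y = g y) -> forall v, 'd f x v = 'd g x v.
Proof. by move=> df dg fg v; rewrite -!deriveE//; exact: near_eq_derive. Qed.

Lemma diff_comp_near (R : realType) (V1 V2 V3 : normedModType R) (f : V1 -> V2) (g : V2 -> V3) k x : differentiable f x ->
  differentiable g (f x) -> differentiable k x ->
  (\forall y \near x, g (f y) = k y) -> forall v, 'd g (f x) ('d f x v) = 'd k x v.
Proof.
move=> df dg dk H v.
have <- : 'd (g \o f) x v = 'd g (f x) ('d f x v) by rewrite diff_comp.
exact: (diff_near_eq (differentiable_comp df dg)).
Qed.

Section Forms.
Context {R : realType} {n : nat}.
Local Notation E := 'rV[R]_n.

Definition mlin q (f : ('I_q -> E) -> R) :=
  forall v i (c : R) a b,
    f (dfwith v i (c *: a + b)) = c * f (dfwith v i a) + f (dfwith v i b).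

Definition alt q (f : ('I_q -> E) -> R) :=
  forall v i j, i != j -> v i = v j -> f v = 0.

Section Multilinear.
Context {q : nat} (f : ('I_q -> E) -> R) (fl : mlin f).

Lemma mlin0 v i : f (dfwith v i 0) = 0.
Proof.
have := fl v i 1 0 0; rewrite scaler0 addr0 mul1r => /eqP.
by rewrite -subr_eq subrr => /eqP <-.
Qed.

Lemma mlinD v i a b : f (dfwith v i (a + b)) = f (dfwith v i a) + f (dfwith v i b).
Proof. by have := fl v i 1 a b; rewrite scale1r mul1r. Qed.

Lemma mlinZ v i c a : f (dfwith v i (c *: a)) = c * f (dfwith v i a).
Proof. by have := fl v i c a 0; rewrite addr0 mlin0 addr0. Qed.

Lemma mlin_basis v i z :
  f (dfwith v i z) = \sum_j z 0 j * f (dfwith v i (delta_mx 0 j)).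
Proof.
rewrite {1}[z]row_sum_delta; elim/big_ind2: _ => [|a b c d Ha Hc|j _].
- exact: mlin0.
- by rewrite mlinD Ha Hc.
- exact: mlinZ.
Qed.

Lemma dfwith_id (v : 'I_q -> E) i : dfwith v i (v i) = v.
Proof. by apply: funext => j; case: dfwithP. Qed.

Lemma dfwithC (v : 'I_q -> E) i j a b : i != j ->
  dfwith (dfwith v i a) j b = dfwith (dfwith v j b) i a.
Proof.
move=> ij; apply: funext => k; have [<-|ik] := eqVneq i k.
  by rewrite dfwithin dfwithout 1?eq_sym// dfwithin.
rewrite [RHS]dfwithout//; have [<-|jk] := eqVneq j k; rewrite ?dfwithin// !dfwithout//.
Qed.

Lemma alt_antisym : alt f -> antisym f.
Proof.
move=> fa u i j ij; pose F a b := f (dfwith (dfwith u i a) j b).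
have FD1 a a' b : F (a + a') b = F a b + F a' b.
  by rewrite /F !(dfwithC u _ _ ij) mlinD.
have FD2 a b b' : F a (b + b') = F a b + F a b' by rewrite /F mlinD.
have F0 a : F a a = 0.
  by apply: (fa _ i j ij); rewrite dfwithin dfwithout 1?eq_sym// dfwithin.
have Fs a b : F a b = - F b a.
  by have := F0 (a + b); rewrite FD1 !FD2 !F0 add0r addr0 => /eqP; rewrite addr_eq0 => /eqP.
have -> : f u = F (u i) (u j) by rewrite /F dfwith_id dfwith_id.
rewrite -Fs /F; congr f; apply: funext => k /=; case: tpermP => [->|->|/eqP ki /eqP kj].
- by rewrite dfwithout 1?eq_sym// dfwithin.
- by rewrite dfwithin.
- by rewrite !dfwithout// eq_sym.
Qed.

Lemma antisym_alt : antisym f -> alt f.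
Proof.
move=> fa v i j ij vij; have := fa v i j ij.
have -> : v \o tperm i j = v.
  by apply: funext => k /=; case: tpermP => // ->.
by move/eqP; rewrite -addr_eq0 -mulr2n mulrn_eq0 => /eqP.
Qed.

End Multilinear.

Lemma comp_dfwith q (g : E -> E) (v : 'I_q -> E) k z :
  (fun i => g (dfwith v k z i)) = dfwith (fun i => g (v i)) k (g z).
Proof.
by apply: funext => j; have [->|kj] := eqVneq k j; rewrite ?dfwithin// !dfwithout.
Qed.

Lemma dfwith_lift_same q (v : 'I_q.+1 -> E) k z : dfwith v k z \o lift k = v \o lift k.
Proof. by apply: funext => j /=; rewrite dfwithout// neq_lift. Qed.

Lemma dfwith_lift q (v : 'I_q.+1 -> E) k l z :
  dfwith v (lift k l) z \o lift k = dfwith (v \o lift k) l z.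
Proof.
apply: funext => j /=; have [<-|lj] := eqVneq l j; rewrite ?dfwithin// !dfwithout//=.
by rewrite (inj_eq (@lift_inj _ k)).
Qed.

(** A multilinear map on moving vectors is reduced to constant vectors by
    expanding one moving vector at a time in the standard basis. *)
Lemma frame_ind q (Q : (E -> E) -> Prop) (P : (E -> 'I_q -> E) -> Prop) :
  (forall a, Q (fun=> a)) -> (forall v, P (fun=> v)) ->
  (forall c i, (forall k, Q (fun y => c y k)) ->
    (forall j, P (fun y => dfwith (c y) i (delta_mx 0 j))) -> P c) ->
  forall c, (forall i, Q (fun y => c y i)) -> P c.
Proof.
move=> Q0 P0 PS c Qc.
suff H m (c' : E -> 'I_q -> E) : (m <= q)%N -> (forall i, Q (fun y => c' y i)) ->
    (forall i : 'I_q, (m <= i)%N -> exists a, forall y, c' y i = a) -> P c'.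
  by apply: (H q) => // i; rewrite leqNgt ltn_ord.
elim: m c' => [|m IH] c' mq Qc' cst'.
  have [f Hf] : exists f, forall i y, c' y i = f i.
    have H i : exists a, forall y, c' y i = a by exact: cst'.
    by exists (fun i => projT1 (cid (H i))) => i y; case: cid.
  rewrite (_ : c' = fun=> f); first exact: P0.
  by apply: funext => y; apply: funext => i.
apply: (PS _ (Ordinal mq)) => // j; apply: IH => [|i|i mi]; first exact: ltnW.
  have [<-|i0i] := eqVneq (Ordinal mq) i.
    by under eq_fun do rewrite dfwithin.
  by under eq_fun do rewrite dfwithout//.
have [<-|i0i] := eqVneq (Ordinal mq) i.
  by exists (delta_mx 0 j) => y; rewrite dfwithin.
have [|b Hb] := cst' i; first by move: i0i; rewrite -val_eqE /=; lia.
by exists b => y; rewrite dfwithout.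
Qed.

Section OnOpen.
Context (U : set E) (oU : open U).

Lemma OmegaP q (w : dform R n q) : Omega U w <->
  [/\ forall x, mlin (w x), forall x, alt (w x),
      forall v k, Ck k U (fun x => w x v) & forall x v, ~ U x -> w x v = 0].
Proof.
by split=> -[lw aw sw zw]; split=> // v; have := sw v; rewrite smooth_onP.
Qed.

Lemma Omega_derive_lin q (w : dform R n q) x u : Omega U w -> U x -> 
  mlin (fun v => 'D_u (fun y => w y v) x).
Proof.
move=> /OmegaP[lw _ sw _] Ux v i c a b.
have D z := Ck_derive u (sw z 1%N) Ux.
rewrite (_ : (fun y => w y _) = (fun y => c * w y (dfwith v i a)) + (fun y => w y (dfwith v i b))).
  by have [_ ->] := is_deriveD (is_deriveZ c (D (dfwith v i a))) (D (dfwith v i b)).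
by apply: funext => y; rewrite lw.
Qed.

Lemma Ck_derive_lindir (f : E -> R) x c a b : Ck 1 U f -> U x ->
  'D_(c *: a + b) f x = c * 'D_a f x + 'D_b f x.
Proof.
move=> Cf Ux; have df := Ck_differentiable oU Cf Ux.
by rewrite !deriveE// linearP.
Qed.

Lemma extdE q (w : dform R n q) x v : U x ->
  extd U w x v = \sum_(i < q.+1) (-1) ^+ i * 'D_(v i) (fun y => w y (v \o lift i)) x.
Proof. by move=> Ux; rewrite /extd mem_set. Qed.

Lemma extd_Omega q (w : dform R n q) : Omega U w -> Omega U (extd U w).
Proof.
move=> Ow; have [lw aw sw zw] := (OmegaP _).1 Ow.
have z x v : ~ U x -> extd U w x v = 0 by move=> Ux; rewrite /extd memNset.
have dl x : mlin (extd U w x).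
  move=> v i c a b; have [Ux|Ux] := pselect (U x); last by rewrite !z// mulr0 addr0.
  rewrite !extdE// mulr_sumr -big_split /=; apply: eq_bigr => k _.
  rewrite [c * _]mulrCA -mulrDr; congr (_ * _).
  have [<-|ki] := eqVneq k i.
    rewrite !dfwithin !dfwith_lift_same.
    exact: Ck_derive_lindir (sw _ 1%N) Ux.
  have [l -> _] := unlift_some ki.
  rewrite !dfwithout 1?eq_sym ?neq_lift// !dfwith_lift.
  by have := Omega_derive_lin (v k) Ow Ux (v \o lift k) l c a b.
apply/OmegaP; split=> //.
- move=> x; apply: antisym_alt; have [Ux|Ux] := pselect (U x); last first.
    by move=> v i j ij; rewrite !z// oppr0.
  have aP : forall t, antisym (fun v => 'D_t (fun y => w y v) x).
    move=> t u i j ij; rewrite (_ : (fun y => _) = - (fun y => w y u)).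
      by have [_ ->] := is_deriveN (Ck_derive t (sw u 1%N) Ux).
    by apply: funext => y; rewrite (alt_antisym (lw y) (aw y)).
  move=> v i j ij; rewrite !extdE//.
  exact: (antisym_face_sum aP).
- move=> v k; apply: (@Ck_eq _ _ _ _ _ (fun x => \sum_(i < q.+1) (-1) ^+ i * 'D_(v i) (fun y => w y (v \o lift i)) x)) => //.
    by move=> x Ux; rewrite extdE.
  apply: Ck_sum => // i; apply: CkM => //; first exact: Ck_cst.
  by apply: CkD_; exact: sw.
Qed.

Lemma Ck_derive_comm (f : E -> R) x a b : Ck 2 U f -> U x ->
  'D_a ('D_b f) x = 'D_b ('D_a f) x.
Proof.
move=> Cf Ux; apply: (derive_comm oU Ux).
- by move=> y Uy; have [] := Ck_derive b Cf Uy.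
- by move=> y Uy; have [] := Ck_derive a Cf Uy.
- by move=> y Uy; have [] := Ck_derive a (CkD_ b Cf) Uy.
- by move=> y Uy; have [] := Ck_derive b (CkD_ a Cf) Uy.
- exact: (Ck_continuous (CkD_ a (CkD_ b Cf)) Ux).
- exact: (Ck_continuous (CkD_ b (CkD_ a Cf)) Ux).
Qed.

Lemma extd_extd q (w : dform R n q) : Omega U w -> extd U (extd U w) = (fun _ _ => 0).
Proof.
move=> Ow; have [lw aw sw zw] := (OmegaP _).1 Ow.
apply: funext => x; apply: funext => v; have [Ux|Ux] := pselect (U x); last first.
  by rewrite /extd memNset.
rewrite extdE// -[RHS](face_face_sum (Psi := fun a b u => 'D_a ('D_b (fun y => w y u)) x) v).
  apply: eq_bigr => i _; rewrite -mulr_sumr; congr (_ * _).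
  rewrite (@near_eq_derive _ _ _ _ (\sum_(j < q.+1) (fun y => (-1) ^+ j *
    'D_(v (lift i j)) (fun y => w y (v \o lift i \o lift j)) y))); last first.
    apply: filterS (open_nbhs_nbhs (conj oU Ux)) => y Uy.
    by rewrite extdE// fct_sumE.
  have D j := Ck_derive (v i) (CkD_ (v (lift i j)) (sw (v \o lift i \o lift j) 2%N)) Ux.
  by have [_ ->] := is_derive_sum (fun j => is_deriveZ ((-1) ^+ j) (D j)).
by move=> a b u; exact: Ck_derive_comm (sw _ 2%N) Ux.
Qed.

End OnOpen.

Lemma is_derive_valE (V W : normedModType R) (f : V -> W) x v d :
  is_derive x v f d -> 'D_v f x = d.
Proof. by case. Qed.

Lemma continuous_neq0 (W : normedModType R) (f : E -> W) x :
  {for x, continuous f} -> f x != 0 -> \forall y \near x, f y != 0.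
Proof. by move=> c f0; exact: (@cvgr_neq0 _ _ _ _ _ f (f x) c f0). Qed.

Section Pullback.
Context (U U' : set E) (oU : open U) (oU' : open U').

Lemma Ck_mlin_comp k q (w : dform R n q) (f : E -> E) (c : E -> 'I_q -> E) :
  (forall x, U x -> U' (f x)) -> Omega U' w -> Ck k U f ->
  (forall i, Ck k U (fun y => c y i)) -> Ck k U (fun y => w (f y) (c y)).
Proof.
move=> fU /OmegaP[lw _ sw _] Cf.
apply: (frame_ind (Q := fun g => Ck k U g) (P := fun c => Ck k U (fun y => w (f y) (c y)))).
- by move=> a; exact: Ck_cst.
- by move=> v; exact: (Ck_comp oU oU' fU Cf (sw v k)).
move=> {}c i Cc IH.
apply: (@Ck_eq _ _ _ _ _ (fun y => \sum_j c y i 0 j * w (f y) (dfwith (c y) i (delta_mx 0 j)))) => //.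
  by move=> y _; rewrite -mlin_basis// dfwith_id.
apply: Ck_sum => // j; apply: CkM => //.
exact: (Ck_coordP k _ oU).1.
Qed.

(** The Leibniz rule for a form evaluated on moving vectors. *)
Lemma is_derive_mlin_comp q (w : dform R n q) (f : E -> E) (c : E -> 'I_q -> E) x u :
  (forall x, U x -> U' (f x)) -> Omega U' w -> Ck 1 U f ->
  (forall i, Ck 1 U (fun y => c y i)) -> U x ->
  is_derive x u (fun y => w (f y) (c y))
    ('D_('D_u f x) (fun y => w y (c x)) (f x) +
     \sum_i w (f x) (dfwith (c x) i ('D_u (fun y => c y i) x))).
Proof.
move=> fU Ow Cf + Ux; have [lw _ sw _] := (OmegaP _ _).1 Ow.
move: c; apply: (frame_ind (Q := fun g => Ck 1 U g) (P := fun c => is_derive x u (fun y => w (f y) (c y))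
    ('D_('D_u f x) (fun y => w y (c x)) (f x) +
     \sum_i w (f x) (dfwith (c x) i ('D_u (fun y => c y i) x))))).
- by move=> a; exact: Ck_cst.
- move=> v; rewrite big1 ?addr0; last by move=> i _; rewrite derive_cst mlin0.
  have := Ck_is_derive_comp u oU oU' Cf (sw v 1%N) Ux (fU x Ux).
  rewrite -(C1_derive_sum ('D_u f x) oU')//; last exact: fU.
    by move=> a y Uy; have [] := Ck_derive a (sw v 1%N) Uy.
  by move=> a y Uy; exact: Ck_continuous (CkD_ a (sw v 1%N)) Uy.
move=> c i Cc IH.
have Dc j := is_derive_coord (Ck_derive u (Cc i) Ux) j.
have -> : (fun y => w (f y) (c y)) = \sum_j ((fun y => c y i 0 j) *
    (fun y => w (f y) (dfwith (c y) i (delta_mx 0 j)))).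
  by apply: funext => y; rewrite fct_sumE -[RHS](mlin_basis (lw (f y))) dfwith_id.
apply: is_derive_eq (is_derive_sum (fun j => is_deriveM (Dc j) (IH j))) _.
rewrite big_split /= addrC [RHS]addrC (bigD1 i)//= -[RHS]addrA; congr (_ + _).
  rewrite [RHS](mlin_basis (lw (f x))); apply: eq_bigr => j _.
  by rewrite [_ *: _]mulrC.
rewrite [RHS]addrC.
have -> : 'D_('D_u f x) (fun y => w y (c x)) (f x) =
    \sum_j c x i 0 j * 'D_('D_u f x) (fun y => w y (dfwith (c x) i (delta_mx 0 j))) (f x).
  rewrite -(mlin_basis (Omega_derive_lin ('D_u f x) Ow (fU x Ux)) (c x) (c x i)).
  by rewrite dfwith_id.
under eq_bigr do rewrite scalerDr; rewrite big_split /=; congr (_ + _).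
have E1 k : k != i -> w (f x) (dfwith (c x) k ('D_u (fun y => c y k) x)) =
   \sum_j c x i 0 j * w (f x) (dfwith (dfwith (c x) i (delta_mx 0 j)) k ('D_u (fun y => c y k) x)).
  move=> ki; rewrite -[in LHS](dfwith_id (dfwith _ _ _) i) dfwithout// mlin_basis//.
  by apply: eq_bigr => j _; rewrite (dfwithC _ _ _ ki).
rewrite [RHS](eq_bigr _ E1) [RHS]exchange_big /=; apply: eq_bigr => j _.
rewrite [LHS]mulr_sumr (bigD1 i)//= [X in X + _](_ : _ = 0) ?add0r.
  apply: eq_bigr => k ki; congr (_ * w _ (dfwith _ _ _)).
  have -> // : (fun y => dfwith (c y) i (delta_mx 0 j) k) = (fun y => c y k).
  by apply: funext => y; rewrite dfwithout// eq_sym.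
rewrite (_ : (fun y => _) = cst (delta_mx 0 j)) ?derive_cst ?mlin0 ?mulr0//.
by apply: funext => y; rewrite dfwithin.
Qed.

Context (f : E -> E) (fU : forall x, U x -> U' (f x)) (sf : smooth_on U f).

Let Cf k : Ck k U f.
Proof. exact: (smooth_onP _ _).1. Qed.

Let df x : U x -> differentiable f x.
Proof. exact: Ck_differentiable_mx oU (Cf 1). Qed.

Lemma pullbackE q (w : dform R n q) x v : U x ->
  pullback U f w x v = w (f x) (fun i => 'D_(v i) f x).
Proof.
move=> Ux; rewrite /pullback mem_set//; congr w; apply: funext => i.
by rewrite deriveE//; exact: df.
Qed.

Lemma Ck_pullback k q (w : dform R n q) v : Omega U' w ->
  Ck k U (fun x => w (f x) (fun i => 'd f x (v i))).
Proof.
move=> Ow; apply: (@Ck_eq _ _ _ _ _ (fun x => w (f x) (fun i => 'D_(v i) f x))) => //.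
  by move=> x Ux; congr w; apply: funext => i; rewrite deriveE//; exact: df.
by apply: Ck_mlin_comp => // i; exact: CkD_.
Qed.

Lemma pullback_Omega q (w : dform R n q) : Omega U' w -> Omega U (pullback U f w).
Proof.
move=> Ow; have [lw aw sw zw] := (OmegaP _ _).1 Ow.
apply/OmegaP; split.
- move=> x v i c a b; rewrite /pullback; case: ifP => _; last by rewrite mulr0 addr0.
  by rewrite !comp_dfwith linearP lw.
- move=> x v i j ij vij; rewrite /pullback; case: ifP => // _.
  by apply: (aw _ _ i j ij); rewrite vij.
- move=> v k; apply: Ck_eq (Ck_pullback k v Ow) => // x Ux.
  by rewrite /pullback mem_set.
- by move=> x v Ux; rewrite /pullback memNset.
Qed.

(** The derivative of a pullback has one term with first derivatives of f, which
    gives the pullback of dw, and terms with second derivatives of f, which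
    cancel in pairs because they are symmetric. *)
Lemma extd_pullback q (w : dform R n q) : Omega U' w ->
  extd U (pullback U f w) = pullback U f (extd U' w).
Proof.
move=> Ow; have [lw aw sw zw] := (OmegaP _ _).1 Ow.
apply: funext => x; apply: funext => v; have [Ux|Ux] := pselect (U x); last first.
  by rewrite /extd /pullback memNset.
rewrite pullbackE// !extdE//; last exact: fU.
have D i : 'D_(v i) (fun y => pullback U f w y (v \o lift i)) x =
    'D_('D_(v i) f x) (fun y => w y (fun j => 'D_(v (lift i j)) f x)) (f x) +
    \sum_j w (f x) (dfwith (fun j => 'D_(v (lift i j)) f x) j ('D_(v i) ('D_(v (lift i j)) f) x)).
  rewrite (@near_eq_derive _ _ _ _ (fun y => w (f y) (fun j => 'D_(v (lift i j)) f y))).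
    apply: derive_val.
    by apply: (is_derive_mlin_comp (c := fun y j => 'D_(v (lift i j)) f y)) => // j; exact: CkD_.
  by apply: filterS (open_nbhs_nbhs (conj oU Ux)) => y Uy; rewrite pullbackE.
under eq_bigr do rewrite D mulrDr; rewrite big_split /= [X in _ + X](_ : _ = 0) ?addr0//.
case: q w Ow lw aw sw zw v D => [|q] w Ow lw aw sw zw v _.
  by apply: big1 => i _; rewrite big_ord0 mulr0.
pose Psi a b (u : 'I_q -> E) := w (f x) (scons ('D_a ('D_b f) x) (fun k => 'D_(u k) f x)).
rewrite -[RHS](face_face_sum (Psi := Psi) v).
  apply: eq_bigr => i _; rewrite mulr_sumr; apply: eq_bigr => j _; congr (_ * _).
  by rewrite (antisym_to_front _ _ _ (alt_antisym (lw _) (aw _))).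
move=> a b u; rewrite /Psi; suff -> : 'D_a ('D_b f) x = 'D_b ('D_a f) x by [].
apply/rowP => i.
have Cfi := (Ck_coordP 2 _ oU).1 (Cf 2) i.
have E c d : 'D_c (fun y => ('D_d f y) 0 i) x = 'D_c ('D_d (fun y => f y 0 i)) x.
  apply: near_eq_derive; apply: filterS (open_nbhs_nbhs (conj oU Ux)) => y Uy.
  by have [_ ->] := is_derive_coord (Ck_derive d (Cf 1) Uy) i.
have H c d := etrans (esym (is_derive_valE (is_derive_coord (Ck_derive c (CkD_ d (Cf 2)) Ux) i))) (E c d).
exact: etrans (H a b) (etrans (Ck_derive_comm oU a b Cfi Ux) (esym (H b a))).
Qed.

End Pullback.

(** If the condition of the first map fails at some point, it fails on an open
    set by continuity, and there the conditions of the remaining maps still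
    cover. *)
Lemma finite_cover_open (L : seq (E -> E)) (U W N : set E) (s s' : E -> E) :
  (forall h, h \in L -> forall x, U x -> {for x, continuous h}) ->
  (forall x, W x -> U (s x)) ->
  (forall x, W x -> {for x, continuous s}) -> (forall x, W x -> {for x, continuous s'}) ->
  open N -> N !=set0 -> N `<=` W ->
  (forall x, N x -> exists2 h, h \in L & h (s x) = s' x) ->
  exists h N', [/\ h \in L, open N', N' !=set0, N' `<=` N & forall x, N' x -> h (s x) = s' x].
Proof.
move=> + sU cs cs'; elim: L N => [|h L IH] N cL oN [x0 Nx0] NW HN.
  by have [] := HN x0 Nx0.
have [H|/existsNP[x1 /not_implyP[Nx1 hx1]]] := pselect (forall x, N x -> h (s x) = s' x).
  by exists h, N; split => //; [rewrite inE eqxx | exists x0].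
have nE : \forall x \near x1, h (s x) != s' x.
  have c : {for x1, continuous (fun x => h (s x) - s' x)}.
    apply: continuousB; last exact: cs' (NW _ Nx1).
    apply: continuous_comp; first exact: cs (NW _ Nx1).
    by apply: cL; [rewrite inE eqxx | exact: sU (NW _ Nx1)].
  have h0 : h (s x1) - s' x1 != 0 by rewrite subr_eq0; exact/eqP.
  have /= := continuous_neq0 c h0; 
  by apply: filterS => x /=; rewrite subr_eq0.
pose N1 := (N `&` [set x | h (s x) != s' x])°.
have [|||||h' [N' [h'L oN' N'0 N'N HN']]] := IH N1.
- by move=> h' h'L; apply: cL; rewrite inE h'L orbT.
- exact: open_interior.
- by exists x1; apply: filterI => //; exact: open_nbhs_nbhs (conj oN Nx1).
- by move=> x /interior_subset[/NW].
- move=> x /interior_subset[Nx /= hx]; have [h' + h'x] := HN x Nx.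
  by rewrite inE => /orP[/eqP E|h'L]; [rewrite -E h'x eqxx in hx | exists h'].
exists h', N'; split=> //; first by rewrite inE h'L orbT.
by move=> x /N'N/interior_subset[].
Qed.

(** The group element relating s to s' may vary from point to point, but it can
    be chosen locally constant on a dense open set. There the two values agree
    by invariance, and then they agree everywhere by continuity. *)
Lemma invariant_pullback_eq q (U W : set E) (G : set (E -> E)) (s s' : E -> E)
    (w : dform R n q) x v :
  open U -> open W -> finite_set G -> G `<=` Diff U -> Omega_inv U G w ->
  smooth_on W s -> smooth_on W s' ->
  (forall x, W x -> U (s x)) -> (forall x, W x -> U (s' x)) ->
  (forall x, W x -> exists2 h, G h & h (s x) = s' x) -> W x ->
  w (s x) (fun i => 'd s x (v i)) = w (s' x) (fun i => 'd s' x (v i)).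
Proof.
move=> oU oW /finite_seqP[L GL] GU [Ow Iw] ss ss' sU s'U Hh Wx.
have sm f (V : set E) k : smooth_on V f -> Ck k V f by move=> /smooth_onP.
have C1 := Ck_pullback oW oU sU ss 0 v Ow.
have C2 := Ck_pullback oW oU s'U ss' 0 v Ow.
set a1 := (fun x => w (s x) _) in C1; set a2 := (fun x => w (s' x) _) in C2.
apply: contrapT => ne.
have c : {for x, continuous (fun y => a1 y - a2 y)} by apply: continuousB; [exact: C1|exact: C2].
have h0 : a1 x - a2 x != 0 by rewrite subr_eq0; exact/eqP.
have nE : \forall y \near x, W y /\ a1 y != a2 y.
  apply: filterI; first exact: open_nbhs_nbhs (conj oW Wx).
  by have /= := continuous_neq0 c h0; apply: filterS => y /=; rewrite subr_eq0.
have [||||||||h [N [hL oN [y Ny] NN HN]]] := @finite_cover_open L U W ([set y | W y /\ a1 y != a2 y]°) s s'.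
- move=> h hL y Uy; have [_ [g [sh _ _ _ _]]] : Diff U h by apply: GU; rewrite GL.
  exact: (sm _ _ _ 0%N sh y Uy).
- exact: sU.
- by move=> y Wy; exact: (sm _ _ _ 0%N ss y Wy).
- by move=> y Wy; exact: (sm _ _ _ 0%N ss' y Wy).
- exact: open_interior.
- by exists x.
- by move=> y /interior_subset[].
- move=> y /interior_subset[Wy _]; have [h Gh hE] := Hh y Wy.
  by exists h; [rewrite GL in Gh; exact: Gh | exact: hE].
have [Wy /eqP] := interior_subset (NN y Ny); apply.
have Gh : G h by rewrite GL.
have [_ [g [sh _ hU _ _]]] := GU h Gh.
have dh z : U z -> differentiable h z by exact: Ck_differentiable_mx oU (sm _ _ _ 1%N sh).
have ds z : W z -> differentiable s z by exact: Ck_differentiable_mx oW (sm _ _ _ 1%N ss).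
have ds' z : W z -> differentiable s' z by exact: Ck_differentiable_mx oW (sm _ _ _ 1%N ss').
rewrite /a1 -(Iw h Gh) /pullback mem_set; last exact: sU.
rewrite (HN y Ny) /a2; congr w; apply: funext => i.
apply: (diff_comp_near (ds _ Wy) (dh _ (sU _ Wy)) (ds' _ Wy)).
by apply: filterS (open_nbhs_nbhs (conj oN Ny)) => z /HN.
Qed.

End Forms.

(** * Charts and local lifts between them *)

Section ChartTheory.
Context {R : realType} {n : nat} {X : topologicalType}.
Local Notation E := 'rV[R]_n.
Implicit Types c : chart R n X.

(** Values outside the domain are None, so that the projection composes with
    maps of R^n; its restriction to the domain is [cproj]. *)
Definition pproj c (y : E) : option X :=
  if pselect (dom c y) is left H then Some (cproj (SigSub (mem_set H) : dom c)) else None.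

Lemma dom_val c y : dom c y -> exists z : dom c, set_val z = y.
Proof. by move=> cy; exists (SigSub (mem_set cy)). Qed.

Lemma proj_val c (z : dom c) : pproj c (set_val z) = Some (cproj z).
Proof.
rewrite /pproj; case: pselect => [H|[]]; last exact: set_valP.
by congr (Some (cproj _)); exact: val_inj.
Qed.

Lemma proj_dom c y p : pproj c y = Some p -> dom c y /\ supp c p.
Proof. by rewrite /pproj; case: pselect => // H [<-]; split => //; exists (SigSub (mem_set H)). Qed.

Lemma dom_proj c y : dom c y -> exists2 p, pproj c y = Some p & supp c p.
Proof. by move=> /dom_val[z <-]; exists (cproj z); [exact: proj_val | exists z]. Qed.

Lemma proj_notin c y : ~ dom c y -> pproj c y = None.
Proof. by rewrite /pproj; case: pselect. Qed.

Lemma supp_proj c p : supp c p -> exists2 y, dom c y & pproj c y = Some p.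
Proof. by move=> [z _ <-]; exists (set_val z); [exact: set_valP | exact: proj_val]. Qed.

Lemma smooth_sub (T : normedModType R) (W W' : set E) (s : E -> T) : W' `<=` W -> smooth_on W s -> smooth_on W' s.
Proof. by move=> WW' ss vs x /WW'/ss; apply. Qed.

Lemma smooth_preimage_open (W W' : set E) (s : E -> E) :
  open W -> open W' -> smooth_on W s -> open (W `&` s @^-1` W').
Proof.
move=> oW oW' ss; rewrite openE => x [Wx W'x].
apply: filterI; first exact: open_nbhs_nbhs (conj oW Wx).
by have [cs _] := ss [::] x Wx; apply: cs; exact: open_nbhs_nbhs (conj oW' W'x).
Qed.

Lemma grp_smooth c g : dg_set (grp c) g ->
  [/\ smooth_on (dom c) g & forall x, dom c x -> dom c (g x)].
Proof. by move=> /dg_diff[_ [h []]]. Qed.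

Lemma grp_proj c g y : dg_set (grp c) g -> dom c y -> pproj c (g y) = pproj c y.
Proof.
move=> Gg cy; have [_ gc] := grp_smooth Gg.
have [z zy] := dom_val cy; have [z' zy'] := dom_val (gc _ cy).
rewrite -zy' -zy !proj_val; congr Some; apply: cproj_invariant Gg _.
by rewrite zy zy'.
Qed.

Lemma cproj_repr c (u : dom c) : cproj (repr (\pi_(orbit_space (grp c)) u)) = cproj u.
Proof.
have /eqmodP/asboolP[g Gg gE] := reprK (\pi_(orbit_space (grp c)) u).
by rewrite (cproj_invariant Gg (esym gE)).
Qed.

(** The map that the projection induces on the orbit space is injective. *)
Lemma proj_fibre c y y' : dom c y -> pproj c y = pproj c y' ->
  exists2 g, dg_set (grp c) g & g y = y'.
Proof.
move=> cy E; have [p Ep _] := dom_proj cy.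
have [cy' _] : dom c y' /\ supp c p by apply: proj_dom; rewrite -E.
have [z zy] := dom_val cy; have [z' zy'] := dom_val cy'.
have [inj _ _] := cproj_homeo c.
have rE := @cproj_repr c.
have : cproj z = cproj z' by move: E; rewrite -zy -zy' !proj_val => -[].
rewrite -(rE z) -(rE z') => /inj /eqmodP/asboolP[g Gg gE].
by exists g => //; rewrite -zy gE.
Qed.

(** The map to the orbit space is open, since the orbit of an open set is a
    union of its translates, and the orbit space is homeomorphic to the open set
    [supp c]. *)
Lemma proj_open c (W : set E) : open W -> W `<=` dom c ->
  open [set p | exists2 y, W y & pproj c y = Some p].
Proof.
move=> oW Wc.
pose piq := \pi_(orbit_space (grp c)) : dom c -> orbit_space (grp c).
pose Q : set (orbit_space (grp c)) := piq @` (set_val @^-1` W).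
pose V := \bigcup_(g in dg_set (grp c)) (dom c `&` g @^-1` W).
have oV : open V.
  apply: bigcup_open => g Gg; have [sg _] := grp_smooth Gg.
  by apply: smooth_preimage_open => //; exact: dom_open.
have oQ : open Q.
  rewrite /open /= /quotient_open; exists V => //.
  apply/seteqP; split=> z.
    move=> [g Gg [_ Wgz]]; have [z' z'E] := dom_val (Wc _ Wgz).
    exists z'; first by rewrite /= z'E.
    apply/eqmodP; have [h Gh hg] := dg_inv Gg; apply/asboolP; exists h => //.
    by rewrite z'E -[h (g _)]/((h \o g) _) hg.
  move=> [z' Wz' /eqmodP/asboolP[g Gg gE]].
  have [h Gh hg] := dg_inv Gg; exists h => //; split; first exact: set_valP.
  by rewrite /= -gE -[h (g _)]/((h \o g) _) hg.
have [_ _ /(_ Q oQ)[P oP PE]] := cproj_homeo c.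
have -> : [set p | exists2 y, W y & pproj c y = Some p] = P `&` supp c.
  have -> : supp c = range (@cproj _ _ _ c \o repr : orbit_space (grp c) -> X).
    apply/seteqP; split=> [_ [z _ <-]|_ [z _ <-]]; last by exists (repr z).
    by exists (piq z) => //=; rewrite cproj_repr.
  rewrite -PE; apply/seteqP; split=> [p [y Wy yp]|_ [_ [z Wz <-] <-]].
    have [z zy] := dom_val (Wc _ Wy); exists (piq z).
      by exists z; rewrite //= zy.
    by rewrite /= cproj_repr; move: yp; rewrite -zy proj_val => -[].
  by exists (set_val z) => //; rewrite proj_val /= cproj_repr.
by apply: openI => //; exact: supp_open.
Qed.

Lemma embedding_proj c c' l : embedding c c' l -> forall x, dom c x -> pproj c' (l x) = pproj c x.
Proof.
move=> [_ _ _ lc lp] x cx; have [z zx] := dom_val cx; have [z' zx'] := dom_val (lc _ cx).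
by rewrite -zx' -zx !proj_val; congr Some; apply: lp; rewrite zx.
Qed.

Lemma embedding_inverse c c' l : embedding c c' l ->
  open (l @` dom c) /\ exists g, smooth_on (l @` dom c) g /\ forall x, dom c x -> g (l x) = x.
Proof.
move=> [sl dl [il _ el] _ _].
have injl x y : dom c x -> dom c y -> l x = l y -> x = y.
  by move=> /dom_val[z <-] /dom_val[z' <-] /(il z z') ->.
have emb W : open W -> W `<=` dom c -> exists2 Q, open Q & l @` W = Q `&` l @` dom c.
  move=> oW Wc; have [|Q oQ HQ] := el (set_val @^-1` W : set (dom c)).
    by exists W.
  exists Q => //.
  have -> : l @` W = (l \o set_val) @` (set_val @^-1` W : set (dom c)).
    apply/seteqP; split=> [_ [x Wx <-]|_ [z Wz <-]]; last by exists (set_val z).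
    by have [z zx] := dom_val (Wc x Wx); exists z; rewrite /= zx.
  rewrite HQ; congr (_ `&` _); apply/seteqP; split=> [_ [z _ <-]|_ [x cx <-]].
    by exists (set_val z) => //; exact: set_valP.
  by have [z zx] := dom_val cx; exists z; rewrite //= zx.
have oc := @dom_open _ _ _ c.
pose g y := xget 0 [set x | dom c x /\ l x = y].
have gK x : dom c x -> g (l x) = x.
  move=> cx; rewrite /g; case: xgetP => [y _ [cy /injl]|/(_ x)]; first exact.
  by case.
split; first exact: (embedding_image_open oc sl dl injl emb oc).
by exists g; split => //; exact: (inverse_smooth oc sl dl injl emb gK).
Qed.

(** The common generalization of embeddings, of their inverses and of the
    elements of the groups. Lifts compose, and any two charts of a good atlas
    are related by lifts over their common part even if neither embeds into the
    other. *)
Definition chart_lift c c' (W : set E) (s : E -> E) : Prop :=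
  [/\ open W, W `<=` dom c, smooth_on W s, forall y, W y -> dom c' (s y) &
      forall y, W y -> pproj c' (s y) = pproj c y].

Lemma lift_comp c1 c2 c3 W W' s s' : chart_lift c1 c2 W s -> chart_lift c2 c3 W' s' ->
  chart_lift c1 c3 (W `&` s @^-1` W') (s' \o s).
Proof.
move=> [oW Wc ss sc ps] [oW' Wc' ss' sc' ps'].
have oV := smooth_preimage_open oW oW' ss; split => //.
- by move=> y [/Wc].
- apply/smooth_onP => k; apply: (@Ck_comp_mx _ _ k _ W') => // [x []//||].
    by apply: (smooth_onP _ _).1; apply: smooth_sub ss => x [].
  exact: (smooth_onP _ _).1.
- by move=> y [_ /sc'].
- by move=> y [Wy W'y] /=; rewrite ps'// ps.
Qed.

Lemma lift_grp c g : dg_set (grp c) g -> chart_lift c c (dom c) g.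
Proof.
move=> Gg; have [sg gc] := grp_smooth Gg; split => //; first exact: dom_open.
by move=> y cy; exact: grp_proj.
Qed.

Lemma lift_id c : chart_lift c c (dom c) idfun.
Proof. exact: lift_grp (dg_id _). Qed.

Lemma lift_embedding c c' l : embedding c c' l -> chart_lift c c' (dom c) l.
Proof.
move=> el; have lp := embedding_proj el; have [sl _ _ lc _] := el.
by split => //; exact: dom_open.
Qed.

Lemma lift_inverse c c' l : embedding c c' l ->
  exists g, chart_lift c' c (l @` dom c) g /\ forall x, dom c x -> g (l x) = x.
Proof.
move=> el; have lp := embedding_proj el; have [_ _ _ lc _] := el.
have [ol [g [sg gK]]] := embedding_inverse el.
exists g; split => //; split => //.
- by move=> _ [x cx <-]; exact: lc.
- by move=> _ [x cx <-]; rewrite gK.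
- by move=> _ [x cx <-]; rewrite gK// lp.
Qed.

Lemma lift_diff c c' W s x : chart_lift c c' W s -> W x -> differentiable s x.
Proof.
by move=> [oW _ ss _ _]; apply: (Ck_differentiable_mx oW ((smooth_onP _ _).1 ss 1%N)).
Qed.

(** At each point the two lifts differ by an element of the group, since the
    fibres are orbits. *)
Lemma lift_eq c c' W W' s s' q (w : dform R n q) x v :
  chart_lift c c' W s -> chart_lift c c' W' s' -> Omega_inv (dom c') (grp c') w -> W x -> W' x ->
  w (s x) (fun i => 'd s x (v i)) = w (s' x) (fun i => 'd s' x (v i)).
Proof.
move=> [oW Wc ss sc ps] [oW' Wc' ss' sc' ps'] Ow Wx W'x.
apply: (@invariant_pullback_eq _ _ _ (dom c') (W `&` W') (dg_set (grp c'))) => //.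
- exact: dom_open.
- exact: openI.
- exact: dg_finite.
- exact: dg_diff.
- by apply: smooth_sub ss => y [].
- by apply: smooth_sub ss' => y [].
- by move=> y [/sc].
- by move=> y [_ /sc'].
- move=> y [Wy W'y]; apply: proj_fibre; first exact: sc.
  by rewrite ps// ps'.
Qed.

(** * Transfer of invariant forms along local lifts *)

(** For an invariant form the choice of the lift is immaterial by [lift_eq]. The
    value 0 off the part of c lying over c' makes the product with a function
    supported in [supp c'] smooth on all of c. *)
Definition transfer c' c q (w : dform R n q) : dform R n q := fun x v =>
  if pselect (exists Ws : set E * (E -> E), chart_lift c c' Ws.1 Ws.2 /\ Ws.1 x) is left H
  then let s := (projT1 (cid H)).2 in w (s x) (fun i => 'd s x (v i)) else 0.

Lemma transferE c' c W s q (w : dform R n q) x v :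
  chart_lift c c' W s -> Omega_inv (dom c') (grp c') w -> W x ->
  transfer c' c w x v = w (s x) (fun i => 'd s x (v i)).
Proof.
move=> ls Ow Wx; rewrite /transfer; case: pselect => [H|[]]; last by exists (W, s).
by case: cid => -[W' s'] /= [ls' W'x]; exact: lift_eq ls' ls Ow W'x Wx.
Qed.

Lemma transfer0 c' c q (w : dform R n q) x v :
  (forall W s, chart_lift c c' W s -> ~ W x) -> transfer c' c w x v = 0.
Proof.
move=> H; rewrite /transfer; case: pselect => // -[[W s] [ls Wx]].
by have := H W s ls Wx.
Qed.

Lemma transfer_mlin c' c q (w : dform R n q) x :
  (forall x, mlin (w x)) -> mlin (transfer c' c w x).
Proof.
move=> lw v i a y z; rewrite /transfer; case: pselect => [H|_]; last by rewrite mulr0 addr0.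
by rewrite /= !comp_dfwith linearP lw.
Qed.

Lemma transfer_alt c' c q (w : dform R n q) x :
  (forall x, alt (w x)) -> alt (transfer c' c w x).
Proof.
move=> aw v i j ij vij; rewrite /transfer; case: pselect => // H.
by apply: (aw _ _ i j ij); rewrite vij.
Qed.

Lemma transfer_pointN c' c q (w : dform R n q) x v :
  transfer c' c (fun x v => - w x v) x v = - transfer c' c w x v.
Proof. by rewrite /transfer; case: pselect => //; rewrite oppr0. Qed.

Lemma transfer_id c q (w : dform R n q) : Omega_inv (dom c) (grp c) w -> transfer c c w = w.
Proof.
move=> Ow; apply: funext => x; apply: funext => v.
have [cx|cx] := pselect (dom c x).
  rewrite (transferE _ (lift_id c) Ow cx) /=; congr w; apply: funext => i.
  by rewrite diff_val.
case: Ow => -[_ _ _ zw] _; rewrite zw// transfer0// => W s [_ Wc _ _ _] /Wc.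
exact: cx.
Qed.

Lemma transfer_lift c1 c2 c3 W W' s s' q (w : dform R n q) x v :
  chart_lift c3 c2 W s -> W x -> chart_lift c2 c1 W' s' -> W' (s x) ->
  Omega_inv (dom c1) (grp c1) w ->
  transfer c1 c2 w (s x) (fun i => 'd s x (v i)) = transfer c1 c3 w x v.
Proof.
move=> ls Wx ls' Ws Ow.
rewrite (transferE _ ls' Ow Ws) (transferE _ (lift_comp ls ls') Ow)//.
congr (w _ _); apply: funext => i.
have D := lift_diff ls Wx; have D' := lift_diff ls' Ws.
by apply: (diff_comp_near D D' (differentiable_comp D D')); near=> y.
Unshelve. all: by end_near. Qed.

Lemma transfer_transfer c1 c2 c3 W s q (w : dform R n q) x v :
  chart_lift c3 c2 W s -> W x -> Omega_inv (dom c1) (grp c1) w ->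
  (forall y, dom c2 y -> pproj c2 y = pproj c3 x -> exists W' s', chart_lift c2 c1 W' s' /\ W' y) ->
  transfer c2 c3 (transfer c1 c2 w) x v = transfer c1 c3 w x v.
Proof.
move=> ls Wx Ow H; rewrite {1}/transfer; case: pselect => [H'|[]]; last by exists (W, s).
case: cid => -[V u] /= [lu Vx]; have [_ _ _ uc up] := lu.
have [V' [u' [lu' Vu]]] := H (u x) (uc x Vx) (up x Vx).
exact: transfer_lift lu Vx lu' Vu Ow.
Qed.

(** Precomposition with a group element turns lifts into lifts. *)
Lemma transfer_grp c' c g q (w : dform R n q) x v :
  Omega_inv (dom c') (grp c') w -> dg_set (grp c) g -> dom c x ->
  transfer c' c w (g x) (fun i => 'd g x (v i)) = transfer c' c w x v.
Proof.
move=> Ow Gg cx; have lg := lift_grp Gg; have [_ _ _ gc _] := lg.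
have [[[W s] [ls Wgx]]|N] := pselect (exists Ws : set E * (E -> E), chart_lift c c' Ws.1 Ws.2 /\ Ws.1 (g x)).
  rewrite (transferE _ ls Ow Wgx) (transferE _ (lift_comp lg ls) Ow)//=.
  congr (w _ _); apply: funext => i.
  have D := lift_diff lg cx; have D' := lift_diff ls Wgx.
  by apply: (diff_comp_near D D' (differentiable_comp D D')); near=> y.
rewrite !transfer0// => W s ls Wx; apply: N; last by exists (W, s).
have [h Gh hg] := dg_inv Gg; have lh := lift_grp Gh.
exists (dom c `&` h @^-1` W, s \o h); split; first exact: lift_comp lh ls.
split; first exact: gc.
by rewrite /= -[h (g x)]/((h \o g) x) hg.
Unshelve. all: by end_near. Qed.

End ChartTheory.

Section InvariantForms.
Context {R : realType} {n : nat} {X : topologicalType}.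
Local Notation E := 'rV[R]_n.
Implicit Types c : chart R n X.

Lemma pullback_transfer c c' l q (w : dform R n q) : embedding c c' l ->
  Omega_inv (dom c') (grp c') w -> pullback (dom c) l w = transfer c' c w.
Proof.
move=> el Ow; apply: funext => x; apply: funext => v; rewrite /pullback.
case: ifPn => [/set_mem cx|/negP cx].
  by rewrite (transferE _ (lift_embedding el) Ow cx).
by rewrite transfer0// => W s [_ Wc _ _ _] /Wc cx'; apply: cx; rewrite inE.
Qed.

Lemma pullback_Omega_inv c c' l q (w : dform R n q) : embedding c c' l ->
  Omega_inv (dom c') (grp c') w -> Omega_inv (dom c) (grp c) (pullback (dom c) l w).
Proof.
move=> el Ow; have [sl _ _ lc _] := el; have oc := @dom_open _ _ _ c.
split; first by apply: (pullback_Omega oc (@dom_open _ _ _ c') lc sl); case: Ow.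
move=> g Gg; rewrite (pullback_transfer el Ow); apply: funext => x; apply: funext => v.
rewrite /pullback; case: ifPn => [/set_mem cx|/negP cx]; first exact: transfer_grp.
by rewrite transfer0// => W s [_ Wc _ _ _] /Wc cx'; apply: cx; rewrite inE.
Qed.

Lemma extd_Omega_inv c q (w : dform R n q) : Omega_inv (dom c) (grp c) w ->
  Omega_inv (dom c) (grp c) (extd (dom c) w).
Proof.
move=> [Ow Iw]; have oc := @dom_open _ _ _ c; split; first exact: extd_Omega.
by move=> g Gg; have [sg gc] := grp_smooth Gg; rewrite -(extd_pullback oc oc)// Iw.
Qed.

Lemma Omega_inv0 c q : Omega_inv (dom c) (grp c) ((fun _ _ => 0) : dform R n q).
Proof.
split; first split => //.
- by move=> *; rewrite mulr0 addr0.
- by move=> v; apply/smooth_onP => k; exact: Ck_cst (@dom_open _ _ _ c).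
by move=> g Gg; apply: funext => x; apply: funext => v; rewrite /pullback; case: ifP.
Qed.

Lemma Omega_invZD c q (a : R) (w1 w2 : dform R n q) :
  Omega_inv (dom c) (grp c) w1 -> Omega_inv (dom c) (grp c) w2 ->
  Omega_inv (dom c) (grp c) (fun x v => a * w1 x v + w2 x v).
Proof.
move=> [/OmegaP[l1 a1 s1 z1] i1] [/OmegaP[l2 a2 s2 z2] i2]; split.
  apply/OmegaP; split.
  - by move=> x v i b y z; rewrite l1 l2; ring.
  - by move=> x v i j ij vij; rewrite (a1 _ _ _ _ ij vij) (a2 _ _ _ _ ij vij) mulr0 addr0.
  - move=> v k; have oc := @dom_open _ _ _ c.
    by apply: CkD => //; apply: CkM => //; exact: Ck_cst.
  - by move=> x v cx; rewrite z1// z2// mulr0 addr0.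
move=> g Gg; apply: funext => x; apply: funext => v.
rewrite -[in RHS](i1 g Gg) -[in RHS](i2 g Gg) /pullback.
by case: ifP => //; rewrite mulr0 addr0.
Qed.

Lemma Omega_invD c q (w1 w2 : dform R n q) :
  Omega_inv (dom c) (grp c) w1 -> Omega_inv (dom c) (grp c) w2 ->
  Omega_inv (dom c) (grp c) (fun x v => w1 x v + w2 x v).
Proof.
move=> o1 o2; rewrite (_ : (fun x v => _) = (fun x v => 1 * w1 x v + w2 x v)).
  exact: Omega_invZD.
by apply: funext => x; apply: funext => v; rewrite mul1r.
Qed.

Lemma Omega_invZ c q (a : R) (w : dform R n q) :
  Omega_inv (dom c) (grp c) w -> Omega_inv (dom c) (grp c) (fun x v => a * w x v).
Proof.
move=> ow; rewrite (_ : (fun x v => _) = (fun x v => a * w x v + 0)).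
  exact: (Omega_invZD a ow (Omega_inv0 c q)).
by apply: funext => x; apply: funext => v; rewrite addr0.
Qed.

Lemma Omega_inv_sum c q (I : Type) (r : seq I) (F : I -> dform R n q) :
  (forall i, Omega_inv (dom c) (grp c) (F i)) ->
  Omega_inv (dom c) (grp c) (fun x v => \sum_(i <- r) F i x v).
Proof.
move=> oF; elim: r => [|i r IH].
  rewrite (_ : (fun x v => _) = (fun _ _ => 0)); first exact: Omega_inv0.
  by apply: funext => x; apply: funext => v; rewrite big_nil.
rewrite (_ : (fun x v => _) = (fun x v => F i x v + \sum_(i <- r) F i x v)).
  exact: Omega_invD.
by apply: funext => x; apply: funext => v; rewrite big_cons.
Qed.

End InvariantForms.

(** * Good atlases *)

Section AtlasTheory.
Context {R : realType} {n : nat} {X : topologicalType} (U : good_atlas R n X).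
Local Notation V := (vert U).
Local Notation E := 'rV[R]_n.
Local Notation Ominv I := (Omega_inv (dom (U I)) (grp (U I))).

Lemma cup_ext p p' (J : MFin V p) (J' : MFin V p') :
  (\big[fsetU/fset0]_(i < p.+1) val (J i) = \big[fsetU/fset0]_(i < p'.+1) val (J' i))%fset ->
  cup J = cup J'.
Proof. by move=> H; apply: val_inj. Qed.

Lemma cup_const (I : Fin V) : cup (fun _ : 'I_1 => I) = I.
Proof. by apply: val_inj => /=; rewrite big_ord1. Qed.

Lemma cup_swap p (J : MFin V p) j k : cup (swap j k J) = cup J.
Proof.
apply: cup_ext; rewrite [RHS](reindex_inj (@perm_inj _ (tperm j k))) /=.
exact: eq_bigr.
Qed.

Lemma supp_cup p (J : MFin V p) x :
  supp (U (cup J)) x <-> forall i, supp (U (J i)) x.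
Proof. by rewrite ga_inter; split=> [H i|H i _]; exact: H. Qed.

Lemma supp_cup_face p (J : MFin V p.+1) k : supp (U (cup J)) `<=` supp (U (cup (face k J))).
Proof. by move=> x /supp_cup H; apply/supp_cup => i; exact: H. Qed.

Lemma supp_cup_sub p (J : MFin V p) i : supp (U (cup J)) `<=` supp (U (J i)).
Proof. by move=> x /supp_cup. Qed.

(** The chart of the union of I and J embeds into both charts. An element of the
    group of J moves x into the image of one embedding; its inverse followed by
    the other embedding is the lift. *)
Lemma atlas_lift (I J : Fin V) x p : pproj (U J) x = Some p -> supp (U I) p ->
  exists W s, chart_lift (U J) (U I) W s /\ W x.
Proof.
move=> xp Ip; pose IJ : MFin V 1 := scons I (fun _ : 'I_1 => J).
have KI : supp (U (cup IJ)) `<=` supp (U I).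
  by have := @supp_cup_sub 1 IJ ord0; rewrite /IJ scons0.
have KJ : supp (U (cup IJ)) `<=` supp (U J).
  by have := @supp_cup_sub 1 IJ (lift ord0 (ord0 : 'I_1)); rewrite /IJ sconsS.
have [cx Jp] := proj_dom xp.
have Kp : supp (U (cup IJ)) p.
  by apply/supp_cup => i; case: (unliftP ord0 i) => [k|] ->; rewrite /IJ ?sconsS ?scons0.
have [l el] := ga_embedding KI; have [m em] := ga_embedding KJ.
have [z cz zp] := supp_proj Kp.
have [g Gg gx] : exists2 g, dg_set (grp (U J)) g & g x = m z.
  by apply: proj_fibre => //; rewrite (embedding_proj em)// zp.
have [h [lh hK]] := lift_inverse em.
have L := lift_comp (lift_comp (lift_grp Gg) lh) (lift_embedding el).
eexists; eexists; split; first exact: L.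
split; last by rewrite /= gx hK.
by split => //; rewrite /= gx; exists z.
Qed.

Lemma restr_embedding (I J : Fin V) : supp (U I) `<=` supp (U J) ->
  embedding (U I) (U J) (get (embedding (U I) (U J))).
Proof. by move=> /ga_embedding; exact: getPex. Qed.

Lemma restrE (I J : Fin V) q (w : dform R n q) : supp (U I) `<=` supp (U J) ->
  Ominv J w -> restr I J w = transfer (U J) (U I) w.
Proof. by move=> /restr_embedding el Ow; exact: pullback_transfer. Qed.

Lemma restr_Omega_inv (I J : Fin V) q (w : dform R n q) : supp (U I) `<=` supp (U J) ->
  Ominv J w -> Ominv I (restr I J w).
Proof. by move=> /restr_embedding el Ow; exact: (pullback_Omega_inv el Ow). Qed.

Lemma extd_restr (I J : Fin V) q (w : dform R n q) : supp (U I) `<=` supp (U J) ->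
  Ominv J w -> extd (dom (U I)) (restr I J w) = restr I J (extd (dom (U J)) w).
Proof.
move=> /restr_embedding el [Ow _]; have [sl _ _ lc _] := el.
by apply: extd_pullback => //; exact: dom_open.
Qed.

Lemma atlas_transfer (I K J : Fin V) q (w : dform R n q) x v p :
  pproj (U J) x = Some p -> supp (U K) p -> supp (U I) p -> Ominv I w ->
  transfer (U K) (U J) (transfer (U I) (U K) w) x v = transfer (U I) (U J) w x v.
Proof.
move=> xp Kp Ip Ow; have [W [s [ls Wx]]] := atlas_lift xp Kp.
apply: (transfer_transfer _ ls) => // y cy yp.
by apply: (@atlas_lift I K y p) => //; rewrite yp.
Qed.

(** Both sides are transfers, which do not depend on the chosen embeddings. *)
Lemma restr_restr (I K J : Fin V) q (w : dform R n q) :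
  supp (U J) `<=` supp (U K) -> supp (U K) `<=` supp (U I) -> Ominv I w ->
  restr J K (restr K I w) = restr J I w.
Proof.
move=> JK KI Ow; have JI := subset_trans JK KI.
rewrite restrE//; last exact: restr_Omega_inv.
rewrite !restrE//; apply: funext => x; apply: funext => v.
have [cx|cx] := pselect (dom (U J) x).
  by have [p xp Jp] := dom_proj cx; apply: (atlas_transfer _ xp) => //; [exact: JK|exact: JI].
by rewrite !transfer0// => W s [_ Wc _ _ _] /Wc.
Qed.

Lemma restr_pointD (I J : Fin V) q (w1 w2 : dform R n q) x v :
  restr I J (fun x v => w1 x v + w2 x v) x v = restr I J w1 x v + restr I J w2 x v.
Proof. by rewrite /restr /pullback; case: ifP => // _; rewrite addr0. Qed.

Lemma restr_pointZ (I J : Fin V) q (a : R) (w : dform R n q) x v :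
  restr I J (fun x v => a * w x v) x v = a * restr I J w x v.
Proof. by rewrite /restr /pullback; case: ifP => // _; rewrite mulr0. Qed.

Lemma restr_point0 (I J : Fin V) q x v : restr I J ((fun _ _ => 0) : dform R n q) x v = 0.
Proof. by rewrite /restr /pullback; case: ifP. Qed.

End AtlasTheory.

(** * A smooth partition of unity *)

Section Partition.
Context {R : realType} {n : nat} {X : topologicalType} (U : good_atlas R n X).
Hypothesis hsecond : @second_countable X.
Hypothesis hhausdorff : hausdorff_space X.
Local Notation V := (vert U).
Local Notation E := 'rV[R]_n.
Local Notation Ominv I := (Omega_inv (dom (U I)) (grp (U I))).

Definition on_chart (c : chart R n X) (f : X -> R) (y : E) : R := oapp f 0 (pproj c y).

Lemma proj_preimage_open (c : chart R n X) (Q : set X) : open Q ->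
  open [set y | exists2 p, pproj c y = Some p & Q p].
Proof.
move=> oQ; have /continuousP/(_ Q oQ)[P oP PE] := @cproj_continuous _ _ _ c.
have -> : [set y | exists2 p, pproj c y = Some p & Q p] = dom c `&` P.
  apply/seteqP; split=> y.
    move=> [p yp Qp]; have [cy _] := proj_dom yp; split => //.
    have [z zy] := dom_val cy; move: yp; rewrite -zy proj_val => -[zp].
    have : (@cproj _ _ _ c @^-1` Q) z by rewrite /= zp.
    by rewrite -PE.
  move=> [cy Py]; have [z zy] := dom_val cy; exists (cproj z); first by rewrite -zy proj_val.
  have : (set_val @^-1` P) z by rewrite /= zy.
  by rewrite PE.
by apply: openI => //; exact: dom_open.
Qed.

(** The set C is closed in X and not only in [supp (U I)], so that f is smooth in
    charts that reach across the boundary of [supp (U I)]. *)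
Definition bump_on (I : Fin V) (f : X -> R) : Prop :=
  (forall J, smooth_on (dom (U J)) (on_chart (U J) f)) /\
  exists C, [/\ closed C, C `<=` supp (U I) & forall p, ~ C p -> f p = 0].

Lemma smooth_on_local (W : normedModType R) (D : set E) (f : E -> W) :
  (forall x, D x -> exists N g, [/\ open N, N x, forall k, Ck k N g & forall y, N y -> g y = f y]) ->
  smooth_on D f.
Proof.
move=> H vs x Dx; have [N [g [oN Nx Cg gf]]] := H x Dx.
have : smooth_on N f by apply/smooth_onP => k; exact: Ck_eq oN gf (Cg k).
by move=> /(_ vs x Nx).
Qed.

Lemma on_chart_off (I : Fin V) (f : X -> R) (c : chart R n X) x p : bump_on I f ->
  pproj c x = Some p -> ~ supp (U I) p ->
  exists N, [/\ open N, N x & forall y, N y -> on_chart c f y = 0].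
Proof.
move=> [_ [C [cC CI f0]]] xp nI.
exists [set y | exists2 p, pproj c y = Some p & (~` C) p]; split.
- by apply: proj_preimage_open; exact: closed_openC.
- by exists p => // /CI.
- by move=> y [r yr nC]; rewrite /on_chart yr /= f0.
Qed.

(** A bump b on a chart is made invariant by passing to 1 - prod_g (1 - b o g),
    which is 1 wherever b is, and then descends to X. The support is closed
    because it is the image of a compact set in a Hausdorff space. *)
Lemma bump_exists (p : X) : exists I f, bump_on I f /\
  exists Q, [/\ open Q, Q p & forall q, Q q -> f q = 1].
Proof.
have [i _ pi] : (\bigcup_i supp (U (fin1 i))) p by rewrite ga_cover.
pose I := fin1 i; have [x cx xp] := supp_proj pi.
have oI := @dom_open _ _ _ (U I).
have [b [W [K [Cb [oW Wx] [cK KI] b1 b0]]]] := bump_function oI cx.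
have /finite_seqP[L0 L0E] := @dg_finite _ _ _ (grp (U I)).
pose L := undup L0.
have LE g : dg_set (grp (U I)) g <-> g \in L by rewrite L0E mem_undup.
pose B y := 1 - \prod_(g <- L) (1 - b (g y)).
have BG g y : dg_set (grp (U I)) g -> B (g y) = B y.
  move=> Gg; rewrite /B; congr (1 - _).
  have [h Gh hg] := dg_inv Gg; have [h' Gh' hh] := dg_inv Gh.
  have gh : g \o h = idfun.
    have -> : g = h'; last by [].
    have -> : g = h' \o (h \o g) by rewrite compA hh.
    by rewrite hg.
  (* right translation by g permutes the group *)
  have PL : perm_eq [seq (f : E -> E) \o g | f <- L] L.
    apply: uniq_perm; last 1 first.
    - move=> f; apply/mapP/idP => [[f' /LE f'L ->]|/LE fL].
        by apply/LE; exact: dg_comp.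
      exists (f \o h); first by apply/LE; exact: dg_comp.
      by rewrite -compA hg.
    - rewrite map_inj_uniq ?undup_uniq// => f f' ff.
      apply: funext => z; have := congr1 (fun F : E -> E => F (h z)) ff.
      by rewrite /= -[g (h z)]/((g \o h) z) gh.
    - exact: undup_uniq.
  by rewrite -[in RHS](perm_big _ PL) big_map.
have CB k : Ck k (dom (U I)) B.
  have C1 g : dg_set (grp (U I)) g -> Ck k (dom (U I)) (fun y => 1 - b (g y)).
    move=> Gg; have [sg gI] := grp_smooth Gg.
    apply: (@Ck_eq _ _ _ _ _ (cst 1 \+ (cst (-1) \* (b \o g)))) => //.
      by move=> y _ /=; rewrite mulN1r.
    apply: CkD => //; first exact: Ck_cst.
    apply: CkM => //; first exact: Ck_cst.
    by apply: (Ck_comp oI openT) (Cb k) => //; exact: (smooth_onP _ _).1.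
  apply: (@Ck_eq _ _ _ _ _ (cst 1 \+ (cst (-1) \* (fun y => \prod_(g <- L) (1 - b (g y)))))) => //.
    by move=> y _ /=; rewrite mulN1r.
  apply: CkD => //; first exact: Ck_cst.
  apply: CkM => //; first exact: Ck_cst.
  apply: (@Ck_eq _ _ _ _ _ (fun y => \prod_(g <- L | g \in L) (1 - b (g y)))) => //.
    by move=> y _; rewrite -big_seq.
  apply: (@Ck_eq _ _ _ _ _ (fun y => \prod_(g <- L) (if g \in L then 1 - b (g y) else 1))) => //.
    by move=> y _; rewrite -big_mkcond.
  apply: Ck_prod => // g; case: (boolP (g \in L)) => [/LE|_]; first exact: C1.
  exact: Ck_cst.
pose f q := if pselect (exists y, pproj (U I) y = Some q) is left H then B (projT1 (cid H)) else 0.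
have fB y q : pproj (U I) y = Some q -> f q = B y.
  move=> yq; rewrite /f; case: pselect => [H|[]]; last by exists y.
  case: cid => y' /= y'q; have [cy' _] := proj_dom y'q.
  have [g Gg <-] : exists2 g, dg_set (grp (U I)) g & g y' = y by apply: proj_fibre; rewrite ?y'q.
  by rewrite BG.
have f_out q : ~ supp (U I) q -> f q = 0.
  move=> nq; rewrite /f; case: pselect => // H; exfalso.
  by have [y yq] := H; have [] := proj_dom yq.
pose F y := odflt p (pproj (U I) y).
pose C := F @` K.
have cC : closed C.
  apply: compact_closed => //; apply: continuous_compact => //.
  apply: continuous_in_subspaceT => y /set_mem /KI cy A.
  have [q yq _] := dom_proj cy; rewrite /F yq /= nbhsE => -[Q [oQ Qq] QA].
  have : nbhs y [set z | exists2 r, pproj (U I) z = Some r & Q r].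
    by apply: open_nbhs_nbhs; split; [exact: proj_preimage_open | exists q].
  by apply: filterS => z [r zr Qr]; apply: QA; rewrite /= zr.
have CI : C `<=` supp (U I).
  by move=> _ [y /KI cy <-]; have [q yq qI] := dom_proj cy; rewrite /F yq.
have fC q : ~ C q -> f q = 0.
  move=> nq; have [qI|/f_out//] := pselect (supp (U I) q).
  have [y cy yq] := supp_proj qI; rewrite (fB _ _ yq) /B big_seq big1 ?subrr// => g /LE Gg.
  rewrite b0 ?subr0// => Kgy; apply: nq; exists (g y) => //.
  by rewrite /F grp_proj// yq.
exists I, f; split; last first.
  exists [set q | exists2 y, (W `&` dom (U I)) y & pproj (U I) y = Some q]; split.
  - by apply: proj_open => [|y []//]; exact: openI.
  - by exists x.
  - move=> q [y [Wy cy] yq]; rewrite (fB _ _ yq) /B.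
    have -> : \prod_(g <- L) (1 - b (g y)) = 0; last by rewrite subr0.
    apply/eqP; rewrite prodf_seq_eq0; apply/hasP; exists idfun.
      by apply/LE; exact: dg_id.
    by rewrite /= b1// subrr.
split; last by exists C.
move=> J; apply: smooth_on_local => y cy; have [q yq _] := dom_proj cy.
have [qI|qI] := pselect (supp (U I) q).
  have [W' [s [[oW' W'J ss sI sp] W'y]]] := atlas_lift yq qI.
  exists W', (B \o s); split => //.
    by move=> k; apply: (Ck_comp oW' oI sI _ (CB k)); exact: (smooth_onP _ _).1.
  move=> z W'z /=; have [r zr _] := dom_proj (W'J _ W'z).
  by rewrite /on_chart zr /= (@fB (s z))// sp.
exists [set z | exists2 r, pproj (U J) z = Some r & (~` C) r], (cst 0); split.
- by apply: proj_preimage_open; exact: closed_openC.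
- by exists q => // /CI.
- by move=> k; apply: Ck_cst; apply: proj_preimage_open; exact: closed_openC.
- by move=> z [r zr nr]; rewrite /on_chart zr /= fC.
Qed.

(** One bump for each basic open set on which some bump is 1. *)
Lemma countable_bumps (I0 : Fin V) : exists (ix : nat -> Fin V) (b : nat -> X -> R),
  (forall k, bump_on (ix k) (b k)) /\
  forall p, exists k Q, [/\ open Q, Q p & forall q, Q q -> b k q = 1].
Proof.
have [Bs /countable_injP[code code_inj] [Bo Bb]] := hsecond.
pose e k : set X := xget set0 [set A | Bs A /\ code A = k].
have eE A : Bs A -> e (code A) = A.
  move=> BA; rewrite /e; case: xgetP => [A' _ [BA' cA]|/(_ A)]; last by case.
  by apply: code_inj => //; rewrite inE.
pose P k (If : Fin V * (X -> R)) := bump_on If.1 If.2 /\ forall q, e k q -> If.2 q = 1.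
have b0 : bump_on I0 (cst 0).
  split; last by exists set0; split => //; exact: closed0.
  move=> J; apply/smooth_onP => k; apply: (@Ck_eq _ _ _ _ _ (cst 0)) => //.
  - exact: dom_open.
  - by move=> x _; rewrite /on_chart; case: pproj.
  - by apply: Ck_cst; exact: dom_open.
pose F k := if pselect (exists If, P k If) is left H then projT1 (cid H) else (I0, cst 0).
exists (fun k => (F k).1), (fun k => (F k).2); split.
  by move=> k; rewrite /F; case: pselect => // H; case: cid => If [].
move=> p; have [I [f [bf [Q [oQ Qp Q1]]]]] := bump_exists p.
have [A [BA Ap] AQ] := Bb p Q (open_nbhs_nbhs (conj oQ Qp)).
exists (code A), A; split; [exact: Bo|exact: Ap|move=> q Aq].
rewrite /F; case: pselect => [H|[]]; last first.
  by exists (I, f); split => // r; rewrite eE// => /AQ/Q1.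
by case: cid => If [bIf H1] /=; apply: H1; rewrite eE.
Qed.

(** Multiplying each bump by the product of 1 minus the previous ones makes the
    partial sums telescope to 1 minus a product, which vanishes as soon as one
    of the bumps is 1; the later functions vanish there too. *)
Lemma partition_of_unity (I0 : Fin V) : exists (ix : nat -> Fin V) (psi : nat -> X -> R),
  (forall k, bump_on (ix k) (psi k)) /\
  forall p, exists N Q, [/\ open Q, Q p & forall q, Q q ->
    \sum_(k < N) psi k q = 1 /\ forall k, (N <= k)%N -> psi k q = 0].
Proof.
have [ix [b [bb cov]]] := countable_bumps I0.
pose r k q := \prod_(j < k) (1 - b j q).
pose psi k := b k \* r k.
have sumE N q : \sum_(k < N) psi k q = 1 - r N q.
  elim: N => [|N IH]; first by rewrite big_ord0 /r big_ord0 subrr.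
  by rewrite big_ord_recr IH /psi /r /= big_ord_recr /=; ring.
exists ix, psi; split.
  move=> k; have [sb [C [cC CI b0]]] := bb k; split; last first.
    by exists C; split => // p /b0 bp; rewrite /psi /= bp mul0r.
  move=> J; have oJ := @dom_open _ _ _ (U J); apply/smooth_onP => m.
  apply: (@Ck_eq _ _ _ _ _ (on_chart (U J) (b k) \* (fun y => \prod_(j < k) (1 - on_chart (U J) (b j) y)))) => //.
    move=> y cy; have [p yp _] := dom_proj cy.
    transitivity (b k p * \prod_(j < k) (1 - b j p)); last by rewrite /on_chart yp.
    rewrite /= {1}/on_chart yp; congr (_ * _); apply: eq_bigr => j _.
    by rewrite /on_chart yp.
  apply: CkM => //; first exact: (smooth_onP _ _).1.
  apply: Ck_prod => // j.
  apply: (@Ck_eq _ _ _ _ _ (cst 1 \+ (cst (-1) \* on_chart (U J) (b j)))) => //.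
    by move=> y _ /=; rewrite mulN1r.
  apply: CkD => //; first exact: Ck_cst.
  apply: CkM => //; first exact: Ck_cst.
  by apply: (smooth_onP _ _).1; have [] := bb j.
move=> p; have [k [Q [oQ Qp Q1]]] := cov p.
exists k.+1, Q; split => // q Qq.
have rz m : (k < m)%N -> r m q = 0.
  by move=> km; apply/eqP/prodf_eq0; exists (Ordinal km); rewrite //= Q1 ?subrr.
split; first by rewrite sumE rz ?subr0.
by move=> m km; rewrite /psi /= rz ?mulr0.
Qed.

End Partition.

(** * The contracting homotopy *)

Section Homotopy.
Context {R : realType} {n : nat} {X : topologicalType} (U : good_atlas R n X).
Local Notation V := (vert U).
Local Notation E := 'rV[R]_n.
Local Notation Ominv I := (Omega_inv (dom (U I)) (grp (U I))).

(** At a point over [supp (U I)] the transfer is locally a pullback, and at any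
    other point the bump vanishes nearby. *)
Lemma bump_transfer_smooth (I K J : Fin V) (f : X -> R) q (w : dform R n q) v :
  bump_on I f -> (forall r, supp (U I) r -> supp (U J) r -> supp (U K) r) -> Ominv K w ->
  smooth_on (dom (U J)) (fun x => on_chart (U J) f x * transfer (U K) (U J) w x v).
Proof.
move=> bf IJK Ow; apply: smooth_on_local => x cx; have [r xr Jr] := dom_proj cx.
have [Ir|Ir] := pselect (supp (U I) r).
  have [W [s [ls Wx]]] := atlas_lift xr (IJK _ Ir Jr).
  have [oW WJ ss sK _] := ls.
  exists W, (fun y => on_chart (U J) f y * w (s y) (fun i => 'd s y (v i))); split => //.
    move=> k; apply: CkM => //; last first.
      by apply: (Ck_pullback oW (@dom_open _ _ _ (U K)) sK ss); case: Ow.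
    by apply: (smooth_onP _ _).1; apply: smooth_sub WJ _; case: bf.
  by move=> y Wy; rewrite (transferE _ ls Ow Wy).
have [N [oN Nx N0]] := on_chart_off bf xr Ir.
exists N, (cst 0); split => //; first by move=> k; exact: Ck_cst.
by move=> y Ny; rewrite N0// mul0r.
Qed.

Context (ix : nat -> Fin V) (psi : nat -> X -> R) (Nf : X -> nat).
Hypothesis psi_bump : forall k, bump_on (ix k) (psi k).
Hypothesis psi_fin : forall p, exists N Q, [/\ open Q, Q p & forall q, Q q ->
  forall k, (N <= k)%N -> psi k q = 0].
Hypothesis Nf0 : forall p k, (Nf p <= k)%N -> psi k p = 0.
Hypothesis Nf1 : forall p, \sum_(k < Nf p) psi k p = 1.

Lemma psi_sum_stable p N (a : nat -> R) : (forall k, (N <= k)%N -> psi k p = 0) ->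
  \sum_(k < Nf p) psi k p * a k = \sum_(k < N) psi k p * a k.
Proof.
have H M M' : (M <= M')%N -> (forall k, (M <= k)%N -> psi k p = 0) ->
    \sum_(k < M') psi k p * a k = \sum_(k < M) psi k p * a k.
  move=> MM' z; rewrite -(subnKC MM') big_split_ord /= [X in _ + X]big1 ?addr0// => k _.
  by rewrite z ?mul0r// leq_addr.
move=> HN; have [h|h] := leqP N (Nf p); first exact: H.
by rewrite -(H _ _ (ltnW h))//; exact: Nf0.
Qed.

(** The contraction (K a)_J = sum_k psi_k a_(i_k J) of the Cech complex. The
    form a_(i_k J) lives on a smaller chart than that of J, hence the transfer;
    [Nf r] bounds the indices with psi_k(r) nonzero. *)
Definition homotopy p q (a : cochain R n V p.+1 q) : cochain R n V p q :=
  fun J x v => if pproj (U (cup J)) x is Some r then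
    \sum_(k < Nf r) psi k r *
      transfer (U (cup (scons (ix k) J))) (U (cup J)) (a (scons (ix k) J)) x v
  else 0.

Lemma supp_scons (I : Fin V) p (J : MFin V p) r :
  supp (U (cup (scons I J : MFin V p.+1))) r <-> supp (U I) r /\ supp (U (cup J)) r.
Proof.
split=> [/supp_cup H|[Ir /supp_cup H]].
  split; first by have := H ord0; rewrite scons0.
  by apply/supp_cup => i; have := H (lift ord0 i); rewrite sconsS.
by apply/supp_cup => i; case: (unliftP ord0 i) => [k|] ->; rewrite ?sconsS ?scons0.
Qed.

Lemma homotopy_Cbar p q (a : cochain R n V p.+1 q) :
  @Cbar _ _ _ U p.+1 q a -> @Cbar _ _ _ U p q (homotopy a).
Proof.
move=> [Oa asw]; have O_ k J := Oa (scons (ix k) J).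
split=> [J|j k J jk].
  have oc := @dom_open _ _ _ (U (cup J)).
  split.
    apply/(OmegaP _); split.
    - move=> x v i c b b'; rewrite /homotopy; case: pproj => [r|]; last by rewrite mulr0 addr0.
      rewrite mulr_sumr -big_split /=; apply: eq_bigr => k _.
      have [lw _ _ _] := (OmegaP _ _).1 (O_ k J).1.
      rewrite (transfer_mlin _ _ _ lw).
      by ring.
    - move=> x v i j ij vij; rewrite /homotopy; case: pproj => // r.
      apply: big1 => k _; have [_ aw _ _] := (OmegaP _ _).1 (O_ k J).1.
      by rewrite (transfer_alt _ _ _ aw ij vij) mulr0.
    - move=> v; apply: (smooth_onP _ _).1; apply: smooth_on_local => x cx.
      have [r xr _] := dom_proj cx; have [N [Q [oQ Qr QN]]] := psi_fin r.
      (* near r the number of terms can be taken constant *)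
      exists (dom (U (cup J)) `&` [set y | exists2 p, pproj (U (cup J)) y = Some p & Q p]).
      exists (fun y => \sum_(k < N) on_chart (U (cup J)) (psi k) y *
         transfer (U (cup (scons (ix k) J))) (U (cup J)) (a (scons (ix k) J)) y v).
      split.
      + by apply: openI => //; exact: proj_preimage_open.
      + by split => //; exists r.
      + move=> m; apply: Ck_sum => [|k].
          by apply: openI => //; exact: proj_preimage_open.
        apply: (@Ck_sub _ _ _ _ (dom (U (cup J)))) => [y []//|].
        apply: (smooth_onP _ _).1; apply: (bump_transfer_smooth v (psi_bump k)) => // r' I' J'.
        exact/supp_scons.
      + move=> y [cy [r' yr' Qr']]; rewrite /homotopy yr'.
        rewrite (psi_sum_stable (fun k => transfer (U (cup (scons (ix k) J))) (U (cup J)) (a (scons (ix k) J)) y v) (QN _ Qr')).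
        by apply: eq_bigr => k _; rewrite /on_chart yr'.
    - by move=> x v cx; rewrite /homotopy proj_notin.
  move=> g Gg; apply: funext => x; apply: funext => v; rewrite /pullback.
  case: ifPn => [/set_mem cx|/negP cx]; last first.
    by rewrite /homotopy proj_notin// => cx'; apply: cx; rewrite inE.
  rewrite /homotopy grp_proj//; case: pproj => // r; apply: eq_bigr => k _.
  by rewrite transfer_grp.
apply: funext => x; apply: funext => v.
rewrite -[RHS]/(- homotopy a (swap j k J) x v) /homotopy cup_swap.
case: pproj => [r|]; last by rewrite oppr0.
rewrite -sumrN; apply: eq_bigr => i _; rewrite -mulrN; congr (_ * _).
have jk' : lift ord0 j != lift ord0 k by rewrite (inj_eq (@lift_inj _ _)).
have E1 : scons (ix i) (swap j k J) = swap (lift ord0 j) (lift ord0 k) (scons (ix i) J).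
  exact: scons_tperm.
rewrite E1 cup_swap -transfer_pointN; congr (transfer _ _ _ x v).
by rewrite (asw _ _ (scons (ix i) J) jk').
Qed.

Lemma face_scons0 (I : Fin V) p (J : MFin V p) : face ord0 (scons I J : MFin V p.+1) = J.
Proof. exact: scons_face0. Qed.

Lemma face_sconsS (I : Fin V) p (J : MFin V p.+1) k :
  face (lift ord0 k) (scons I J : MFin V p.+2) = scons I (face k J).
Proof. exact: scons_faceS. Qed.

(** Over a point of the support of psi_k, the cocycle identity for the string
    i_k J expresses a_J by the faces that keep i_k, which are the components
    entering in delta (K a). *)
Lemma delta_homotopy p q (a : cochain R n V p.+1 q) :
  @Cbar _ _ _ U p.+1 q a -> @delta _ _ _ U p.+1 q a = (fun _ _ _ => 0) ->
  @delta _ _ _ U p q (homotopy a) = a.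
Proof.
move=> [Oa _] da.
apply: funext => J; apply: funext => x; apply: funext => v.
have [cx|cx] := pselect (dom (U (cup J)) x); last first.
  rewrite /delta big1; last by move=> k _; rewrite /restr /pullback memNset ?mulr0.
  by have [[_ _ _ ->]] := Oa J.
have [r xr Jr] := dom_proj cx.
have restrE' k : restr (cup J) (cup (face k J)) (homotopy a (face k J)) x v =
    \sum_(i < Nf r) psi i r * transfer (U (cup (scons (ix i) (face k J)))) (U (cup J)) (a (scons (ix i) (face k J))) x v.
  have el := restr_embedding (@supp_cup_face _ _ _ U p J k).
  have ll := lift_embedding el; have [_ _ _ lc lp] := ll.
  rewrite /restr /pullback mem_set// /homotopy lp// xr; apply: eq_bigr => i _.
  have [Ir|Ir] := pselect (supp (U (ix i)) r); last first.
    have [_ [C [_ CI psi0]]] := psi_bump i.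
    by rewrite psi0 ?mul0r// => /CI.
  congr (_ * _).
  have [|W [s [ls Ws]]] := @atlas_lift _ _ _ U (cup (scons (ix i) (face k J))) (cup (face k J))
     (get (embedding (U (cup J)) (U (cup (face k J)))) x) r (etrans (lp x cx) xr).
    by apply/supp_scons; split => //; exact: supp_cup_face Jr.
  exact: transfer_lift ll cx ls Ws (Oa _).
rewrite /delta; under eq_bigr do rewrite restrE' mulr_sumr.
transitivity (\sum_(i < Nf r) psi i r * a J x v); last by rewrite -mulr_suml Nf1 mul1r.
rewrite exchange_big /=; apply: eq_bigr => i _.
have [Ir|Ir] := pselect (supp (U (ix i)) r); last first.
  have [_ [C [_ CI psi0]]] := psi_bump i.
  have z : psi i r = 0 by rewrite psi0 // => /CI.
  by rewrite z mul0r; apply: big1 => k _; rewrite mul0r mulr0.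
under eq_bigr do rewrite mulrCA.
rewrite -mulr_sumr; congr (_ * _).
pose S : MFin V p.+2 := scons (ix i) J.
have Sr : supp (U (cup S)) r by apply/supp_scons.
have [W [s [ls Wx]]] := atlas_lift xr Sr.
have [_ _ _ sS sp] := ls.
have term (k : 'I_p.+3) : restr (cup S) (cup (face k S)) (a (face k S)) (s x) (fun j => 'd s x (v j)) =
    transfer (U (cup (face k S))) (U (cup J)) (a (face k S)) x v.
  rewrite restrE; [|exact: supp_cup_face|exact: Oa].
  have [W' [s' [ls' W's]]] := @atlas_lift _ _ _ U (cup (face k S)) (cup S) (s x) r (etrans (sp x Wx) xr) (supp_cup_face k Sr).
  exact: transfer_lift ls Wx ls' W's (Oa _).
have := congr1 (fun F : cochain R n V p.+2 q => F S (s x) (fun j => 'd s x (v j))) da.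
rewrite /delta; under eq_bigr do rewrite term.
rewrite big_ord_recl expr0 mul1r face_scons0 transfer_id; last exact: Oa.
move=> /eqP; rewrite addr_eq0 => /eqP ->; rewrite -sumrN; apply: eq_bigr => k _.
by rewrite face_sconsS exprS mulN1r mulNr opprK.
Qed.

End Homotopy.

Lemma cech_exact (R : realType) n (X : topologicalType) (U : good_atlas R n X) p q
    (a : cochain R n (vert U) p.+1 q) :
  @second_countable X -> hausdorff_space X ->
  @Cbar _ _ _ U p.+1 q a -> @delta _ _ _ U p.+1 q a = (fun _ _ _ => 0) ->
  exists2 b, @Cbar _ _ _ U p q b & @delta _ _ _ U p q b = a.
Proof.
move=> h2 hh Ca da.
(* the partition of unity is indexed by nat, which needs a default vertex set *)
have [[I0 _]|noI] := pselect (exists I : Fin (vert U), True); last first.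
  have no (T : Prop) m (J : MFin (vert U) m) : T by exfalso; apply: noI; exists (J ord0).
  exists (fun _ _ _ => 0); last by apply: funext => J; exact: no J.
  by split=> [J|j k J _]; exact: no J.
have [ix [psi [bp fp]]] := partition_of_unity h2 hh I0.
have ex r : exists N, \sum_(k < N) psi k r = 1 /\ forall k, (N <= k)%N -> psi k r = 0.
  by have [N [Q [_ Qr QN]]] := fp r; exists N; exact: QN.
pose Nf r := projT1 (cid (ex r)).
have Nf1 r : \sum_(k < Nf r) psi k r = 1 by rewrite /Nf; case: cid => N [].
have Nf0 r k : (Nf r <= k)%N -> psi k r = 0 by rewrite /Nf; case: cid => N [S0 H] /= /H.
have fin r : exists N Q, [/\ open Q, Q r & forall s, Q s -> forall k, (N <= k)%N -> psi k s = 0].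
  by have [N [Q [oQ Qr QN]]] := fp r; exists N, Q; split => // s /QN[].
exists (homotopy ix psi Nf a); first exact: homotopy_Cbar.
exact: delta_homotopy.
Qed.

(** * Cohomology of a subcomplex *)

Section Subcomplex.
Context {A : zmodType}.
Implicit Types C : precomplex A.

Lemma dif0 C (k : int) : is_complex C -> dif C 0 = 0.
Proof.
move=> /(_ k)[[C0 _] Cadd _ _]; have := Cadd 0 0 C0 C0.
by rewrite addr0 => /eqP; rewrite -subr_eq subrr => /eqP <-.
Qed.

Lemma subgroupN (S : set A) x : subgroup S -> S x -> S (- x).
Proof. by move=> [S0 SB] Sx; rewrite -sub0r; exact: SB. Qed.

Lemma subgroupD (S : set A) x y : subgroup S -> S x -> S y -> S (x + y).
Proof. by move=> sS Sx Sy; rewrite -[y]opprK; apply: sS.2 => //; exact: subgroupN. Qed.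

Lemma difB C k x y : is_complex C -> C k x -> C k y -> dif C (x - y) = dif C x - dif C y.
Proof.
move=> cC Cx Cy; have [sC Cadd _ _] := cC k.
have CN := subgroupN sC Cy.
have E : dif C (- y) = - dif C y.
  by apply/eqP; rewrite -addr_eq0 -Cadd// addNr (dif0 k cC).
by rewrite Cadd// E.
Qed.

Lemma coboundaries_subgroup C k : is_complex C -> subgroup (coboundaries C k).
Proof.
move=> cC; have [[C0 CB] _ _ _] := cC (k - 1).
split; first by exists 0 => //; exact: dif0 (k - 1) cC.
by move=> _ _ [x Cx <-] [y Cy <-]; exists (x - y); [exact: CB | exact: difB cC Cx Cy].
Qed.

Lemma cclass_self C k z : is_complex C -> cclass C k z z.
Proof. by move=> /(coboundaries_subgroup k)[B0 _]; exists 0; rewrite ?addr0. Qed.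

Lemma cclass_eq C k z z' : is_complex C -> coboundaries C k (z' - z) ->
  cclass C k z = cclass C k z'.
Proof.
move=> /(coboundaries_subgroup k) sB Bz.
apply/seteqP; split=> _ [b Bb <-].
  by exists (b - (z' - z)); [exact: sB.2 | by rewrite opprB addrC -addrA subrK addrC].
by exists (b + (z' - z)); [exact: subgroupD | by rewrite addrC -addrA subrK addrC].
Qed.

Lemma cclassD C k z w : is_complex C ->
  [set x + y | x in cclass C k z & y in cclass C k w] = cclass C k (z + w).
Proof.
move=> /(coboundaries_subgroup k) sB; apply/seteqP; split.
  move=> _ [_ [b Bb <-] [_ [b' Bb' <-] <-]]; exists (b + b'); first exact: subgroupD.
  by rewrite addrACA.
move=> _ [b Bb <-]; exists (z + b); first by exists b.
by exists w; [exists 0; [exact: sB.1 | rewrite addr0] | rewrite addrAC].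
Qed.

(** The last hypothesis gives surjectivity in cohomology when it is applied to
    the cocycles of F, and injectivity when it is applied to the cochains of F
    whose differential is a cocycle of E. *)
Lemma cohomology_iso_of_retraction (E F : precomplex A) :
  is_complex E -> is_complex F -> subcomplex E F ->
  (forall k b, F k b -> E (k + 1) (dif F b) ->
     exists2 c, F (k - 1) c & E k (b - dif F c)) ->
  cohomology_iso E F.
Proof.
move=> cE cF sEF ret.
have subB k : coboundaries E k `<=` coboundaries F k.
  by move=> _ [u Eu <-]; have [Fu dE] := sEF _ _ Eu; exists u; rewrite ?dE.
have Fd k x : F (k - 1) x -> F k (dif F x).
  by move=> Fx; have [_ _ + _] := cF (k - 1); rewrite subrK; apply.
pose phi k (c : set A) : set A := [set x + y | x in c & y in coboundaries F k].
have phiE k z : phi k (cclass E k z) = cclass F k z.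
  have sB := coboundaries_subgroup k cF; apply/seteqP; split.
    move=> _ [_ [e Ee <-] [b Bb <-]]; exists (e + b); last by rewrite addrA.
    by apply: subgroupD => //; exact: subB.
  by move=> _ [b Bb <-]; exists z; [exact: cclass_self | exists b].
exists phi => k; split=> //.
- split.
  + move=> _ [z [Ez dz] <-]; rewrite phiE; exists z => //.
    by have [Fz dE] := sEF _ _ Ez; split => //; rewrite -dE.
  + move=> _ _ /set_mem[z [Ez dz] <-] /set_mem[w [Ew dw] <-]; rewrite !phiE => H.
    have [b [u Fu bE] zE] : cclass F k z w by rewrite H; exact: cclass_self.
    have [|c Fc Ec] := ret _ u Fu.
      have -> : dif F u = w - z by rewrite bE -zE addrC addKr.
      by rewrite subrK; have [[_ EB] _ _ _] := cE k; exact: EB.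
    apply: cclass_eq => //; exists (u - dif F c) => //.
    have [_ ->] := sEF _ _ Ec.
    have [_ _ _ dd] := cF (k - 1 - 1).
    by rewrite (difB cF Fu (Fd _ _ Fc)) (dd _ Fc) subr0 bE -zE addrC addKr.
  + move=> _ [z [Fz dz] <-].
    have [|c Fc Ec] := ret k z Fz.
      by rewrite dz; have [[]] := cE (k + 1).
    exists (cclass E k (z - dif F c)).
      exists (z - dif F c) => //; split => //; have [_ ->] := sEF _ _ Ec.
      have [_ _ _ dd] := cF (k - 1).
      by rewrite (difB cF Fz (Fd _ _ Fc)) dz (dd _ Fc) subr0.
    rewrite phiE; apply: cclass_eq => //; exists c => //.
    by rewrite opprB addrCA subrr addr0.
- by move=> _ _ [z _ <-] [w _ <-]; rewrite cclassD// !phiE cclassD.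
Qed.

End Subcomplex.

(** * The double complex *)

(* A bicochain is itself a function of the bidegree. *)
Local Arguments tot_delta {R n X} U a p q J x v.
Local Arguments tot_d {R n X} U a p q J x v.
Local Arguments tot_D {R n X} U a p q J x v.

Section DoubleComplex.
Context {R : realType} {n : nat} {X : topologicalType} (U : good_atlas R n X).
Local Notation V := (vert U).
Local Notation E := 'rV[R]_n.
Local Notation Ominv I := (Omega_inv (dom (U I)) (grp (U I))).
Local Notation delta := (@delta _ _ _ U _ _).
Local Notation Cbar := (@Cbar _ _ _ U _ _).

Lemma extd_sum (D : set E) q m (c : 'I_m -> R) (F : 'I_m -> dform R n q) x v : open D ->
  (forall i, Omega D (F i)) ->
  extd D (fun x v => \sum_(i < m) c i * F i x v) x v = \sum_(i < m) c i * extd D (F i) x v.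
Proof.
move=> oD OF; have [Dx|Dx] := pselect (D x); last first.
  by rewrite /extd memNset// big1// => i _; rewrite mulr0.
under [RHS]eq_bigr do rewrite extdE// mulr_sumr.
rewrite extdE// exchange_big /=; apply: eq_bigr => i _.
under eq_bigr do rewrite mulrCA.
rewrite -mulr_sumr; congr (_ * _).
have D1 k : is_derive x (v i) (fun y => F k y (v \o lift i)) ('D_(v i) (fun y => F k y (v \o lift i)) x).
  have [_ _ sF _] := (OmegaP D (F k)).1 (OF k).
  exact: Ck_derive (v i) (sF (v \o lift i) 1%N) Dx.
rewrite (_ : (fun y => _) = \sum_(k < m) (fun y => c k * F k y (v \o lift i))).
  by have [_ ->] := is_derive_sum (fun k => is_deriveZ (c k) (D1 k)).
by apply: funext => y; rewrite fct_sumE.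
Qed.

Lemma extdZD (D : set E) q c (w1 w2 : dform R n q) x v : open D -> Omega D w1 -> Omega D w2 ->
  extd D (fun x v => c * w1 x v + w2 x v) x v = c * extd D w1 x v + extd D w2 x v.
Proof.
move=> oD O1 O2.
pose C (i : 'I_2) := if i == ord0 then c else 1.
pose F (i : 'I_2) := if i == ord0 then w1 else w2.
have -> : (fun x v => c * w1 x v + w2 x v) = (fun x v => \sum_(i < 2) C i * F i x v).
  by apply: funext => y; apply: funext => z; rewrite big_ord_recl big_ord1 /C /F /= mul1r.
rewrite extd_sum//; last by move=> i; rewrite /F; case: ifP.
by rewrite big_ord_recl big_ord1 /C /F /= mul1r.
Qed.

Lemma extdN (D : set E) q (w : dform R n q) x v : open D -> Omega D w ->
  extd D (fun x v => - w x v) x v = - extd D w x v.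
Proof.
move=> oD Ow.
have -> : (fun x v => - w x v) = (fun x v => \sum_(i < 1) (-1) * w x v).
  by apply: funext => y; apply: funext => z; rewrite big_ord1 mulN1r.
by rewrite extd_sum// big_ord1 mulN1r.
Qed.

Lemma extd0 (D : set E) q x v : extd D ((fun _ _ => 0) : dform R n q) x v = 0.
Proof.
rewrite /extd; case: ifP => // _; apply: big1 => i _.
by rewrite (_ : (fun y => _) = cst 0) ?derive_cst ?mulr0.
Qed.

Lemma dform_oppE q (w : dform R n q) x v : (- w) x v = - w x v.
Proof. by []. Qed.

Definition cochain_d p q (a : cochain R n V p q) : cochain R n V p q.+1 :=
  fun J => extd (dom (U (cup J))) (a J).

Lemma restr_sum (I J : Fin V) q m (c : 'I_m -> R) (F : 'I_m -> dform R n q) x v :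
  restr I J (fun x v => \sum_(i < m) c i * F i x v) x v = \sum_(i < m) c i * restr I J (F i) x v.
Proof.
by rewrite /restr /pullback; case: ifP => // _; rewrite big1// => i _; rewrite mulr0.
Qed.

Lemma Cbar0 p q : Cbar ((fun _ _ _ => 0) : cochain R n V p q).
Proof.
split=> [J|j k J _]; first exact: Omega_inv0.
by apply: funext => x; apply: funext => v; rewrite /= oppr0.
Qed.

Lemma CbarZD p q c (a b : cochain R n V p q) : Cbar a -> Cbar b ->
  Cbar (fun J x v => c * a J x v + b J x v).
Proof.
move=> [Oa sa] [Ob sb]; split=> [J|j k J jk]; first exact: Omega_invZD.
apply: funext => x; apply: funext => v; rewrite (sa _ _ _ jk) (sb _ _ _ jk).
by rewrite !dform_oppE mulrN opprD.
Qed.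

Lemma delta_ZD p q c (a b : cochain R n V p q) J x v :
  delta (fun J x v => c * a J x v + b J x v) J x v = c * delta a J x v + delta b J x v.
Proof.
rewrite /Defs.delta mulr_sumr -big_split; apply: eq_bigr => k _ /=.
by rewrite restr_pointD restr_pointZ mulrDr mulrCA.
Qed.

Lemma delta0 p q J x v : delta ((fun _ _ _ => 0) : cochain R n V p q) J x v = 0.
Proof. by rewrite /Defs.delta big1// => k _; rewrite restr_point0 mulr0. Qed.

Lemma delta_Cbar p q (a : cochain R n V p q) : Cbar a -> Cbar (delta a).
Proof.
move=> [Oa sa]; split=> [J|j k J jk].
  apply: Omega_inv_sum => k; apply: Omega_invZ.
  by apply: restr_Omega_inv => //; exact: supp_cup_face.
apply: funext => x; apply: funext => v.
rewrite dform_oppE /Defs.delta cup_swap.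
pose Phi (_ : Fin V) (u : MFin V p) := restr (cup J) (cup u) (a u) x v.
have Phi_anti t : antisym (Phi t).
  move=> u i l il; rewrite /Phi -[u \o _]/(swap i l u) cup_swap (sa _ _ u il).
  rewrite -[RHS]mulN1r -restr_pointZ; congr (restr _ _ _ _ _).
  by apply: funext => y; apply: funext => z; rewrite mulN1r opprK.
apply: oppr_inj; rewrite opprK; symmetry; exact: antisym_face_sum Phi_anti J j k jk.
Qed.

Lemma delta_delta p q (a : cochain R n V p q) J x v : Cbar a -> delta (delta a) J x v = 0.
Proof.
move=> [Oa _].
pose Psi (_ _ : Fin V) (u : MFin V p) := restr (cup J) (cup u) (a u) x v.
rewrite -[RHS](face_face_sum (Psi := Psi) J)//; apply: eq_bigr => k _.
rewrite [X in _ * X]restr_sum mulr_sumr; apply: eq_bigr => l _; congr (_ * (_ * _)).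
by rewrite restr_restr//; exact: supp_cup_face.
Qed.

Lemma cochain_d_Cbar p q (a : cochain R n V p q) : Cbar a -> Cbar (cochain_d a).
Proof.
move=> [Oa sa]; split=> [J|j k J jk]; first exact: extd_Omega_inv.
apply: funext => x; apply: funext => v; rewrite /cochain_d cup_swap (sa _ _ _ jk).
have Oopp : Ominv (cup J) (a (swap j k J)) by rewrite -(cup_swap J j k).
rewrite -[- a _]/(fun x v => - a (swap j k J) x v).
by rewrite dform_oppE extdN//; [exact: dom_open | case: Oopp].
Qed.

Lemma cochain_d_ZD p q c (a b : cochain R n V p q) J x v : Cbar a -> Cbar b ->
  cochain_d (fun J x v => c * a J x v + b J x v) J x v = c * cochain_d a J x v + cochain_d b J x v.
Proof.
move=> [Oa _] [Ob _]; rewrite /cochain_d extdZD//; first exact: dom_open.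
- by case: (Oa J).
- by case: (Ob J).
Qed.

Lemma cochain_d_d p q (a : cochain R n V p q) J x v : Cbar a -> cochain_d (cochain_d a) J x v = 0.
Proof. by move=> [/(_ J)[Oa _] _]; rewrite /cochain_d extd_extd//; exact: dom_open. Qed.

Lemma cochain_d0 p q J x v : cochain_d ((fun _ _ _ => 0) : cochain R n V p q) J x v = 0.
Proof. exact: extd0. Qed.

Lemma cochain_d_delta p q (a : cochain R n V p q) J x v : Cbar a ->
  cochain_d (delta a) J x v = delta (cochain_d a) J x v.
Proof.
move=> [Oa _]; rewrite /cochain_d /Defs.delta extd_sum; last 2 first.
- exact: dom_open.
- by move=> k; have [] := restr_Omega_inv (@supp_cup_face _ _ _ U p J k) (Oa (face k J)).
by apply: eq_bigr => k _; rewrite extd_restr//; exact: supp_cup_face.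
Qed.

Local Notation B := (bicochain R n V).
Implicit Types a b : B.

Lemma tot_d_Cbar a p q : (forall p q, Cbar (a p q)) -> Cbar (tot_d U a p q).
Proof. by move=> Ca; case: q => [|q]; [exact: Cbar0 | exact: cochain_d_Cbar]. Qed.

Lemma tot_delta_Cbar a p q : (forall p q, Cbar (a p q)) -> Cbar (tot_delta U a p q).
Proof. by move=> Ca; case: p => [|p]; [exact: Cbar0 | exact: delta_Cbar]. Qed.

Lemma tot_DE a p q : tot_D U a p q =
  fun J x v => (-1) ^+ p * tot_d U a p q J x v + tot_delta U a p q J x v.
Proof. by do 3 apply: funext => ?; rewrite addrC. Qed.

Lemma tot_D_Cbar a p q : (forall p q, Cbar (a p q)) -> Cbar (tot_D U a p q).
Proof.
by move=> Ca; rewrite tot_DE; apply: CbarZD; [exact: tot_d_Cbar | exact: tot_delta_Cbar].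
Qed.

Lemma tot_delta_delta a p q J x v : (forall p q, Cbar (a p q)) ->
  tot_delta U (tot_delta U a) p q J x v = 0.
Proof.
by move=> Ca; case: p J => [|[|p]] J //; [exact: delta0 | exact: delta_delta].
Qed.

Lemma tot_d_d a p q J x v : (forall p q, Cbar (a p q)) -> tot_d U (tot_d U a) p q J x v = 0.
Proof.
by move=> Ca; case: q v => [|[|q]] v //; [exact: cochain_d0 | exact: cochain_d_d].
Qed.

Lemma tot_d_delta a p q J x v : (forall p q, Cbar (a p q)) ->
  tot_d U (tot_delta U a) p q J x v = tot_delta U (tot_d U a) p q J x v.
Proof.
move=> Ca; case: q v => [|q] v; case: p J => [|p] J //.
- by symmetry; exact: delta0.
- exact: cochain_d0.
- exact: cochain_d_delta.
Qed.

Lemma tot_delta_ZD c a b p q J x v :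
  tot_delta U (fun p q J x v => c * a p q J x v + b p q J x v) p q J x v =
  c * tot_delta U a p q J x v + tot_delta U b p q J x v.
Proof. by case: p J => [|p] J; [rewrite /= mulr0 addr0 | exact: delta_ZD]. Qed.

Lemma tot_d_ZD c a b p q J x v : (forall p q, Cbar (a p q)) -> (forall p q, Cbar (b p q)) ->
  tot_d U (fun p q J x v => c * a p q J x v + b p q J x v) p q J x v =
  c * tot_d U a p q J x v + tot_d U b p q J x v.
Proof.
by move=> Ca Cb; case: q v => [|q] v; [rewrite /= mulr0 addr0 | exact: cochain_d_ZD].
Qed.

Lemma tot_delta_tot_D a p q J x v : (forall p q, Cbar (a p q)) ->
  tot_delta U (tot_D U a) p q J x v = - (-1) ^+ p * tot_delta U (tot_d U a) p q J x v.
Proof.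
move=> Ca; case: p J => [|p] J; first by rewrite /= mulr0.
rewrite -[LHS]/(delta (tot_D U a p q) J x v) tot_DE delta_ZD.
rewrite -[delta (tot_delta U a p q) J x v]/(tot_delta U (tot_delta U a) p.+1 q J x v) tot_delta_delta//.
by rewrite addr0 exprS mulN1r opprK.
Qed.

Lemma tot_d_tot_D a p q J x v : (forall p q, Cbar (a p q)) ->
  tot_d U (tot_D U a) p q J x v = tot_delta U (tot_d U a) p q J x v.
Proof.
move=> Ca; case: q v => [|q] v.
  by case: p J => [|p] J //; symmetry; exact: delta0.
rewrite -[LHS]/(cochain_d (tot_D U a p q) J x v) tot_DE cochain_d_ZD; [|exact: tot_d_Cbar|exact: tot_delta_Cbar].
rewrite -[cochain_d (tot_d U a p q) J x v]/(tot_d U (tot_d U a) p q.+1 J x v) tot_d_d// mulr0 add0r.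
by rewrite -[LHS]/(tot_d U (tot_delta U a) p q.+1 J x v) tot_d_delta.
Qed.

Lemma tot_D_tot_D a : (forall p q, Cbar (a p q)) -> tot_D U (tot_D U a) = 0.
Proof.
move=> Ca; apply: bc_ext => p q J x v.
rewrite -[LHS]/(tot_delta U (tot_D U a) p q J x v + (-1) ^+ p * tot_d U (tot_D U a) p q J x v).
by rewrite tot_delta_tot_D// tot_d_tot_D// mulNr addNr.
Qed.

Lemma bcDE a b : a + b = fun p q J x v => 1 * a p q J x v + b p q J x v.
Proof. by apply: bc_ext => *; rewrite mul1r. Qed.

Lemma bcBE a b : a - b = fun p q J x v => (-1) * b p q J x v + a p q J x v.
Proof. by apply: bc_ext => *; rewrite mulN1r addrC. Qed.

Lemma tot_D_D a b : (forall p q, Cbar (a p q)) -> (forall p q, Cbar (b p q)) ->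
  tot_D U (a + b) = tot_D U a + tot_D U b.
Proof.
move=> Ca Cb; rewrite bcDE; apply: bc_ext => p q J x v.
rewrite /tot_D tot_delta_ZD tot_d_ZD//.
rewrite -[RHS]/(tot_D U a p q J x v + tot_D U b p q J x v) /tot_D.
by ring.
Qed.

Lemma tot_delta_eq0 a p q J x v : (forall p', p = p'.+1 -> a p' q = 0) ->
  tot_delta U a p q J x v = 0.
Proof. by case: p J => [|p] J a0 //; rewrite /= a0//; exact: delta0. Qed.

Lemma tot_d_eq0 a p q J x v : (forall q', q = q'.+1 -> a p q' = 0) ->
  tot_d U a p q J x v = 0.
Proof. by case: q v => [|q] v a0 //; rewrite /= a0//; exact: cochain_d0. Qed.

Lemma bcB_eq0 a b p q : a p q = 0 -> b p q = 0 -> (a - b) p q = 0.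
Proof.
move=> a0 b0; do 3 apply: funext => ?.
by rewrite -[LHS]/(a p q _ _ _ - b p q _ _ _) a0 b0 subrr.
Qed.

Lemma Tot_Cbar k a : Tot U k a -> forall p q, Cbar (a p q).
Proof. by move=> Ta p q; have [] := Ta p q. Qed.

Lemma Tot_eq0 k a p q : Tot U k a -> (p + q)%:Z <> k -> a p q = 0.
Proof. by move=> Ta; have [_] := Ta p q. Qed.

Lemma Tot_is_complex : is_complex (Tot U).
Proof.
move=> k; split.
- split=> [p q|a b Ta Tb p q]; first by split => //; exact: Cbar0.
  split=> [|pq]; first by rewrite bcBE; apply: CbarZD; [exact: Tot_Cbar Tb _ _|exact: Tot_Cbar Ta _ _].
  by rewrite bcB_eq0// (Tot_eq0 _ pq).
- by move=> a b Ta Tb; apply: tot_D_D; exact: Tot_Cbar.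
- move=> a Ta p q; split; first by apply: tot_D_Cbar; exact: Tot_Cbar Ta.
  move=> pq; do 3 apply: funext => ?; rewrite /= /tot_D tot_delta_eq0 ?tot_d_eq0 ?mulr0 ?addr0//.
    by move=> q' qE; apply: (Tot_eq0 Ta) => H; apply: pq; rewrite qE -H; lia.
  by move=> p' pE; apply: (Tot_eq0 Ta) => H; apply: pq; rewrite pE -H; lia.
- by move=> a Ta; apply: tot_D_tot_D; exact: Tot_Cbar.
Qed.

(** * Global forms *)

Lemma MFin0 (J : MFin V 0) : J = fun=> J ord0.
Proof. by apply: funext => i; rewrite ord1. Qed.

Lemma OmegaBar_Cbar q (a : cochain R n V 0 q) :
  @OmegaBar _ _ _ U q (fun I => a (fun=> I)) -> Cbar a.
Proof.
move=> [Oa _]; split=> [J|j k J]; last by rewrite !ord1.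
by rewrite (MFin0 J) cup_const.
Qed.

(** Both faces of a string of length two restrict to the form on the chart of
    the union, with opposite signs. *)
Lemma OmegaBar_delta q (a : cochain R n V 0 q) J x v :
  @OmegaBar _ _ _ U q (fun I => a (fun=> I)) -> delta a J x v = 0.
Proof.
move=> [_ Ea]; pose b I := a (fun=> I).
have H k : restr (cup J) (cup (face k J)) (a (face k J)) = b (cup J).
  have sk := @supp_cup_face _ _ _ U _ J k; move: sk; rewrite (MFin0 (face k J)) cup_const => sk.
  exact: Ea (restr_embedding sk).
by rewrite /Defs.delta big_ord_recl big_ord1 !H /= expr0 expr1 mul1r mulN1r subrr.
Qed.

Lemma OmegaBarZD q c (a b : Fin V -> dform R n q) : @OmegaBar _ _ _ U q a -> @OmegaBar _ _ _ U q b ->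
  @OmegaBar _ _ _ U q (fun I x v => c * a I x v + b I x v).
Proof.
move=> [Oa Ea] [Ob Eb]; split=> [I|I J l el]; first exact: Omega_invZD.
apply: funext => x; apply: funext => v; rewrite -(Ea _ _ _ el) -(Eb _ _ _ el) /pullback.
by case: ifP => // _; rewrite mulr0 addr0.
Qed.

Lemma OmegaBar0 q : @OmegaBar _ _ _ U q (fun _ _ _ => 0).
Proof.
split=> [I|I J l _]; first exact: Omega_inv0.
by apply: funext => x; apply: funext => v; rewrite /pullback; case: ifP.
Qed.

Lemma OmegaBar_extd q (a : Fin V -> dform R n q) : @OmegaBar _ _ _ U q a ->
  @OmegaBar _ _ _ U q.+1 (fun I => extd (dom (U I)) (a I)).
Proof.
move=> [Oa Ea]; split=> [I|I J l el]; first exact: extd_Omega_inv.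
have [sl _ _ lc _] := el.
rewrite -(Ea _ _ _ el) (extd_pullback (@dom_open _ _ _ (U I)) (@dom_open _ _ _ (U J)) lc sl)//.
by case: (Oa J).
Qed.

Lemma OmegaBar_complex_form k a q : OmegaBar_complex U k a ->
  @OmegaBar _ _ _ U q (fun I => a 0%N q (fun=> I)).
Proof. by move=> /(_ 0%N q)[Oa _]; exact: Oa. Qed.

Lemma OmegaBar_complex_eq0 k a p q : OmegaBar_complex U k a ->
  ~ (p = 0%N /\ q%:Z = k) -> a p q = 0.
Proof. by move=> Ea; have [] := Ea p q. Qed.

Lemma OmegaBar_complex_Cbar k a : OmegaBar_complex U k a -> forall p q, Cbar (a p q).
Proof.
move=> Ea [|p] q; first exact/OmegaBar_Cbar/OmegaBar_complex_form/Ea.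
by rewrite (OmegaBar_complex_eq0 Ea) => [|[]//]; exact: Cbar0.
Qed.

Lemma OmegaBar_subcomplex : subcomplex (OmegaBar_complex U) (Tot U).
Proof.
move=> k a Ea; split.
  move=> p q; split; first exact: OmegaBar_complex_Cbar Ea p q.
  by move=> pq; apply: (OmegaBar_complex_eq0 Ea) => -[p0 qk]; apply: pq; rewrite p0.
apply: bc_ext => p q J x v.
rewrite -[RHS]/(tot_delta U a p q J x v + (-1) ^+ p * tot_d U a p q J x v).
have -> : tot_delta U a p q J x v = 0.
  case: p J => [|[|p]] J //; first exact/OmegaBar_delta/OmegaBar_complex_form/Ea.
  by apply: tot_delta_eq0 => _ [<-]; apply: (OmegaBar_complex_eq0 Ea) => -[].
rewrite add0r; case: p J => [|p] J; first by rewrite expr0 mul1r.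
rewrite -[LHS]/(tot_d U a p.+1 q J x v).
have -> : tot_d U a p.+1 q J x v = 0; last by rewrite mulr0.
by apply: tot_d_eq0 => q' _; apply: (OmegaBar_complex_eq0 Ea) => -[].
Qed.

Lemma OmegaBar_is_complex : is_complex (OmegaBar_complex U).
Proof.
move=> k; split.
- split=> [p q|a b Ea Eb p q]; first by split=> // _; exact: OmegaBar0.
  split=> [_|pq]; last by rewrite bcB_eq0// (OmegaBar_complex_eq0 _ pq).
  by rewrite bcBE; apply: OmegaBarZD; [exact: OmegaBar_complex_form Eb|exact: OmegaBar_complex_form Ea].
- move=> a b Ea Eb; rewrite bcDE; apply: bc_ext => p q J x v.
  rewrite -[RHS]/(tot_d U a p q J x v + tot_d U b p q J x v).
  rewrite -[LHS]/(tot_d U (fun p q J x v => 1 * a p q J x v + b p q J x v) p q J x v).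
  by rewrite tot_d_ZD ?mul1r//; exact: OmegaBar_complex_Cbar.
- move=> a Ea p q; split.
    move=> _; case: q => [|q]; first exact: OmegaBar0.
    have := OmegaBar_extd (@OmegaBar_complex_form k a q Ea).
    rewrite (_ : (fun I => extd _ _) = fun I => tot_d U a 0%N q.+1 (fun=> I))//.
    by apply: funext => I; rewrite /= cup_const.
  move=> pq; do 3 apply: funext => ?; apply: tot_d_eq0 => q' qE.
  by apply: (OmegaBar_complex_eq0 Ea) => -[p0 qk]; apply: pq; split=> //; rewrite qE -qk; lia.
- move=> a Ea; apply: bc_ext => p q J x v.
  by rewrite -[LHS]/(tot_d U (tot_d U a) p q J x v) tot_d_d//; exact: OmegaBar_complex_Cbar.
Qed.

(** * Integral cochains *)

Lemma CbarZZD p (c : int) (a b : cochain R n V p 0) : @CbarZ _ _ _ U p a -> @CbarZ _ _ _ U p b ->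
  @CbarZ _ _ _ U p (fun J x v => c%:~R * a J x v + b J x v).
Proof.
move=> [Ca Za] [Cb Zb]; split=> [|J]; first exact: CbarZD.
have [m am] := Za J; have [m' bm] := Zb J.
by exists (c * m + m') => x v cx; rewrite am// bm// rmorphD rmorphM.
Qed.

Lemma CbarZ0 p : @CbarZ _ _ _ U p (fun _ _ _ => 0).
Proof. by split=> [|J]; [exact: Cbar0 | exists 0]. Qed.

Lemma CbarZ_delta p (a : cochain R n V p 0) : @CbarZ _ _ _ U p a -> @CbarZ _ _ _ U p.+1 (delta a).
Proof.
move=> [Ca Za]; split=> [|J]; first exact: delta_Cbar.
have Zk k : exists m : int, forall x v, dom (U (cup (face k J))) x -> a (face k J) x v = m%:~R.
  exact: Za.
exists (\sum_(k < p.+2) (-1) ^+ k * projT1 (cid (Zk k))) => x v cx.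
rewrite rmorph_sum; apply: eq_bigr => k _; rewrite rmorphM rmorphXn rmorphN rmorph1.
congr (_ * _); case: cid => m /= am.
have [_ _ _ lc _] := restr_embedding (@supp_cup_face _ _ _ U _ J k).
by rewrite /restr /pullback mem_set// am//; exact: lc.
Qed.

Lemma CbarZ_cochain_d p (a : cochain R n V p 0) J x v : @CbarZ _ _ _ U p a -> cochain_d a J x v = 0.
Proof.
move=> [_ /(_ J)[m am]]; rewrite /cochain_d /extd; case: ifPn => // /set_mem cx.
apply: big1 => i _; rewrite (@near_eq_derive _ _ _ _ (cst (m%:~R : R))) ?derive_cst ?mulr0//.
by apply: filterS (open_nbhs_nbhs (conj (@dom_open _ _ _ (U (cup J))) cx)) => y cy; rewrite am.
Qed.

Lemma CbarZ_complex_form k a p : CbarZ_complex U k a -> @CbarZ _ _ _ U p (a p 0%N).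
Proof. by move=> Za; have [] := Za p 0%N. Qed.

Lemma CbarZ_complex_eq0 k a p q : CbarZ_complex U k a -> ~ (p%:Z = k /\ q = 0%N) -> a p q = 0.
Proof. by move=> Za; have [] := Za p q. Qed.

Lemma CbarZ_complex_Cbar k a : CbarZ_complex U k a -> forall p q, Cbar (a p q).
Proof.
move=> Za p [|q]; first by have [] := CbarZ_complex_form p Za.
by rewrite (CbarZ_complex_eq0 Za) => [|[]//]; exact: Cbar0.
Qed.

Lemma CbarZ_subcomplex : subcomplex (CbarZ_complex U) (Tot U).
Proof.
move=> k a Za; split.
  move=> p q; split; first exact: CbarZ_complex_Cbar Za p q.
  by move=> pq; apply: (CbarZ_complex_eq0 Za) => -[pk q0]; apply: pq; rewrite q0 addn0.
apply: bc_ext => p q J x v.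
rewrite -[RHS]/(tot_delta U a p q J x v + (-1) ^+ p * tot_d U a p q J x v).
rewrite [X in _ * X](_ : _ = 0) ?mulr0 ?addr0//.
case: q v => [|[|q]] v //; first exact/CbarZ_cochain_d/CbarZ_complex_form/Za.
by apply: tot_d_eq0 => _ [<-]; apply: (CbarZ_complex_eq0 Za) => -[].
Qed.

Lemma CbarZ_is_complex : is_complex (CbarZ_complex U).
Proof.
move=> k; split.
- split=> [p q|a b Za Zb p q]; first by split=> //; exact: CbarZ0.
  split=> [|pq]; last by rewrite bcB_eq0// (CbarZ_complex_eq0 _ pq).
  rewrite bcBE (_ : -1 = (-1)%:~R)//.
  by apply: CbarZZD; [exact: CbarZ_complex_form Zb|exact: CbarZ_complex_form Za].
- move=> a b Za Zb; rewrite bcDE; apply: bc_ext => p q J x v.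
  rewrite -[RHS]/(tot_delta U a p q J x v + tot_delta U b p q J x v).
  rewrite -[LHS]/(tot_delta U (fun p q J x v => 1 * a p q J x v + b p q J x v) p q J x v).
  by rewrite tot_delta_ZD mul1r.
- move=> a Za p q; split.
    by case: p => [|p]; [exact: CbarZ0 | exact/CbarZ_delta/CbarZ_complex_form/Za].
  move=> pq; do 3 apply: funext => ?; apply: tot_delta_eq0 => p' pE.
  by apply: (CbarZ_complex_eq0 Za) => -[pk q0]; apply: pq; split=> //; rewrite pE -pk; lia.
- move=> a Za; apply: bc_ext => p q J x v.
  by rewrite -[LHS]/(tot_delta U (tot_delta U a) p q J x v) tot_delta_delta//; exact: CbarZ_complex_Cbar.
Qed.

(** * Intersection and negative degrees *)

Lemma CbarZ_OmegaBar (k : int) : 0 < k -> CbarZ_complex U k `&` OmegaBar_complex U k = [set 0].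
Proof.
move=> k0; apply/seteqP; split=> [a [Za Ea]|_ ->]; last first.
  by split; [have [[]] := CbarZ_is_complex k | have [[]] := OmegaBar_is_complex k].
apply: bc_ext => p q J x v; have [p0|p0] := pselect (p = 0%N).
  by rewrite (CbarZ_complex_eq0 Za)// => -[pk _]; move: k0; rewrite -pk p0.
by rewrite (OmegaBar_complex_eq0 Ea)// => -[].
Qed.

Lemma complexes_neg (k : int) : k < 0 ->
  [/\ Tot U k = [set 0], OmegaBar_complex U k = [set 0] & CbarZ_complex U k = [set 0]].
Proof.
move=> k0; split; apply/seteqP; split=> [a Ha|_ ->].
- by apply: bc_ext => p q J x v; rewrite (Tot_eq0 Ha)// => H; move: k0; rewrite -H; lia.
- by have [[]] := Tot_is_complex k.
- apply: bc_ext => p q J x v; rewrite (OmegaBar_complex_eq0 Ha)// => -[_ H].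
  by move: k0; rewrite -H; lia.
- by have [[]] := OmegaBar_is_complex k.
- apply: bc_ext => p q J x v; rewrite (CbarZ_complex_eq0 Ha)// => -[H _].
  by move: k0; rewrite -H; lia.
- by have [[]] := CbarZ_is_complex k.
Qed.

(** * From the total complex to global forms *)

(** The cocycle condition on the string I J lives on the chart of the union, and
    a local lift of x to that chart brings it to the chart of I. Since transfers
    compare any two lifts, this covers every embedding of I into J and not only
    the chosen ones that enter in delta. *)
Lemma delta_eq0_OmegaBar q (b : cochain R n V 0 q) : Cbar b -> delta b = (fun _ _ _ => 0) ->
  @OmegaBar _ _ _ U q (fun I => b (fun=> I)).
Proof.
move=> [Ob _] db0; have Obc I : Ominv I (b (fun=> I)) by have := Ob (fun=> I); rewrite cup_const.
split=> // I J l el; rewrite (pullback_transfer el (Obc J)).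
apply: funext => x; apply: funext => v.
have [cx|cx] := pselect (dom (U I) x); last first.
  rewrite transfer0; last by move=> W s [_ Wc _ _ _] /Wc.
  by have [_ _ _ ->] := (Obc I).1.
have [r xr Ir] := dom_proj cx.
have [_ _ _ lc _] := el.
have Jr : supp (U J) r.
  by have [] := @proj_dom _ _ _ (U J) (l x) r; rewrite ?(embedding_proj el cx).
pose S : MFin V 1 := scons I (fun _ : 'I_1 => J).
have Sr : supp (U (cup S)) r by apply/supp_scons; rewrite cup_const.
have [W [s [ls Wx]]] := atlas_lift xr Sr; have [_ _ _ sS sp] := ls.
have term k : restr (cup S) (cup (face k S)) (b (face k S)) (s x) (fun j => 'd s x (v j)) =
    transfer (U (cup (face k S))) (U I) (b (face k S)) x v.
  rewrite restrE; [|exact: supp_cup_face|exact: Ob].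
  have [W' [s' [ls' W's]]] := @atlas_lift _ _ _ U (cup (face k S)) (cup S) (s x) r (etrans (sp x Wx) xr) (supp_cup_face k Sr).
  exact: transfer_lift ls Wx ls' W's (Ob _).
have := congr1 (fun F : cochain R n V 1 q => F S (s x) (fun j => 'd s x (v j))) db0.
rewrite /Defs.delta big_ord_recl big_ord1 !term expr0 expr1 mul1r mulN1r => /eqP.
have -> : face ord0 S = fun=> J by apply: funext => i; rewrite /face /S sconsS.
have -> : face (lift ord0 ord0) S = fun=> I.
  apply: funext => i; rewrite /face /S (ord1 i).
  by rewrite (_ : lift _ _ = ord0 :> 'I_2); [rewrite scons0 | apply: val_inj].
by rewrite !cup_const subr_eq0 transfer_id// => /eqP.
Qed.

Lemma tot_D_delta a k p q : OmegaBar_complex U k (tot_D U a) -> (forall q, a p.+1 q = 0) ->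
  delta (a p q) = (fun _ _ _ => 0).
Proof.
move=> Ea a0; apply: funext => J; apply: funext => x; apply: funext => v.
transitivity (tot_D U a p.+1 q J x v); last by rewrite (OmegaBar_complex_eq0 Ea)// => -[].
by rewrite /tot_D tot_d_eq0 ?mulr0 ?addr0.
Qed.

Hypothesis hsecond : @second_countable X.
Hypothesis hhausdorff : hausdorff_space X.

(** By induction on the largest Cech degree in which b is nonzero. The top
    component is delta-closed because the differential of b is concentrated in
    Cech degree 0, hence it is delta e, and subtracting the total differential
    of e lowers the degree. In Cech degree 0 a delta-closed cochain is a global
    form. *)
Lemma zigzag m (k : int) b : Tot U k b -> OmegaBar_complex U (k + 1) (tot_D U b) ->
  (forall p q, (m < p)%N -> b p q = 0) ->
  exists2 c, Tot U (k - 1) c & OmegaBar_complex U k (b - tot_D U c).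
Proof.
elim: m b => [|m IH] b Tb Eb bm.
  exists 0; first by have [[]] := Tot_is_complex (k - 1).
  rewrite -[tot_D U 0]/(dif (Tot U) 0) (dif0 k Tot_is_complex) subr0 => p q; split.
    move=> _; apply: delta_eq0_OmegaBar; first exact: Tot_Cbar Tb _ _.
    by apply: (tot_D_delta _ Eb) => q'; exact: bm.
  move=> pq; case: p pq => [|p] pq; last exact: bm.
  by apply: (Tot_eq0 Tb) => H; apply: pq.
have db q : delta (b m.+1 q) = (fun _ _ _ => 0).
  by apply: (tot_D_delta _ Eb) => q'; exact: bm.
have ex p q : exists e : cochain R n V p q, [/\ Cbar e, p = m -> delta e = b p.+1 q,
    p <> m -> e = 0 & b p.+1 q = 0 -> e = 0].
  have [pm|pm] := pselect (p = m); last by exists 0; split=> //; exact: Cbar0.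
  have [b0|b0] := pselect (b p.+1 q = 0).
    exists 0; split=> //; first exact: Cbar0.
    by move=> _; rewrite b0; do 3 apply: funext => ?; exact: delta0.
  rewrite pm in b0 *; have [e Ce de] := cech_exact hsecond hhausdorff (Tot_Cbar Tb m.+1 q) (db q).
  by exists e; split.
(* the last condition on e keeps c in total degree k - 1 *)
pose c : B := fun p q => projT1 (cid (ex p q)).
have cP p q : [/\ Cbar (c p q), p = m -> delta (c p q) = b p.+1 q,
    p <> m -> c p q = 0 & b p.+1 q = 0 -> c p q = 0] by rewrite /c; case: cid.
have Tc : Tot U (k - 1) c.
  move=> p q; have [Cc _ _ c0] := cP p q; split=> // pq; apply: c0.
  by apply: (Tot_eq0 Tb) => H; apply: pq; rewrite -H; lia.
have [[_ TB] _ _ _] := Tot_is_complex k.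
have TDc : Tot U k (tot_D U c).
  by have [_ _ + _] := Tot_is_complex (k - 1); rewrite subrK; apply.
have DB : tot_D U (b - tot_D U c) = tot_D U b.
  rewrite -[LHS]/(dif (Tot U) _) (difB Tot_is_complex Tb TDc).
  have -> : dif (Tot U) (tot_D U c) = 0 by apply: tot_D_tot_D; exact: Tot_Cbar Tc.
  by rewrite subr0.
have [|||c' Tc' Ec'] := IH (b - tot_D U c).
- exact: TB.
- by rewrite DB.
- case=> [|p] q // mp; do 3 apply: funext => ?.
  rewrite -[LHS]/(b p.+1 q _ _ _ - (delta (c p q) _ _ _ + (-1) ^+ p.+1 * tot_d U c p.+1 q _ _ _)).
  rewrite tot_d_eq0 ?mulr0 ?addr0; last first.
    by move=> q' _; have [_ _ -> //] := cP p.+1 q'; lia.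
  have [_ cm c0 _] := cP p q; have [pm|pm] := pselect (p = m); first by rewrite cm// subrr.
  rewrite (bm p.+1); last by lia.
  by rewrite c0// delta0 subr0.
exists (c + c').
  by have [sT _ _ _] := Tot_is_complex (k - 1); exact: subgroupD sT Tc Tc'.
rewrite tot_D_D; [|exact: Tot_Cbar Tc|exact: Tot_Cbar Tc'].
by rewrite opprD addrA.
Qed.

End DoubleComplex.

Theorem theorem4p3 (R : realType) (n : nat) (X : topologicalType)
  (hparacompact : paracompact X) (hsecond : @second_countable X)
  (hhausdorff : hausdorff_space X) (U : good_atlas R n X) :
  spark_complex (Tot U) (OmegaBar_complex U) (CbarZ_complex U).
Proof.
split; first by split; [exact: Tot_is_complex|exact: OmegaBar_is_complex|exact: CbarZ_is_complex].
split.
- by split; [exact: OmegaBar_subcomplex | exact: CbarZ_subcomplex].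
- exact: CbarZ_OmegaBar.
- exact: complexes_neg.
apply: cohomology_iso_of_retraction.
- exact: OmegaBar_is_complex.
- exact: Tot_is_complex.
- exact: OmegaBar_subcomplex.
move=> k b Tb Eb; apply: (zigzag hsecond hhausdorff (m := `|k|%N)) => // p q kp.
by apply: (Tot_eq0 Tb); lia.
Qed.
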